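(* Let $G$ be a locally compact group. Then ${\cal C}_0(G)$ is an injective Banach $M(G)$-bimodule if and only if $G$ is finite.
   Context: $M(G)$ is the measure algebra of $G$ (bounded complex regular Borel measures with convolution), identified with the dual of ${\cal C}_0(G)$. ${\cal C}_0(G)$ is a Banach $M(G)$-bimodule as a closed sub-bimodule of $M(G)^\ast$, i.e. $\langle\mu,\nu\cdot f\rangle=\langle\mu\ast\nu,f\rangle$ and $\langle\mu,f\cdot\nu\rangle=\langle\nu\ast\mu,f\rangle$ for $\mu,\nu\in M(G)$, $f\in{\cal C}_0(G)$; explicitly $(\nu\cdot f)(x)=\int f(xy)\,d\nu(y)$ and $(f\cdot\nu)(x)=\int f(yx)\,d\nu(y)$. Injectivity: for a Banach algebra $\mathfrak{A}$ let $\mathfrak{A}^\#$ be the unconditional unitization (an identity is adjoined whether or not $\mathfrak{A}$ already has one), $\hat{\otimes}$ the projective tensor product. For a Banach $\mathfrak{A}$-bimodule $E$ (actions extended canonically to $\mathfrak{A}^\#$), the space ${\cal B}(\mathfrak{A}^\#\hat{\otimes}\mathfrak{A}^\#,E)$ of bounded linear maps is a Banach $\mathfrak{A}$-bimodule via $(a\cdot T)(x\otimes y)=T(xa\otimes y)$, $(T\cdot a)(x\otimes y)=T(x\otimes ay)$, and $\iota:E\to{\cal B}(\mathfrak{A}^\#\hat{\otimes}\mathfrak{A}^\#,E)$, $\iota(x)(a\otimes b)=a\cdot x\cdot b$, is an $\mathfrak{A}$-bimodule homomorphism. $E$ is called injective if $\iota$ has a bounded left inverse which is an $\mathfrak{A}$-bimodule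 homomorphism. *)

(* Defs.v *)
From HB Require Import structures.
From mathcomp Require Import all_boot all_order all_algebra.
From mathcomp Require Import all_classical all_reals all_analysis.
From mathcomp Require Import measurable_realfun complex ring.

Set Implicit Arguments.
Unset Strict Implicit.
Unset Printing Implicit Defensive.

Import Order.TTheory GRing.Theory Num.Theory.
Import numFieldNormedType.Exports.

Local Open Scope classical_set_scope.
Local Open Scope ring_scope.
Local Open Scope complex_scope.

(* The norm of a space over R[i] takes its values in R[i]; [rnorm] is the same
   norm read as an element of R. *)
Definition rnorm (R : realType) (V : normedZmodType R[i]) (x : V) : R :=
  complex.Re `|x|.

Section rnorm_theory.
Context (R : realType) (V : normedZmodType R[i]).
Implicit Types x y : V.

Lemma rnormE x : `|x| = (rnorm x)%:C.
Proof.
have := normr_ge0 x; rewrite /rnorm; case: `|x| => a b.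
by rewrite lecE /= => /andP[/eqP -> _].
Qed.

Lemma rnorm_ge0 x : 0 <= rnorm x.
Proof. by rewrite -(ler0c (rnorm x)) -rnormE normr_ge0. Qed.

Lemma rnormD x y : rnorm (x + y) <= rnorm x + rnorm y.
Proof. by rewrite -lecR rmorphD /= -!rnormE ler_normD. Qed.

Lemma rnormN x : rnorm (- x) = rnorm x.
Proof. by rewrite /rnorm normrN. Qed.

Lemma rnorm0_eq0 x : rnorm x = 0 -> x = 0.
Proof. by move=> x0; apply: normr0_eq0; rewrite rnormE x0. Qed.

Lemma rnorm0 : rnorm (0 : V) = 0.
Proof. by rewrite /rnorm normr0. Qed.

Lemma rnorm_sum I (r : seq I) (P : pred I) (f : I -> V) :
  rnorm (\sum_(i <- r | P i) f i) <= \sum_(i <- r | P i) rnorm (f i).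
Proof.
elim/big_ind2 : _ => //; first by rewrite rnorm0.
by move=> a b c d ab cd; rewrite (le_trans (rnormD _ _))// lerD.
Qed.

End rnorm_theory.

Lemma rnormZ (R : realType) (V : normedModType R[i]) (c : R[i]) (x : V) :
  rnorm (c *: x) = rnorm c * rnorm x.
Proof.
by apply: (@complexI R); rewrite -rnormE normrZ !rnormE rmorphM.
Qed.

Lemma rnormM (R : realType) (a b : R[i]) : rnorm (a * b) = rnorm a * rnorm b.
Proof. by apply: (@complexI R); rewrite -rnormE normrM !rnormE rmorphM. Qed.

(* The norm [v |-> sup_{i in D} q i v] attached to a separating, pointwise
   bounded family of seminorms; every concrete norm below has this form. *)
Section sup_norm.
Context (R : realType) (V : lmodType R[i]) (I : Type) (D : set I)
  (q : I -> V -> R).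
Hypothesis D0 : D !=set0.
Hypothesis q_ge0 : forall i v, D i -> 0 <= q i v.
Hypothesis qD : forall i v w, D i -> q i (v + w) <= q i v + q i w.
Hypothesis qZ : forall i c v, D i -> q i (c *: v) = rnorm c * q i v.
Hypothesis q_sep : forall v, (forall i, D i -> q i v = 0) -> v = 0.
Hypothesis q_bnd : forall v, has_ubound [set q i v | i in D].

Definition sup_norm (v : V) : R := sup [set q i v | i in D].

Lemma sup_norm_ub i v : D i -> q i v <= sup_norm v.
Proof. by move=> Di; apply: ub_le_sup; [exact: q_bnd | exists i]. Qed.

Lemma sup_norm_le v M : (forall i, D i -> q i v <= M) -> sup_norm v <= M.
Proof.
move=> vM; apply: ge_sup; first by case: D0 => i Di; exists (q i v), i.
by move=> _ [i Di <-]; exact: vM.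
Qed.

Lemma sup_norm_ge0 v : 0 <= sup_norm v.
Proof. by case: D0 => i Di; rewrite (le_trans (q_ge0 v Di)) ?sup_norm_ub. Qed.

Lemma sup_normD v w : sup_norm (v + w) <= sup_norm v + sup_norm w.
Proof.
by apply: sup_norm_le => i Di; rewrite (le_trans (qD _ _ Di))// lerD// sup_norm_ub.
Qed.

Lemma sup_norm0_eq0 v : sup_norm v = 0 -> v = 0.
Proof.
move=> v0; apply: q_sep => i Di; apply/eqP.
by rewrite eq_le q_ge0// -v0 sup_norm_ub.
Qed.

Lemma sup_normZ c v : sup_norm (c *: v) = rnorm c * sup_norm v.
Proof.
have [->|c0] := eqVneq c 0.
  rewrite scale0r /rnorm normr0 /= mul0r; apply/eqP.
  rewrite eq_le sup_norm_ge0 andbT; apply: sup_norm_le => i Di.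
  by rewrite -(scale0r 0) qZ// /rnorm normr0 mul0r.
have cc0 : 0 < rnorm c.
  by rewrite lt_neqAle rnorm_ge0 andbT eq_sym; apply: contra c0 => /eqP/rnorm0_eq0 ->.
apply/eqP; rewrite eq_le; apply/andP; split.
  by apply: sup_norm_le => i Di; rewrite qZ// ler_pM2l// sup_norm_ub.
rewrite -ler_pdivlMl//; apply: sup_norm_le => i Di.
by rewrite ler_pdivlMl// -qZ// sup_norm_ub.
Qed.

Let nrm v : R[i] := (sup_norm v)%:C.

Lemma sup_normCD v w : nrm (v + w) <= nrm v + nrm w.
Proof. by rewrite /nrm -rmorphD /= lecR sup_normD. Qed.

Lemma sup_normCZ c v : nrm (c *: v) = `|c| * nrm v.
Proof. by rewrite /nrm sup_normZ rnormE rmorphM. Qed.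

Lemma sup_normC0_eq0 v : nrm v = 0 -> v = 0.
Proof. by move=> /(@complexI R) /sup_norm0_eq0. Qed.

End sup_norm.

Section bounded_linear_maps.
Context (R : realType) (X E : normedModType R[i]).

Definition is_blin (T : X -> E) :=
  linear T /\ exists M : R, forall x, rnorm (T x) <= M * rnorm x.

Definition blin_pred : {pred X -> E} := mem [set T | is_blin T].

Record blin := Blin { blin_fun :> X -> E; _ : blin_fun \in blin_pred }.

HB.instance Definition _ := [isSub for blin_fun].
HB.instance Definition _ := [Choice of blin by <:].

Lemma blinP (T : blin) : is_blin T.
Proof. by case: T => T /= /set_mem. Qed.

Lemma blin_submod_closed : submod_closed blin_pred.
Proof.
split=> [|c S T /set_mem[lS [M SM]] /set_mem[lT [N TN]]]; apply/mem_set.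
  split=> [a x y|]; first by rewrite /= scaler0 addr0.
  by exists 0 => x; rewrite rnorm0 mul0r.
split=> [a x y|]; last first.
  exists (rnorm c * M + N) => x; rewrite mulrDl -mulrA.
  rewrite (le_trans (rnormD _ _))// lerD// rnormZ ler_wpM2l// ?rnorm_ge0//.
rewrite !fctE lS lT !scalerDr !scalerA -!addrA; congr (_ + _).
  by rewrite mulrC.
by rewrite addrCA.
Qed.

HB.instance Definition _ := GRing.isSubmodClosed.Build _ _ blin_pred
  blin_submod_closed.
HB.instance Definition _ := [SubChoice_isSubLmodule of blin by <:].

Lemma blin_is_linear (T : blin) : linear T.
Proof. exact: (blinP T).1. Qed.

HB.instance Definition _ (T : blin) :=
  GRing.isLinear.Build R[i] X E *:%R T (blin_is_linear T).

Definition blin_norm (T : blin) : R :=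
  sup_norm [set x : X | rnorm x <= 1] (fun x (T : blin) => rnorm (T x)) T.

Let D0 : [set x : X | rnorm x <= 1] !=set0.
Proof. by exists 0; rewrite /= rnorm0. Qed.

Let q_bnd (T : blin) :
  has_ubound [set rnorm (T x) | x in [set x : X | rnorm x <= 1]].
Proof.
have [_ [M TM]] := blinP T; exists `|M| => _ [x /= x1 <-].
rewrite (le_trans (TM x))// (le_trans (ler_wpM2r (rnorm_ge0 x) (ler_norm M)))//.
by rewrite ler_piMr.
Qed.

Let q_sep (T : blin) :
  (forall x : X, [set x | rnorm x <= 1] x -> rnorm (T x) = 0) -> T = 0.
Proof.
move=> T0; apply/val_inj/funext => x /=.
have [->|x0] := eqVneq x 0; first by rewrite [LHS](linear0 T).
have cx0 : rnorm x != 0 by apply: contra x0 => /eqP/rnorm0_eq0 ->.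
have := T0 ((rnorm x)^-1%:C *: x); rewrite /= linearZ /= !rnormZ.
have -> : rnorm (rnorm x)^-1%:C = (rnorm x)^-1.
  by rewrite /rnorm normc_def /= expr0n /= addr0 sqrtr_sqr ger0_norm// invr_ge0 rnorm_ge0.
rewrite mulVf// => /(_ (lexx _))/eqP; rewrite mulf_eq0 invr_eq0 (negbTE cx0) /=.
by move=> /eqP/rnorm0_eq0.
Qed.

Let q_ge0 (x : X) (T : blin) : [set x : X | rnorm x <= 1] x -> 0 <= rnorm (T x).
Proof. by rewrite rnorm_ge0. Qed.

Let qD (x : X) (S T : blin) : [set x : X | rnorm x <= 1] x ->
  rnorm ((S + T) x) <= rnorm (S x) + rnorm (T x).
Proof. by move=> _; exact: rnormD. Qed.

Let qZ (x : X) (c : R[i]) (T : blin) : [set x : X | rnorm x <= 1] x ->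
  rnorm ((c *: T) x) = rnorm c * rnorm (T x).
Proof. by move=> _; exact: rnormZ. Qed.

HB.instance Definition _ := @Lmodule_isNormed.Build R[i] blin
  (fun T => (blin_norm T)%:C) (sup_normCD D0 qD q_bnd) (sup_normCZ D0 q_ge0 qZ q_bnd)
  (sup_normC0_eq0 q_ge0 q_sep q_bnd).

End bounded_linear_maps.


(* The projective tensor product. The dual of the algebraic tensor product of A
   and B under the projective norm is the space of bounded bilinear forms on
   A x B (isometrically), so its completion is realized as usual inside the
   bidual: as the closure, among functions on the bounded bilinear forms, of
   the finite sums of evaluations [phi |-> phi a b], with the dual norm. *)
Section projective_tensor_product.
Context (R : realType) (A B : normedModType R[i]).

Definition bilin_bounded (phi : A -> B -> R[i]) (M : R) :=
  forall a b, rnorm (phi a b) <= M * (rnorm a * rnorm b).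

Record bbform := BBForm {
  bbform_fun :> A -> B -> R[i];
  bbform_linl : forall b, linear (fun a => bbform_fun a b : R[i]^o);
  bbform_linr : forall a, linear (fun b => bbform_fun a b : R[i]^o);
  bbform_bnd : exists2 M, 0 <= M & bilin_bounded bbform_fun M }.

Lemma bbformZl (phi : bbform) c a b : phi (c *: a) b = c * phi a b.
Proof.
have phi0 : phi 0 b = 0.
  by have := bbform_linl phi b (-1) 0 0; rewrite scaler0 addr0 scaleN1r addNr.
by have := bbform_linl phi b c a 0; rewrite !addr0 phi0 addr0.
Qed.

Lemma bbform_scale_subproof (c : R[i]) (phi : bbform) :
  [/\ forall b, linear (fun a => c * phi a b : R[i]^o),
      forall a, linear (fun b => c * phi a b : R[i]^o) &
      exists2 M, 0 <= M & bilin_bounded (fun a b => c * phi a b) M].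
Proof.
split.
- move=> b k x y; rewrite [phi _ _](bbform_linl phi b k x y) mulrDr.
  by congr (_ + _); rewrite /GRing.scale /= mulrCA.
- move=> a k x y; rewrite [phi _ _](bbform_linr phi a k x y) mulrDr.
  by congr (_ + _); rewrite /GRing.scale /= mulrCA.
have [M M0 phiM] := bbform_bnd phi; exists (rnorm c * M).
  by rewrite mulr_ge0 ?rnorm_ge0.
by move=> a b; rewrite rnormM -mulrA ler_wpM2l ?rnorm_ge0.
Qed.

Definition bbform_scale c phi : bbform :=
  let: And3 l r b := bbform_scale_subproof c phi in BBForm l r b.

Lemma bbform_scaleE c phi a b : bbform_scale c phi a b = c * phi a b.
Proof. by rewrite /bbform_scale; case: bbform_scale_subproof. Qed.

Lemma bbform0_subproof :
  [/\ forall b : B, linear (fun a : A => 0 : R[i]^o),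
      forall a : A, linear (fun b : B => 0 : R[i]^o) &
      exists2 M, 0 <= M & bilin_bounded (fun _ _ => 0) M].
Proof.
split; try by move=> b k x y; rewrite scaler0 addr0.
by exists 0 => // a b; rewrite rnorm0 mul0r.
Qed.

Definition bbform0 : bbform :=
  let: And3 l r b := bbform0_subproof in BBForm l r b.

Lemma bbform0E a b : bbform0 a b = 0.
Proof. by rewrite /bbform0; case: bbform0_subproof. Qed.

Definition ev_sum (s : seq (A * B)) (phi : bbform) : R[i]^o :=
  \sum_(p <- s) phi p.1 p.2.

Definition ptensor_pred : {pred bbform -> R[i]^o} :=
  mem [set t | forall e : R, 0 < e -> exists s : seq (A * B),
    forall (phi : bbform) (M : R), 0 <= M -> bilin_bounded phi M ->
      rnorm (t phi - ev_sum s phi) <= e * M].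

Record ptensor := PTensor {
  ptensor_fun :> bbform -> R[i]^o; _ : ptensor_fun \in ptensor_pred }.

HB.instance Definition _ := [isSub for ptensor_fun].
HB.instance Definition _ := [Choice of ptensor by <:].

Lemma ptensorP (t : ptensor) (e : R) : 0 < e -> exists s : seq (A * B),
  forall (phi : bbform) (M : R), 0 <= M -> bilin_bounded phi M ->
    rnorm (t phi - ev_sum s phi) <= e * M.
Proof. by case: t => t /= /set_mem; exact. Qed.

Lemma ptensor_submod_closed : submod_closed ptensor_pred.
Proof.
split=> [|c t u /set_mem ht /set_mem hu]; apply/mem_set.
  move=> e e0; exists [::] => phi M M0 _.
  by rewrite /ev_sum big_nil subr0 rnorm0 mulr_ge0// ltW.
move=> e e0; have c0 : 0 < rnorm c + 1 by rewrite ltr_wpDl ?rnorm_ge0.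
have [s hs] := ht (e / 2 / (rnorm c + 1)) ltac:(by rewrite !divr_gt0).
have [s' hs'] := hu (e / 2) ltac:(by rewrite divr_gt0).
exists ([seq (c *: p.1, p.2) | p <- s] ++ s') => phi M M0 phiM.
have -> : ev_sum ([seq (c *: p.1, p.2) | p <- s] ++ s') phi =
    c * ev_sum s phi + ev_sum s' phi.
  rewrite /ev_sum big_cat big_map /=; congr (_ + _); rewrite mulr_sumr.
  apply: eq_bigr => p _ /=.
  by rewrite bbformZl.
have -> : (c *: t + u) phi - (c * ev_sum s phi + ev_sum s' phi) =
    c *: (t phi - ev_sum s phi) + (u phi - ev_sum s' phi).
  by rewrite !fctE scalerBr opprD addrACA.
rewrite (splitr e) mulrDl (le_trans (rnormD _ _))// lerD//; last exact: hs'.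
rewrite rnormZ (le_trans (ler_wpM2l (rnorm_ge0 c) (hs phi M M0 phiM)))//.
rewrite mulrA ler_wpM2r// mulrCA ler_piMr ?divr_ge0 ?ltW//.
by rewrite ltr_pdivrMr// mul1r ltrDl.
Qed.

HB.instance Definition _ := GRing.isSubmodClosed.Build _ _ ptensor_pred
  ptensor_submod_closed.
HB.instance Definition _ := [SubChoice_isSubLmodule of ptensor by <:].

Let ball : set bbform := [set phi : bbform | bilin_bounded phi 1].

Definition ptensor_norm (t : ptensor) : R :=
  sup_norm [set phi : bbform | bilin_bounded phi 1]
    (fun phi (t : ptensor) => rnorm (t phi)) t.

Let D0 : ball !=set0.
Proof.
by exists bbform0 => a b; rewrite bbform0E rnorm0 mul1r mulr_ge0 ?rnorm_ge0.
Qed.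

Let q_bnd (t : ptensor) : has_ubound [set rnorm (t phi) | phi in ball].
Proof.
have [s hs] := ptensorP t ltr01.
exists (1 + \sum_(p <- s) (rnorm p.1 * rnorm p.2)) => _ [phi phi1 <-].
rewrite -(subrK (ev_sum s phi) (t phi)) (le_trans (rnormD _ _))// lerD//.
  by rewrite (le_trans (hs _ _ ler01 phi1))// mulr1.
rewrite (le_trans (rnorm_sum _ _ _))// ler_sum// => p _.
by rewrite (le_trans (phi1 _ _))// mul1r.
Qed.

Let q_sep (t : ptensor) : (forall phi : bbform, ball phi -> rnorm (t phi) = 0) -> t = 0.
Proof.
move=> t0; apply/val_inj/funext => phi /=; apply: rnorm0_eq0.
have [M M0 phiM] := bbform_bnd phi.
have M1 : 0 < M + 1 by rewrite ltr_wpDl.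
have phiM1 : bilin_bounded phi (M + 1).
  move=> a b; rewrite (le_trans (phiM a b))// ler_wpM2r// ?mulr_ge0 ?rnorm_ge0//.
  by rewrite lerDl.
have rM : rnorm (M + 1)^-1%:C = (M + 1)^-1.
  by rewrite /rnorm normc_def /= expr0n /= addr0 sqrtr_sqr ger0_norm// invr_ge0 ltW.
pose psi := bbform_scale (M + 1)^-1%:C phi.
have psi1 : ball psi.
  move=> a b; rewrite /psi bbform_scaleE rnormM rM.
  by rewrite ler_pdivrMl// mul1r phiM1.
apply/eqP; rewrite eq_le rnorm_ge0 andbT; apply/ler_addgt0Pl => e e0.
rewrite addr0.
have [s hs] := ptensorP t (divr_gt0 e0 (mulr_gt0 (ltr0n _ 2) M1)).
rewrite -(subrK (ev_sum s phi) (t phi)) (le_trans (rnormD _ _))//.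
have h1 := hs _ _ (ltW M1) phiM1.
have h2 := hs _ _ ler01 psi1.
have tpsi : t psi = 0 by apply: rnorm0_eq0; exact: t0.
have es : ev_sum s phi = (M + 1)%:C * ev_sum s psi.
  rewrite /ev_sum mulr_sumr; apply: eq_bigr => p _.
  rewrite /psi bbform_scaleE mulrA -rmorphM /= divff ?mul1r// gt_eqF//.
have rM1 : rnorm (M + 1)%:C = M + 1.
  by rewrite /rnorm normc_def /= expr0n /= addr0 sqrtr_sqr ger0_norm// ltW.
move: h2; rewrite tpsi sub0r rnormN mulr1 => h2.
have h3 : rnorm (ev_sum s phi) <= (M + 1) * (e / (2%:R * (M + 1))).
  by rewrite es rnormM rM1 ler_pM2l.
rewrite (le_trans (lerD h1 h3))// (mulrC (M + 1)) -mulrDr -mulr2n.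
by rewrite -(mulr_natl (M + 1)) divfK// gt_eqF// mulr_gt0.
Qed.

Let q_ge0 (phi : bbform) (t : ptensor) : ball phi -> 0 <= rnorm (t phi).
Proof. by rewrite rnorm_ge0. Qed.

Let qD (phi : bbform) (t u : ptensor) : ball phi ->
  rnorm ((t + u) phi) <= rnorm (t phi) + rnorm (u phi).
Proof. by move=> _; exact: rnormD. Qed.

Let qZ (phi : bbform) (c : R[i]) (t : ptensor) : ball phi ->
  rnorm ((c *: t) phi) = rnorm c * rnorm (t phi).
Proof. by move=> _; rewrite -rnormZ. Qed.

HB.instance Definition _ := @Lmodule_isNormed.Build R[i] ptensor
  (fun t => (ptensor_norm t)%:C) (sup_normCD D0 qD q_bnd)
  (sup_normCZ D0 q_ge0 qZ q_bnd) (sup_normC0_eq0 q_ge0 q_sep q_bnd).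

Lemma tensor_subproof (a : A) (b : B) :
  (fun phi : bbform => phi a b : R[i]^o) \in ptensor_pred.
Proof.
apply/mem_set => e e0; exists [:: (a, b)] => phi M M0 _.
by rewrite /ev_sum big_seq1 subrr rnorm0 mulr_ge0// ltW.
Qed.

Definition tensor (a : A) (b : B) : ptensor := PTensor (tensor_subproof a b).

End projective_tensor_product.

Notation "a '\ox' b" := (tensor a b) (at level 40, left associativity).

Section unitization.
Context (R : realType) (A : normedModType R[i]).

Definition unitization : Type := (A * R[i]^o)%type.

HB.instance Definition _ := GRing.Lmodule.copy unitization (A * R[i]^o)%type.

Definition unitization_norm (x : unitization) : R[i] := `|x.1| + `|x.2|.

Let normD x y :
  unitization_norm (x + y) <= unitization_norm x + unitization_norm y.
Proof. by rewrite /unitization_norm addrACA lerD// ler_normD. Qed.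

Let normZ c x : unitization_norm (c *: x) = `|c| * unitization_norm x.
Proof. by rewrite /unitization_norm !normrZ mulrDr. Qed.

Let norm0 x : unitization_norm x = 0 -> x = 0.
Proof.
move=> /eqP; rewrite paddr_eq0 ?normr_ge0// !normr_eq0.
by case: x => a k /= /andP[/eqP -> /eqP ->].
Qed.

HB.instance Definition _ := @Lmodule_isNormed.Build R[i] unitization
  unitization_norm normD normZ norm0.

End unitization.


(* Injectivity of an A-bimodule E; A is given by its product [mul], and E by
   its left and right actions [la] and [ra]. *)
Section injective_bimodule.
Context (R : realType) (A E : normedModType R[i]).
Variables (mul : A -> A -> A) (la : A -> E -> E) (ra : E -> A -> E).

Local Notation A1 := (unitization A).

Definition unitization_mul (x y : A1) : A1 :=
  (mul x.1 y.1 + x.2 *: y.1 + y.2 *: x.1, x.2 * y.2).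

Definition unitization_in (a : A) : A1 := (a, 0).

Definition unitization_lact (x : A1) (e : E) : E := la x.1 e + x.2 *: e.
Definition unitization_ract (e : E) (x : A1) : E := ra e x.1 + x.2 *: e.

Local Notation "x ** y" := (unitization_mul x y) (at level 39).
Local Notation "a %:A1" := (unitization_in a) (at level 2).
Local Notation BE := (blin (ptensor A1 A1) E).

(* The elementary tensors span a dense subspace, so that an element of BE is
   determined by its values on them; the map iota and the two actions on BE are
   specified by these values. *)
Definition is_iota (e : E) (T : BE) := forall x y : A1,
  T (x \ox y) = unitization_ract (unitization_lact x e) y.

Definition is_lact (a : A) (T aT : BE) := forall x y : A1,
  aT (x \ox y) = T ((x ** a%:A1) \ox y).

Definition is_ract (T : BE) (a : A) (Ta : BE) := forall x y : A1,
  Ta (x \ox y) = T (x \ox (a%:A1 ** y)).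

Definition injective_bimodule := exists rho : blin BE E,
  [/\ forall e T, is_iota e T -> rho T = e,
      forall a T aT, is_lact a T aT -> rho aT = la a (rho T) &
      forall a T Ta, is_ract T a Ta -> rho Ta = ra (rho T) a].

End injective_bimodule.

(* Locally compact groups; as usual, they are Hausdorff. *)
HB.mixin Record isLocallyCompactGroup G of PointedTopological G & Group G := {
  mulg_continuous : continuous (fun p : G * G => p.1 * p.2)%g;
  invg_continuous : continuous (fun x : G => x^-1)%g;
  lcgroup_hausdorff : hausdorff_space G;
  lcgroup_locally_compact : locally_compact [set: G] }.

#[short(type="lcGroupType")]
HB.structure Definition LCGroup :=
  { G of PointedTopological G & Group G & isLocallyCompactGroup G }.

Section charge_integral.
Context d (T : measurableType d) (R : realType).
Variable nu : {charge set T -> \bar R}.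

Definition hahn_pos : set T := projT1 (cid (Hahn_decomposition nu)).
Definition hahn_neg : set T :=
  projT1 (cid (projT2 (cid (Hahn_decomposition nu)))).

Lemma hahn_posnegP : hahn_decomposition nu hahn_pos hahn_neg.
Proof. exact: projT2 (cid (projT2 (cid (Hahn_decomposition nu)))). Qed.

Definition charge_integral (g : T -> R) : R :=
  \int[jordan_pos hahn_posnegP]_x g x - \int[jordan_neg hahn_posnegP]_x g x.

End charge_integral.

Section bounded_integral.
Context d (T : measurableType d) (R : realType).

Lemma bounded_integrable (mu : {finite_measure set T -> \bar R}) (g : T -> R) M :
  measurable_fun setT g -> (forall x, `|g x| <= M) ->
  mu.-integrable setT (EFin \o g).
Proof.
move=> mg gM; apply: measurable_bounded_integrable => //.
  by rewrite -ge0_fin_numE// fin_num_measure.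
exists M; split; first by rewrite num_real.
by move=> N MN x _ /=; rewrite (le_trans (gM x))// ltW.
Qed.

Lemma bounded_integral_le (mu : {finite_measure set T -> \bar R}) (L : set T)
    (g : T -> R) M N :
  measurable L -> measurable_fun setT g -> (forall x, `|g x| <= N) ->
  (forall x, L x -> `|g x| <= M) -> 0 <= M -> 0 <= N ->
  `|\int[mu]_x g x| <= M * fine (mu setT) + N * fine (mu (~` L)).
Proof.
move=> mL mg gN gM M0 N0.
have mC : measurable (~` L) by exact: measurableC.
have ig := bounded_integrable mu mg gN.
have step S K : measurable S -> (forall x, S x -> `|g x| <= K) ->
    `|\int[mu]_(x in S) g x| <= K * fine (mu S).
  move=> mS gK; have igS : mu.-integrable S (EFin \o g).
    exact: integrableS ig.
  rewrite (le_trans (le_normr_Rintegral mS igS))// -Rintegral_cst//.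
  apply: le_Rintegral => //; last exact: finite_measure_integrable_cst.
  exact: (integrable_norm igS).
rewrite -(setUv L) Rintegral_setU//; last 2 first.
  by rewrite setUv.
  by rewrite disj_set2E setICr.
rewrite setUv (le_trans (ler_normD _ _))// lerD//; last exact: step.
rewrite (le_trans (step _ _ mL gM))// ler_wpM2l// fine_le ?fin_num_measure//.
by rewrite le_measure ?inE.
Qed.

End bounded_integral.

Section charge_integral_theory.
Context d (T : measurableType d) (R : realType).
Variable nu : {charge set T -> \bar R}.

Definition charge_mass (A : set T) : R :=
  fine (jordan_pos (hahn_posnegP nu) A) + fine (jordan_neg (hahn_posnegP nu) A).

Lemma charge_mass_ge0 A : 0 <= charge_mass A.
Proof. by rewrite addr_ge0 ?fine_ge0 ?measure_ge0. Qed.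

Lemma charge_integral_le (L : set T) (g : T -> R) M N :
  measurable L -> measurable_fun setT g -> (forall x, `|g x| <= N) ->
  (forall x, L x -> `|g x| <= M) -> 0 <= M -> 0 <= N ->
  `|charge_integral nu g| <= M * charge_mass setT + N * charge_mass (~` L).
Proof.
move=> mL mg gN gM M0 N0; rewrite /charge_integral (le_trans (ler_normB _ _))//.
rewrite !mulrDr addrACA lerD//; exact: bounded_integral_le.
Qed.

Lemma charge_integralB (g h : T -> R) M N :
  measurable_fun setT g -> measurable_fun setT h ->
  (forall x, `|g x| <= M) -> (forall x, `|h x| <= N) ->
  charge_integral nu (fun x => g x - h x) =
  charge_integral nu g - charge_integral nu h.
Proof.
move=> mg mh gM hN; rewrite /charge_integral.
rewrite !RintegralB//; try exact: bounded_integrable gM;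
  try exact: bounded_integrable hN.
by rewrite !opprD !opprK addrACA.
Qed.

Lemma charge_mass_le (A : set T) (e : \bar R) : measurable A ->
  (forall B, measurable B -> B `<=` A -> (`|nu B| <= e)%E) ->
  ((charge_mass A)%:E <= e + e)%E.
Proof.
move=> mA Ae; rewrite /charge_mass EFinD.
have [[mP _] [mN _] _ _] := hahn_posnegP nu.
rewrite !fineK ?fin_num_measure//; apply: leeD.
  rewrite jordan_posE cjordan_posE /crestr0 mem_set// /crestr.
  rewrite (le_trans (lee_abs _))// Ae//; first exact: measurableI.
rewrite jordan_negE cjordan_negE /crestr0 mem_set// /crestr.
rewrite (le_trans (lee_abs _))// abseN Ae//; first exact: measurableI.
Qed.

End charge_integral_theory.

Section complex_topology.
Context (R : realType).

Lemma complex_continuousP (T : topologicalType) (f : T -> R[i]^o) :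
  continuous f <->
  forall x (e : R), 0 < e -> \forall y \near x, rnorm (f y - f x) <= e.
Proof.
split=> [cf x e e0|cf x].
  have e0C : 0 < e%:C :> R[i] by rewrite ltcR.
  have /cvgrPdist_le/(_ _ e0C) := cf x; apply: filterS => y.
  by rewrite distrC rnormE lecR.
apply/cvgrPdist_le => -[a b]; rewrite ltcE /= => /andP[/eqP -> a0].
have := cf x a a0; apply: filterS => y.
by rewrite distrC rnormE lecR.
Qed.

Lemma Re_le_rnorm (z : R[i]) : `|complex.Re z| <= rnorm z.
Proof.
case: z => a b; rewrite /rnorm normc_def /= -sqrtr_sqr ler_wsqrtr//.
by rewrite lerDl sqr_ge0.
Qed.

Lemma Im_le_rnorm (z : R[i]) : `|complex.Im z| <= rnorm z.
Proof.
case: z => a b; rewrite /rnorm normc_def /= -sqrtr_sqr ler_wsqrtr//.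
by rewrite lerDr sqr_ge0.
Qed.

Lemma rnorm_le_ReIm (z : R[i]) : rnorm z <= `|complex.Re z| + `|complex.Im z|.
Proof.
case: z => a b; rewrite /rnorm normc_def /=.
rewrite -[leRHS]ger0_norm ?addr_ge0// -sqrtr_sqr ler_wsqrtr//.
rewrite sqrrD !real_normK ?num_real// addrAC lerDl.
by rewrite mulrn_wge0// mulr_ge0.
Qed.

Lemma lipschitz_continuous (p : R[i]^o -> R) :
  (forall z w, `|p z - p w| <= rnorm (z - w)) -> continuous p.
Proof.
move=> lp x; apply/(@cvgrPdist_le _ _ _ (nbhs x)) => e e0.
have /complex_continuousP/(_ x e e0) H : continuous (@id R[i]^o).
  by move=> ?; exact: cvg_id.
near=> y; rewrite distrC (le_trans (lp _ _))//; near: y; exact: H.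
Unshelve. all: by end_near.
Qed.

Lemma Re_continuous : continuous (@complex.Re R : R[i]^o -> R).
Proof.
by apply: lipschitz_continuous => -[a b] [c e]; exact: Re_le_rnorm ((a - c) +i* (b - e)).
Qed.

Lemma Im_continuous : continuous (@complex.Im R : R[i]^o -> R).
Proof.
by apply: lipschitz_continuous => -[a b] [c e]; exact: Im_le_rnorm ((a - c) +i* (b - e)).
Qed.

Lemma rnorm_continuous : continuous (@rnorm R R[i] : R[i]^o -> R).
Proof.
have H (a b : R[i]) : rnorm a - rnorm b <= rnorm (a - b).
  by rewrite lerBlDr -{1}(subrK b a) rnormD.
apply: lipschitz_continuous => z w; rewrite ler_norml H andbT.
by rewrite lerNl opprB -(rnormN (z - w)) opprB H.
Qed.

End complex_topology.

Section C0.
Context (R : realType) (G : lcGroupType).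

Definition vanishes_at_infinity (f : G -> R[i]^o) :=
  forall e : R, 0 < e ->
    exists2 K : set G, compact K & forall x, ~ K x -> rnorm (f x) <= e.

Definition C0_pred : {pred G -> R[i]^o} :=
  mem [set f | continuous f /\ vanishes_at_infinity f].

Record C0 := MkC0 { C0_fun :> G -> R[i]^o; _ : C0_fun \in C0_pred }.

HB.instance Definition _ := [isSub for C0_fun].
HB.instance Definition _ := [Choice of C0 by <:].

Lemma C0_continuous (f : C0) : continuous f.
Proof. by case: f => f /= /set_mem[]. Qed.

Lemma C0_vanishes (f : C0) : vanishes_at_infinity f.
Proof. by case: f => f /= /set_mem[]. Qed.

Lemma C0_submod_closed : submod_closed C0_pred.
Proof.
split=> [|c f g /set_mem[cf f0] /set_mem[cg g0]]; apply/mem_set.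
  split; first exact: cst_continuous.
  by move=> e e0; exists set0; [exact: compact0|by move=> x _; rewrite rnorm0 ltW].
split.
  move=> x; apply: cvgD; last exact: cg.
  by apply: cvgZr; exact: cf.
move=> e e0; have c0 : 0 < rnorm c + 1 by rewrite ltr_wpDl ?rnorm_ge0.
have [K cK fK] := f0 _ (divr_gt0 (divr_gt0 e0 (ltr0n _ 2)) c0).
have [L cL gL] := g0 _ (divr_gt0 e0 (ltr0n _ 2)).
exists (K `|` L); first exact: compactU.
move=> x /not_orP[/fK fx /gL gx].
rewrite (splitr e) (le_trans (rnormD _ _))// lerD// rnormZ.
rewrite (le_trans (ler_wpM2l (rnorm_ge0 c) fx))// mulrCA ler_piMr ?divr_ge0 ?ltW//.
by rewrite ltr_pdivrMr// mul1r ltrDl.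
Qed.

HB.instance Definition _ := GRing.isSubmodClosed.Build _ _ C0_pred
  C0_submod_closed.
HB.instance Definition _ := [SubChoice_isSubLmodule of C0 by <:].

Lemma C0_bounded (f : C0) : exists2 M : R, 0 <= M & forall x, rnorm (f x) <= M.
Proof.
have [K cK fK] := C0_vanishes f ltr01.
have cf : continuous (fun x => rnorm (f x)).
  move=> x; apply: (@continuous_comp _ _ _ f (@rnorm R R[i])).
    exact: C0_continuous.
  exact: rnorm_continuous.
have /compact_bounded[M [_ HM]] : compact ((fun x => rnorm (f x)) @` K).
  by apply: continuous_compact => //; exact: continuous_subspaceT.
exists (`|M| + 1) => [|x]; first by rewrite addr_ge0.
have [Kx|/fK] := pselect (K x); last by move/le_trans; apply; rewrite lerDr.
rewrite (le_trans (ler_norm _))//; apply: HM; last by exists x.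
by rewrite ltr_pwDr// ler_norm.
Qed.

Definition C0_norm (f : C0) : R :=
  sup_norm [set: G] (fun x (f : C0) => rnorm (f x)) f.

Let D0 : [set: G] !=set0. Proof. by exists point. Qed.

Let q_bnd (f : C0) : has_ubound [set rnorm (f x) | x in [set: G]].
Proof. by have [M _ fM] := C0_bounded f; exists M => _ [x _ <-]. Qed.

Let q_sep (f : C0) : (forall x, [set: G] x -> rnorm (f x) = 0) -> f = 0.
Proof.
by move=> f0; apply/val_inj/funext => x; apply: rnorm0_eq0; exact: f0.
Qed.

Let q_ge0 (x : G) (f : C0) : [set: G] x -> 0 <= rnorm (f x).
Proof. by rewrite rnorm_ge0. Qed.

Let qD (x : G) (f g : C0) : [set: G] x ->
  rnorm ((f + g) x) <= rnorm (f x) + rnorm (g x).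
Proof. by move=> _; exact: rnormD. Qed.

Let qZ (x : G) (c : R[i]) (f : C0) : [set: G] x ->
  rnorm ((c *: f) x) = rnorm c * rnorm (f x).
Proof. by move=> _; rewrite -rnormM. Qed.

HB.instance Definition _ := @Lmodule_isNormed.Build R[i] C0
  (fun f => (C0_norm f)%:C) (sup_normCD D0 qD q_bnd)
  (sup_normCZ D0 q_ge0 qZ q_bnd) (sup_normC0_eq0 q_ge0 q_sep q_bnd).

End C0.

(* A complex measure is given on all subsets of G and normalized to vanish
   outside the Borel sets, so that measures that agree on the Borel sets are
   equal. Regularity is that of the total variation measure. *)
Section complex_measures.
Context (R : realType) (G : lcGroupType).

Definition borel : measurableType (sigma_display (@open G)) :=
  g_sigma_algebraType (@open G).

Definition borel_set (E : set G) := @measurable _ borel E.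

Definition disjoint_borel (E : set G) : set (nat * (nat -> set G)) :=
  [set nF | [/\ forall i, borel_set (nF.2 i), trivIset setT nF.2 &
                forall i, nF.2 i `<=` E]].

Definition variation_sum (nF : nat * (nat -> set G)) (mu : set G -> R[i]^o) : R :=
  \sum_(0 <= i < nF.1) rnorm (mu (nF.2 i)).

Definition measure_variation (mu : set G -> R[i]^o) (E : set G) : R :=
  sup [set variation_sum nF mu | nF in disjoint_borel E].

Definition is_regular_measure (mu : set G -> R[i]^o) :=
  [/\ forall E, ~ borel_set E -> mu E = 0,
      forall F : nat -> set G, (forall i, borel_set (F i)) -> trivIset setT F ->
        (fun n => \sum_(0 <= i < n) mu (F i)) @ \oo --> mu (\bigcup_i F i),
      has_ubound [set variation_sum nF mu | nF in disjoint_borel setT] &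
      forall E, borel_set E -> forall e : R, 0 < e -> exists K U : set G,
        [/\ compact K, open U, K `<=` E, E `<=` U &
            measure_variation mu (U `\` K) <= e]].

Definition measure_pred : {pred set G -> R[i]^o} := mem [set mu | is_regular_measure mu].

Record measure_algebra := MkMeasure { measure_fun :> set G -> R[i]^o; _ : measure_fun \in measure_pred }.

HB.instance Definition _ := [isSub for measure_fun].
HB.instance Definition _ := [Choice of measure_algebra by <:].

Lemma measure_algebraP (mu : measure_algebra) : is_regular_measure mu.
Proof. by case: mu => mu /= /set_mem. Qed.

Lemma disjoint_borelS (E F : set G) :
  E `<=` F -> disjoint_borel E `<=` disjoint_borel F.
Proof. by move=> EF nF [h1 h2 h3]; split=> // i; exact: subset_trans (h3 i) EF. Qed.

Lemma disjoint_borel0 (E : set G) : disjoint_borel E (0, fun=> set0).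
Proof.
split=> /=; [by move=> i; exact: measurable0| |by move=> i; exact: sub0set].
by apply: trivIset_set0.
Qed.

Lemma variation_sum_ge0 nF (mu : set G -> R[i]^o) : 0 <= variation_sum nF mu.
Proof. by rewrite sumr_ge0// => i _; rewrite rnorm_ge0. Qed.

Lemma variation_sumD nF (mu nu : set G -> R[i]^o) :
  variation_sum nF (mu + nu) <= variation_sum nF mu + variation_sum nF nu.
Proof. by rewrite -big_split ler_sum// => i _; exact: rnormD. Qed.

Lemma variation_sumZ nF (c : R[i]) (mu : set G -> R[i]^o) :
  variation_sum nF (c *: mu) = rnorm c * variation_sum nF mu.
Proof. by rewrite mulr_sumr; apply: eq_bigr => i _; rewrite -rnormM. Qed.

Definition finite_variation (mu : set G -> R[i]^o) :=
  has_ubound [set variation_sum nF mu | nF in disjoint_borel setT].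

Lemma finite_variationS mu E : finite_variation mu ->
  has_ubound [set variation_sum nF mu | nF in disjoint_borel E].
Proof.
move=> [m hm]; exists m => _ [nF hnF <-]; apply: hm; exists nF => //.
exact: disjoint_borelS hnF.
Qed.

Lemma variation_ub mu E nF : finite_variation mu -> disjoint_borel E nF ->
  variation_sum nF mu <= measure_variation mu E.
Proof.
by move=> fmu EnF; apply: ub_le_sup; [exact: finite_variationS|exists nF].
Qed.

Lemma variation_lub mu E m :
  (forall nF, disjoint_borel E nF -> variation_sum nF mu <= m) ->
  measure_variation mu E <= m.
Proof.
move=> mum; apply: ge_sup; last by move=> _ [nF EnF <-]; exact: mum.
by exists (variation_sum (0, fun=> set0) mu), (0, fun=> set0) => //;
  exact: disjoint_borel0.
Qed.

Lemma variationS mu E F : finite_variation mu -> E `<=` F ->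
  measure_variation mu E <= measure_variation mu F.
Proof.
move=> fmu EF; apply: variation_lub => nF /(disjoint_borelS EF).
exact: variation_ub.
Qed.

Lemma variation_le mu E B : finite_variation mu -> borel_set B -> B `<=` E ->
  rnorm (mu B) <= measure_variation mu E.
Proof.
move=> fmu mB BE; pose F (i : nat) := if i == 0 then B else set0.
have -> : rnorm (mu B) = variation_sum (1, F) mu.
  by rewrite /variation_sum /= big_nat1.
apply: variation_ub => //; split=> /=.
- by rewrite /F => i; case: ifP => // _; exact: measurable0.
- apply/trivIsetP => i j _ _ ij; rewrite /F; case: ifP => [/eqP i0|_]; last first.
    by rewrite set0I.
  by case: ifP => [/eqP j0|]; [rewrite i0 j0 eqxx in ij|rewrite setI0].
- by rewrite /F => i; case: ifP => // _; exact: sub0set.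
Qed.

Lemma measure_submod_closed : submod_closed measure_pred.
Proof.
split=> [|c mu nu /set_mem[mu0 mus muv mur] /set_mem[nu0 nus nuv nur]];
    apply/mem_set.
  have v0 nF : variation_sum nF 0 = 0.
    by rewrite /variation_sum big1// => i _; exact: rnorm0.
  split=> //.
  - by move=> F _ _; rewrite (_ : (fun=> _) = cst 0); [exact: cvg_cst
      |apply/funext => n; rewrite big1].
  - by exists 0 => _ [nF _ <-]; rewrite v0.
  - move=> E _ e e0; exists set0, setT; split=> //; first exact: compact0.
      exact: openT.
    by apply: variation_lub => nF _; rewrite v0 ltW.
have fv : finite_variation (c *: mu + nu).
  have [m hm] := muv; have [n hn] := nuv.
  exists (rnorm c * m + n) => _ [nF hnF <-].
  rewrite (le_trans (variation_sumD _ _ _))// lerD//; last by apply: hn; exists nF.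
  by rewrite variation_sumZ ler_wpM2l ?rnorm_ge0//; apply: hm; exists nF.
split.
- by move=> E nE; rewrite !fctE mu0// nu0// scaler0 addr0.
- move=> F mF tF; rewrite (_ : (fun _ => _) = (fun n =>
      c *: \sum_(0 <= i < n) mu (F i) + \sum_(0 <= i < n) nu (F i))).
    by apply: cvgD; [apply: cvgZr; exact: mus|exact: nus].
  by apply/funext => n; rewrite scaler_sumr -big_split.
- exact: fv.
move=> E mE e e0; have c0 : 0 < rnorm c + 1 by rewrite ltr_wpDl ?rnorm_ge0.
have e2 : 0 < e / 2 by rewrite divr_gt0.
have [K [U [cK oU KE EU KU]]] := mur _ mE _ (divr_gt0 e2 c0).
have [K' [U' [cK' oU' KE' EU' KU']]] := nur _ mE _ e2.
exists (K `|` K'), (U `&` U'); split.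
- exact: compactU.
- exact: openI.
- by rewrite subUset.
- by rewrite subsetI.
apply: variation_lub => nF hnF.
rewrite (splitr e) (le_trans (variation_sumD _ _ _))// lerD//; last first.
  apply: le_trans KU'; apply: variation_ub => //; apply: disjoint_borelS hnF.
  by move=> x [[_ ?] /not_orP[_ ?]]; split.
rewrite variation_sumZ.
have : variation_sum nF mu <= e / 2 / (rnorm c + 1).
  apply: le_trans KU; apply: variation_ub => //; apply: disjoint_borelS hnF.
  by move=> x [[? _] /not_orP[? _]]; split.
move=> /(ler_wpM2l (rnorm_ge0 c))/le_trans; apply.
rewrite mulrCA ler_piMr ?ltW//.
by rewrite ltr_pdivrMr// mul1r ltrDl.
Qed.

HB.instance Definition _ := GRing.isSubmodClosed.Build _ _ measure_pred
  measure_submod_closed.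
HB.instance Definition _ := [SubChoice_isSubLmodule of measure_algebra by <:].

Let D0 : disjoint_borel setT !=set0.
Proof. by exists (0, fun=> set0); exact: disjoint_borel0. Qed.

Let q_bnd (mu : measure_algebra) :
  has_ubound [set variation_sum nF mu | nF in disjoint_borel setT].
Proof. by have [] := measure_algebraP mu. Qed.

Let q_sep (mu : measure_algebra) :
  (forall nF, disjoint_borel setT nF -> variation_sum nF mu = 0) -> mu = 0.
Proof.
move=> mu0; apply/val_inj/funext => E /=.
have [mE|nE] := pselect (borel_set E); last by have [->] := measure_algebraP mu.
apply/rnorm0_eq0/eqP; rewrite eq_le rnorm_ge0 andbT.
rewrite (le_trans (variation_le (E := setT) (q_bnd mu) mE _))//.
by apply: variation_lub => nF /mu0 ->.
Qed.

Let q_ge0 nF (mu : measure_algebra) : disjoint_borel setT nF -> 0 <= variation_sum nF mu.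
Proof. by move=> _; exact: variation_sum_ge0. Qed.

Let qD nF (mu nu : measure_algebra) : disjoint_borel setT nF ->
  variation_sum nF (mu + nu : measure_algebra) <= variation_sum nF mu + variation_sum nF nu.
Proof. by move=> _; exact: variation_sumD. Qed.

Let qZ nF (c : R[i]) (mu : measure_algebra) : disjoint_borel setT nF ->
  variation_sum nF (c *: mu : measure_algebra) = rnorm c * variation_sum nF mu.
Proof. by move=> _; exact: variation_sumZ. Qed.

HB.instance Definition _ := @Lmodule_isNormed.Build R[i] measure_algebra
  (fun mu => (measure_variation mu setT)%:C)
  (@sup_normCD _ _ _ _ (fun nF (mu : measure_algebra) => variation_sum nF mu) D0 qD q_bnd)
  (@sup_normCZ _ _ _ _ (fun nF (mu : measure_algebra) => variation_sum nF mu) D0 q_ge0 qZ q_bnd)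
  (@sup_normC0_eq0 _ _ _ _ (fun nF (mu : measure_algebra) => variation_sum nF mu) q_ge0 q_sep q_bnd).

End complex_measures.

Section complex_integral.
Context (R : realType) (G : lcGroupType) (mu : measure_algebra R G).
Local Notation T := (borel G).

Definition re_charge (E : set T) : \bar R := (complex.Re (mu E))%:E.
Definition im_charge (E : set T) : \bar R := (complex.Im (mu E))%:E.

Lemma measure_algebra0 : mu set0 = 0.
Proof.
have [_ mus _ _] := measure_algebraP mu.
have m0 (i : nat) : borel_set (@set0 G) by exact: measurable0.
have t0 : trivIset setT (fun i : nat => @set0 G) by apply: trivIset_set0.
have := mus _ m0 t0; rewrite bigcup0// => h.
have h' : (fun n => \sum_(0 <= i < n.+1) mu set0) @ \oo --> mu set0.
  by rewrite (@cvg_shiftS _ (fun n => \sum_(0 <= i < n) mu set0)).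
have h2 : (fun n => \sum_(0 <= i < n.+1) mu set0 -
    \sum_(0 <= i < n) mu set0) @ \oo --> mu set0 - mu set0.
  by apply: (cvgB h' h).
have E : (fun n => \sum_(0 <= i < n.+1) mu set0 - \sum_(0 <= i < n) mu set0) =
    cst (mu set0).
  by apply/funext => n; rewrite big_nat_recr //= addrAC subrr add0r.
rewrite E subrr in h2.
have hT : hausdorff_space R[i]^o by exact: norm_hausdorff.
apply: (@cvg_unique _ hT (cst (mu set0) @ \oo) _ _ _ _ h2).
exact: cvg_cst.
Qed.

Lemma re_sigma_additive : semi_sigma_additive re_charge.
Proof.
move=> F mF tF _; have [_ mus _ _] := measure_algebraP mu.
rewrite (_ : (fun _ => _) =
    EFin \o (@complex.Re R \o (fun n => \sum_(0 <= i < n) mu (F i)))); last first.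
  apply/funext => n /=; rewrite /re_charge sumEFin; congr EFin.
  by elim/big_rec2 : _ => // i y1 y2 _ ->; case: (mu _) y2 => a b [c e].
apply: cvg_EFin; first by near=> n.
apply: (cvg_comp _ _ (mus F mF tF)); exact: Re_continuous.
Unshelve. all: by end_near. Qed.

Lemma im_sigma_additive : semi_sigma_additive im_charge.
Proof.
move=> F mF tF _; have [_ mus _ _] := measure_algebraP mu.
rewrite (_ : (fun _ => _) =
    EFin \o (@complex.Im R \o (fun n => \sum_(0 <= i < n) mu (F i)))); last first.
  apply/funext => n /=; rewrite /im_charge sumEFin; congr EFin.
  by elim/big_rec2 : _ => // i y1 y2 _ ->; case: (mu _) y2 => a b [c e].
apply: cvg_EFin; first by near=> n.
apply: (cvg_comp _ _ (mus F mF tF)); exact: Im_continuous.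
Unshelve. all: by end_near. Qed.

Let re0 : (re_charge set0 = 0)%E. Proof. by rewrite /re_charge measure_algebra0. Qed.
Let im0 : (im_charge set0 = 0)%E. Proof. by rewrite /im_charge measure_algebra0. Qed.

HB.instance Definition _ := isCharge.Build _ T R re_charge re0
  (fun _ _ => isT) re_sigma_additive.
HB.instance Definition _ := isCharge.Build _ T R im_charge im0
  (fun _ _ => isT) im_sigma_additive.

Definition complex_integral (f : G -> R[i]) : R[i] :=
  let u x := complex.Re (f x) in let v x := complex.Im (f x) in
  (charge_integral re_charge u - charge_integral im_charge v) +i*
  (charge_integral re_charge v + charge_integral im_charge u).

Lemma continuous_measurable (g : T -> R) :
  continuous (g : G -> R) -> measurable_fun setT g.
Proof.
move=> /continuousP cg; apply: (measurability _ (RGenOpens.measurableE R)).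
move=> _ [_ [a [b ->] <-]]; rewrite setTI; apply: sub_sigma_algebra.
by apply: cg; exact: interval_open.
Qed.

Lemma compact_borel (K : set G) : compact K -> borel_set K.
Proof.
move=> cK; rewrite -(setCK K); apply: measurableC.
apply: sub_sigma_algebra; apply: closed_openC.
exact: compact_closed (@lcgroup_hausdorff G) cK.
Qed.

Lemma complex_integral_le :
  exists2 V : R, 0 <= V & forall d : R, 0 < d -> exists2 L : set G, compact L &
    forall (h : G -> R[i]^o) m n, continuous h -> 0 <= m -> 0 <= n ->
      (forall x, rnorm (h x) <= n) -> (forall x, L x -> rnorm (h x) <= m) ->
      rnorm (complex_integral h) <= V * m + d * n.
Proof.
have fv : finite_variation mu by have [] := measure_algebraP mu.
exists ((charge_mass re_charge setT + charge_mass im_charge setT) *+ 2).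
  by rewrite mulrn_wge0// addr_ge0// charge_mass_ge0.
move=> d d0; have [_ _ _ reg] := measure_algebraP mu.
have d8 : 0 < d / 8%:R by rewrite divr_gt0.
have [L [U [cL _ _ TU UL]]] := reg setT measurableT _ d8.
exists L => // h m n ch m0 n0 hn hm.
have mL := compact_borel cL.
have mLC : borel_set (~` L) by exact: measurableC.
have mass p : (p = re_charge \/ p = im_charge) ->
    forall B, borel_set B -> B `<=` ~` L -> (`|p B| <= (d / 8%:R)%:E)%E.
  move=> pE B mB BL; have nB : rnorm (mu B) <= d / 8%:R.
    by rewrite (le_trans _ UL)// variation_le// => x Bx; split; [exact: TU|exact: BL].
  by case: pE => ->; rewrite /re_charge /im_charge /= lee_fin;
    rewrite (le_trans _ nB)// ?Re_le_rnorm ?Im_le_rnorm.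
have tail (p : {charge set T -> \bar R}) :
    (forall B, borel_set B -> B `<=` ~` L -> (`|p B| <= (d / 8%:R)%:E)%E) ->
    charge_mass p (~` L) <= d / 8%:R *+ 2.
  by move=> H; have := charge_mass_le mLC H; rewrite -EFinD lee_fin mulr2n.
have mu_ : measurable_fun setT (fun x : T => complex.Re (h x)).
  apply: continuous_measurable => x.
  by apply: (@continuous_comp _ _ _ h (@complex.Re R)); [exact: ch|exact: Re_continuous].
have mv_ : measurable_fun setT (fun x : T => complex.Im (h x)).
  apply: continuous_measurable => x.
  by apply: (@continuous_comp _ _ _ h (@complex.Im R)); [exact: ch|exact: Im_continuous].
have bnd (p : {charge set T -> \bar R}) (w : T -> R) :
    (forall B, borel_set B -> B `<=` ~` L -> (`|p B| <= (d / 8%:R)%:E)%E) ->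
    measurable_fun setT w -> (forall x, `|w x| <= rnorm (h x)) ->
    `|charge_integral p w| <= m * charge_mass p setT + n * (d / 8%:R *+ 2).
  move=> /tail tp mw wh; rewrite (le_trans (@charge_integral_le _ _ _ p L w m n _ _ _ _ _ _))//.
  - by move=> x; rewrite (le_trans (wh x)).
  - by move=> x /hm; exact: le_trans.
  - by rewrite lerD2l ler_wpM2l.
have mre := mass _ (or_introl erefl); have mim := mass _ (or_intror erefl).
rewrite (le_trans (rnorm_le_ReIm _))// /complex_integral /=.
set a := charge_integral re_charge _; set b := charge_integral im_charge _.
set a' := charge_integral re_charge _; set b' := charge_integral im_charge _.
have ha : `|a| <= _ := bnd _ _ mre mu_ (fun x => Re_le_rnorm (h x)).
have hb : `|b| <= _ := bnd _ _ mim mv_ (fun x => Im_le_rnorm (h x)).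
have ha' : `|a'| <= _ := bnd _ _ mre mv_ (fun x => Im_le_rnorm (h x)).
have hb' : `|b'| <= _ := bnd _ _ mim mu_ (fun x => Re_le_rnorm (h x)).
rewrite (le_trans (lerD (ler_normB _ _) (ler_normD _ _)))//.
rewrite (le_trans (lerD (lerD ha hb) (lerD ha' hb')))//.
rewrite le_eqVlt; apply/orP; left; apply/eqP.
have dE : d = d / 8%:R *+ 8 by rewrite -mulr_natr divfK// pnatr_eq0.
rewrite [in RHS]dE {dE}.
move: (charge_mass re_charge _) (charge_mass im_charge _) (d / _) => x y z.
by ring.
Qed.

Lemma complex_integralB (g h : G -> R[i]^o) m n : continuous g -> continuous h ->
  (forall x, rnorm (g x) <= m) -> (forall x, rnorm (h x) <= n) ->
  complex_integral (fun x => g x - h x) = complex_integral g - complex_integral h.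
Proof.
move=> cg ch gm hn.
have mR k : continuous (k : G -> R[i]^o) ->
    measurable_fun setT (fun x : T => complex.Re (k x)).
  move=> ck; apply: continuous_measurable => x.
  by apply: (@continuous_comp _ _ _ k (@complex.Re R)); [exact: ck|exact: Re_continuous].
have mI k : continuous (k : G -> R[i]^o) ->
    measurable_fun setT (fun x : T => complex.Im (k x)).
  move=> ck; apply: continuous_measurable => x.
  by apply: (@continuous_comp _ _ _ k (@complex.Im R)); [exact: ck|exact: Im_continuous].
have bR k K : (forall x : G, rnorm (k x : R[i]) <= K) ->
    forall x, `|complex.Re (k x)| <= K.
  by move=> kK x; exact: le_trans (Re_le_rnorm _) (kK x).
have bI k K : (forall x : G, rnorm (k x : R[i]) <= K) ->
    forall x, `|complex.Im (k x)| <= K.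
  by move=> kK x; exact: le_trans (Im_le_rnorm _) (kK x).
have eR : (fun x => complex.Re (g x - h x)) =
    (fun x => complex.Re (g x) - complex.Re (h x)).
  by apply/funext => x; case: (g x) (h x) => ? ? [].
have eI : (fun x => complex.Im (g x - h x)) =
    (fun x => complex.Im (g x) - complex.Im (h x)).
  by apply/funext => x; case: (g x) (h x) => ? ? [].
rewrite /complex_integral eR eI.
rewrite !(charge_integralB _ (mR _ cg) (mR _ ch) (bR _ _ gm) (bR _ _ hn)).
rewrite !(charge_integralB _ (mI _ cg) (mI _ ch) (bI _ _ gm) (bI _ _ hn)).
by apply/eqP; rewrite eq_complex /=; apply/andP; split; apply/eqP; ring.
Qed.


End complex_integral.

(* Both translation averages [x |-> \int f(xy) dnu(y)] and
   [x |-> \int f(yx) dnu(y)] of f in C_0(G) are in C_0(G); [m] is the product of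
   G or of its opposite group. *)
Section translation_average.
Context (R : realType) (G : lcGroupType).
Variable m : G -> G -> G.
Hypothesis m_continuous : continuous (fun p : G * G => m p.1 p.2).
Hypothesis mA : forall x y z, m x (m y z) = m (m x y) z.
Hypothesis m1 : forall x, m 1%g x = x.
Hypothesis m1r : forall x, m x 1%g = x.
Hypothesis mV : forall x, m x x^-1%g = 1%g.
Hypothesis Vm : forall x, m x^-1%g x = 1%g.

Let m_cont (T : topologicalType) (u v : T -> G) (x : T) :
  {for x, continuous u} -> {for x, continuous v} ->
  {for x, continuous (fun t => m (u t) (v t))}.
Proof.
move=> cu cv; apply: (@continuous_comp _ _ _ (fun t => (u t, v t))
  (fun p : G * G => m p.1 p.2)); last exact: m_continuous.
exact: cvg_pair.
Qed.

Lemma C0_uniform (f : C0 R G) (x0 : G) (e : R) : 0 < e ->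
  \forall x \near x0, forall y, rnorm (f (m x y) - f (m x0 y)) <= e.
Proof.
move=> e0; have e2 : 0 < e / 2 by rewrite divr_gt0.
have [K cK fK] := C0_vanishes f e2.
have cf := @C0_continuous _ _ f.
have H : \forall u \near (1%g : G), K `<=` (fun z => rnorm (f (m u z) - f z) <= e).
  move/compact_near_coveringP : cK; apply => z Kz.
  have cm : {for (z, 1%g), continuous (fun p : G * G => f (m p.2 p.1))}.
    apply: (@continuous_comp _ _ _ (fun p : G * G => m p.2 p.1) f); last exact: cf.
    by apply: m_cont; [exact: cvg_snd|exact: cvg_fst].
  have cp : {for (z, 1%g : G), continuous (fun p : G * G => f p.1)}.
    by apply: (@continuous_comp _ _ _ fst f); [exact: cvg_fst|exact: cf].
  have e2C : 0 < (e / 2)%:C :> R[i] by rewrite ltcR.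
  move/cvgrPdist_le/(_ _ e2C) : cm => cm.
  move/cvgrPdist_le/(_ _ e2C) : cp => cp.
  near=> p.
  have : `|f (m 1%g z) - f (m p.2 p.1)| <= (e / 2)%:C by near: p; exact: cm.
  have : `|f z - f p.1| <= (e / 2)%:C by near: p; exact: cp.
  rewrite m1 !rnormE !lecR => h1 h2.
  rewrite (_ : f (m p.2 p.1) - f p.1 = (f z - f p.1) - (f z - f (m p.2 p.1))).
    by rewrite (splitr e) (le_trans (rnormD _ _))// rnormN lerD.
  by rewrite opprB [RHS]addrC addrA subrK.
have c1 : {for x0, continuous (fun x => m x x0^-1%g)}.
  by apply: m_cont; [exact: cvg_id|exact: cvg_cst].
have c2 : {for x0, continuous (fun x => (m x x0^-1)^-1)%g}.
  by apply: (@continuous_comp _ _ _ _ (fun x : G => x^-1)%g); last exact: invg_continuous.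
have H1 : \forall x \near x0,
    K `<=` (fun z => rnorm (f (m (m x x0^-1%g) z) - f z) <= e).
  by have := c1; rewrite /prop_for /continuous_at mV => /(_ _ H).
have H2 : \forall x \near x0,
    K `<=` (fun z => rnorm (f (m (m x x0^-1)^-1%g z) - f z) <= e).
  by have := c2; rewrite /prop_for /continuous_at mV invg1 => /(_ _ H).
near=> x => y.
have hx1 : K `<=` (fun z => rnorm (f (m (m x x0^-1%g) z) - f z) <= e).
  by near: x.
have hx2 : K `<=` (fun z => rnorm (f (m (m x x0^-1)^-1%g z) - f z) <= e).
  by near: x.
have xy : m x y = m (m x x0^-1%g) (m x0 y) by rewrite -mA [m x0^-1%g _]mA Vm m1.
have [/hx1|nK0] := pselect (K (m x0 y)); first by rewrite -xy.
have [/hx2|nK] := pselect (K (m x y)).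
  by rewrite xy [m _ (m (m x _) _)]mA Vm m1 -xy -rnormN opprB.
rewrite (splitr e) (le_trans (rnormD _ _))// rnormN lerD//; exact: fK.
Unshelve. all: by end_near. Qed.

Lemma translation_continuous (f : C0 R G) (x : G) :
  continuous (fun y => f (m x y)).
Proof.
move=> y; apply: (@continuous_comp _ _ _ (fun y => m x y) f); last exact: C0_continuous.
by apply: m_cont; [exact: cvg_cst|exact: cvg_id].
Qed.

Lemma translation_average_subproof (nu : measure_algebra R G) (f : C0 R G) :
  (fun x => complex_integral nu (fun y => f (m x y)) : R[i]^o) \in @C0_pred R G.
Proof.
have [V V0 hV] := complex_integral_le nu.
have [N N0 fN] := C0_bounded f.
apply/mem_set; split.
  apply/complex_continuousP => x e e0.
  have V1 : 0 < V + 1 by rewrite ltr_wpDl.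
  have H := C0_uniform f x (divr_gt0 e0 V1).
  have [L cL hL] := hV _ ltr01.
  near=> y; rewrite -(complex_integralB nu (m := N) (n := N)); first 1 last.
  - exact: translation_continuous.
  - exact: translation_continuous.
  - by move=> z; exact: fN.
  - by move=> z; exact: fN.
  have hy z : rnorm (f (m y z) - f (m x z)) <= e / (V + 1) by move: z; near: y.
  have e1 : 0 <= e / (V + 1) by rewrite divr_ge0// ltW.
  rewrite (le_trans (hL _ (e / (V + 1)) (e / (V + 1)) _ _ _ _ _))//.
    by move=> z; apply: cvgB; exact: translation_continuous.
  by rewrite -mulrDl mulrC divfK// gt_eqF.
move=> e e0.
have V1 : 0 < V + 1 by rewrite ltr_wpDl.
have N1 : 0 < N + 1 by rewrite ltr_wpDl.
have e2 : 0 < e / 2 by rewrite divr_gt0.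
have [L cL hL] := hV _ (divr_gt0 e2 N1).
have [K cK fK] := C0_vanishes f (divr_gt0 e2 V1).
exists ((fun p : G * G => m p.1 p.2^-1%g) @` (K `*` L)).
  apply: continuous_compact; last exact: compact_setX.
  apply: continuous_subspaceT => p; apply: m_cont; first exact: cvg_fst.
  by apply: (@continuous_comp _ _ _ snd (fun x : G => x^-1)%g);
    [exact: cvg_snd|exact: invg_continuous].
move=> x nx.
rewrite (le_trans (hL _ (e / 2 / (V + 1)) N _ _ _ _ _))//.
- exact: translation_continuous.
- by rewrite divr_ge0// ltW.
- move=> y Ly; apply: fK => Kxy; apply: nx; exists (m x y, y) => //=.
  by rewrite -mA mV m1r.
rewrite [leRHS]splitr lerD//.
  by rewrite mulrCA ler_piMr ?ltW// ltr_pdivrMr// mul1r ltrDl.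
by rewrite mulrAC -mulrA ler_piMr ?ltW// ltr_pdivrMr// mul1r ltrDl.
Unshelve. all: by end_near. Qed.

End translation_average.

Section module_actions.
Context (R : realType) (G : lcGroupType).

Let opp_mulg (x y : G) := (y * x)%g.

Let opp_mulg_continuous : continuous (fun p : G * G => opp_mulg p.1 p.2).
Proof.
move=> p; apply: (@continuous_comp _ _ _ (fun p : G * G => (p.2, p.1))
  (fun p : G * G => p.1 * p.2)%g); last exact: mulg_continuous.
by apply: cvg_pair; [exact: cvg_snd|exact: cvg_fst].
Qed.

Definition C0_lact (nu : measure_algebra R G) (f : C0 R G) : C0 R G :=
  @MkC0 R G (fun x => complex_integral nu (fun y => f (x * y)%g))
    (translation_average_subproof (@mulg_continuous G) (@mulgA G) (@mul1g G)
       (@mulg1 G) (@mulgV G) (@mulVg G) nu f).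

Definition C0_ract (f : C0 R G) (nu : measure_algebra R G) : C0 R G :=
  @MkC0 R G (fun x => complex_integral nu (fun y => f (y * x)%g))
    (translation_average_subproof opp_mulg_continuous
       (fun x y z => esym (mulgA z y x)) (@mulg1 G) (@mul1g G) (@mulVg G)
       (@mulgV G) nu f).

(* The convolution of mu and nu is the regular measure that represents the
   bounded functional [f |-> \int \int f(xy) dnu(y) dmu(x)] on C_0(G); by the
   Riesz representation theorem it exists and is unique, so that the default
   value of [xget] plays no role. *)
Definition convolution (mu nu : measure_algebra R G) : measure_algebra R G :=
  xget 0 [set lambda | forall f : C0 R G, complex_integral lambda f =
    complex_integral mu (fun x => complex_integral nu (fun y => f (x * y)%g))].

End module_actions.

(* Main.v *)
Require Import Defs.
From HB Require Import structures.
From mathcomp Require Import all_boot all_order all_algebra.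
From mathcomp Require Import all_classical all_reals all_analysis.
From mathcomp Require Import measurable_realfun complex ring lra.

Set Implicit Arguments.
Unset Strict Implicit.
Unset Printing Implicit Defensive.

Import Order.TTheory GRing.Theory Num.Theory.
Import numFieldNormedType.Exports.

Local Open Scope classical_set_scope.
Local Open Scope ring_scope.
Local Open Scope complex_scope.

(* For finite G, the average over g and h in G of the two-sided translates of
   T (d_(g^-1) (x) d_(h^-1)), d_g being the point mass at g, is a left inverse
   of iota.

   Let G be infinite, and rho a left inverse of iota. Let H be a countable
   infinite subgroup that normalizes a compact subgroup N and meets it trivially.
   A pair of functions acts on the measures by integrating the first over the
   cosets of N of positive mass and the second over the diffuse part that is left;
   rho turns such pairs (kernels) into functions in C_0(G), boundedly, compatibly
   with translations by H on one side and by G on the other, and sends constant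
   pairs to themselves. By equivariance and boundedness it kills the kernels
   living on one fibre of an H-equivariant map eta : G -> H, a choice of
   representatives modulo H N. Now let h_n in C_0(G) converge pointwise to e, in
   such a way that h_n, h_(n+1), ... agree outside sets W_n that decrease and
   separate the points of each orbit of H. Use h_n on the n-th fibre of eta and e
   on the diffuse part, and let f in C_0(G) be the image under rho of this kernel.
   Modulo finitely many fibres, the translates by a finite subset F of H of this
   kernel minus h_n have almost disjoint supports, hence
   |sum_(s in F) (f - h_n)(g s)| is bounded independently of F for large n. Thus
   f is too close to e along H. This is absurd if G is discrete, N = 1 and e is
   the indicator function of a sparse infinite subset of H, and also if G is not
   discrete, N is the zero set of a continuous pseudonorm p and e is a function of
   p oscillating near 0. *)

(** An element of the target of [iota] is only a bounded operator in its two measures, with no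
    weak-star continuity. Atoms in different fibres of eta may therefore be tested against unrelated
    functions, and a merely Borel e may be used where the measure is diffuse. The left inverse is
    known only on constant kernels, which represent [iota] of a function; all else comes from
    linearity, equivariance and boundedness. The obstacle is that a kernel must produce functions in
    C_0(G). On countably many cosets of N this follows from norm convergence. On the diffuse part
    the set where e and h_n differ must have uniformly small mass under all translates; for
    non-discrete G this is why these sets shrink to N. A non-metrizable G has no continuous norm
    vanishing only at 1, hence N. Right translation of the measure moves the cosets of N, so it is
    limited to elements normalizing N; the other translation only moves the argument of the output
    function. Since the bound on the sums is uniform in F, a fixed nonzero difference repeated along
    many elements of H contradicts it. *)

Section complex_numbers.
Context (R : realType).
Implicit Types (r : R) (z : R[i]).

Lemma rnormC r : rnorm (r%:C : R[i]) = `|r|.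
Proof. by rewrite /rnorm normc_def /= expr0n /= addr0 sqrtr_sqr. Qed.

Lemma rnorm_nat n : rnorm (n%:R : R[i]) = n%:R.
Proof. by rewrite -(rmorph_nat (real_complex R)) rnormC normr_nat. Qed.

Lemma rnorm1 : rnorm (1 : R[i]) = 1.
Proof. exact: (rnorm_nat 1). Qed.

Lemma complexE z : z = (complex.Re z)%:C + 'i * (complex.Im z)%:C.
Proof. by case: z => a b; apply/eqP; rewrite eq_complex /=; apply/andP; split; apply/eqP; ring. Qed.

Lemma rnormBC (V : normedZmodType R[i]) (x y : V) : rnorm (x - y) = rnorm (y - x).
Proof. by rewrite -rnormN opprB. Qed.

Lemma lt0_rnorm (V : normedZmodType R[i]) (x : V) : x != 0 -> 0 < rnorm x.
Proof.
move=> x0; rewrite lt_neqAle rnorm_ge0 andbT eq_sym.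
by apply: contra x0 => /eqP/rnorm0_eq0 ->.
Qed.

End complex_numbers.

(** * Bounded Borel functions *)

Section bounded_borel.
Context (R : realType) (G : lcGroupType).
Local Notation T := (borel G).

(** Measurability is imposed on the real and imaginary parts, since these are what
    [complex_integral] integrates. *)
Definition bborel (f : G -> R[i]) :=
  [/\ exists M, forall x, rnorm (f x) <= M,
      measurable_fun [set: T] (fun x : T => complex.Re (f x)) &
      measurable_fun [set: T] (fun x : T => complex.Im (f x))].

Lemma bborel_lin c f g : bborel f -> bborel g -> bborel (fun x => c * f x + g x).
Proof.
case: c => a b [[M fM] mRf mIf] [[N gN] mRg mIg]; split.
- exists (rnorm (a +i* b) * M + N) => x.
  by rewrite (le_trans (rnormD _ _))// lerD// rnormM ler_wpM2l ?rnorm_ge0.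
- rewrite (_ : (fun _ => _) = (fun x : T =>
      a * complex.Re (f x) - b * complex.Im (f x) + complex.Re (g x))).
    by apply: measurable_funD => //; apply: measurable_funB;
      apply: measurable_funM => //; exact: measurable_cst.
  by apply/funext => x; case: (f x) (g x) => ? ? [].
- rewrite (_ : (fun _ => _) = (fun x : T =>
      a * complex.Im (f x) + b * complex.Re (f x) + complex.Im (g x))).
    by apply: measurable_funD => //; apply: measurable_funD;
      apply: measurable_funM => //; exact: measurable_cst.
  by apply/funext => x; case: (f x) (g x) => ? ? [].
Qed.

Lemma bborel_cst c : bborel (fun=> c).
Proof. by split; [exists (rnorm c)|exact: measurable_cst|exact: measurable_cst]. Qed.

Lemma bborelZ c f : bborel f -> bborel (fun x => c * f x).
Proof.
move=> bf; rewrite (_ : (fun _ => _) = (fun x => c * f x + 0)).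
  exact: bborel_lin (bborel_cst 0).
by apply/funext => x; rewrite addr0.
Qed.

Lemma bborelB f g : bborel f -> bborel g -> bborel (fun x => f x - g x).
Proof.
move=> bf bg; rewrite (_ : (fun _ => _) = (fun x => -1 * g x + f x)).
  exact: bborel_lin.
by apply/funext => x; rewrite mulN1r addrC.
Qed.

Lemma bborelD f g : bborel f -> bborel g -> bborel (fun x => f x + g x).
Proof.
move=> bf bg; rewrite (_ : (fun _ => _) = (fun x => 1 * f x + g x)).
  exact: bborel_lin.
by apply/funext => x; rewrite mul1r.
Qed.

Lemma bborel_real (u : T -> R) M : measurable_fun setT u -> (forall x, `|u x| <= M) ->
  bborel (fun x => (u x)%:C).
Proof. by move=> mu uM; split => //; exists M => x; rewrite rnormC. Qed.

Lemma bborel_indic (A : set G) : borel_set A -> bborel (fun x => (x \in A)%:R).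
Proof.
move=> mA; rewrite (_ : (fun _ => _) = (fun x => (\1_A x : R)%:C)).
  apply: (@bborel_real _ 1); first exact: measurable_indic.
  by move=> x; rewrite indicE ger0_norm// lern1 leq_b1.
by apply/funext => x; rewrite indicE rmorph_nat.
Qed.

Lemma bborel_sum I (r : seq I) (F : I -> G -> R[i]) :
  (forall i, bborel (F i)) -> bborel (fun x => \sum_(i <- r) F i x).
Proof.
move=> bF; elim: r => [|i r ih].
  by rewrite (_ : (fun _ => _) = (fun=> 0)); [exact: bborel_cst
    |apply/funext => x; rewrite big_nil].
rewrite (_ : (fun _ => _) = (fun x => F i x + \sum_(i <- r) F i x)).
  exact: bborelD.
by apply/funext => x; rewrite big_cons.
Qed.

Lemma bborel_continuous (f : G -> R[i]^o) M :
  continuous f -> (forall x, rnorm (f x) <= M) -> bborel f.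
Proof.
move=> cf fM; split; first by exists M.
  apply: continuous_measurable => x.
  by apply: (@continuous_comp _ _ _ f (@complex.Re R)); [exact: cf|exact: Re_continuous].
apply: continuous_measurable => x.
by apply: (@continuous_comp _ _ _ f (@complex.Im R)); [exact: cf|exact: Im_continuous].
Qed.

Lemma bborel_patch (A : set G) f g : borel_set A -> bborel f -> bborel g ->
  bborel (fun x => if x \in A then f x else g x).
Proof.
move=> mA [[M fM] mRf mIf] [[N gN] mRg mIg].
have mb : measurable_fun [set: T] (fun x : T => x \in A).
  apply: (measurable_fun_bool true); rewrite setTI (_ : _ @^-1` _ = A)//.
  by apply/seteqP; split => x /=; [move/set_mem|move/mem_set].
split.
- exists (Num.max M N) => x; rewrite le_max.
  by case: ifP => _; [rewrite fM|rewrite gN orbT].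
- rewrite (_ : (fun _ => _) = (fun x : T =>
      if x \in A then complex.Re (f x) else complex.Re (g x))); last first.
    by apply/funext => x; case: ifP.
  exact: measurable_fun_ifT.
- rewrite (_ : (fun _ => _) = (fun x : T =>
      if x \in A then complex.Im (f x) else complex.Im (g x))); last first.
    by apply/funext => x; case: ifP.
  exact: measurable_fun_ifT.
Qed.

Lemma borel_preimage (phi : G -> G) (A : set G) : continuous phi ->
  borel_set A -> borel_set (phi @^-1` A).
Proof.
move=> cphi mA; have : @measurable_fun _ _ T T setT phi.
  apply: (@measurability _ _ T T setT phi (@open G) erefl) => _ [U oU <-]; rewrite setTI.
  by apply: sub_sigma_algebra; move/continuousP : cphi; exact.
by move=> /(_ measurableT A mA); rewrite setTI.
Qed.

Lemma bborel_comp (phi : G -> G) f : continuous phi -> bborel f ->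
  bborel (fun x => f (phi x)).
Proof.
move=> cphi [[M fM] mR mI]; split; first by exists M.
  move=> _ Y mY; rewrite setTI.
  by have := borel_preimage cphi (mR measurableT Y mY); rewrite setTI.
move=> _ Y mY; rewrite setTI.
by have := borel_preimage cphi (mI measurableT Y mY); rewrite setTI.
Qed.

(** [I] is defined on all maps, but linearity and the supremum-norm bound are required only on
    bounded Borel ones, where integration is linear. *)
Definition bfunctional (I : (G -> R[i]) -> R[i]) :=
  (forall c f g, bborel f -> bborel g ->
     I (fun x => c * f x + g x) = c * I f + I g) /\
  exists2 C : R, 0 <= C & forall f M, bborel f -> 0 <= M ->
     (forall x, rnorm (f x) <= M) -> rnorm (I f) <= C * M.

Lemma bfunctionalB I J : bfunctional I -> bfunctional J ->
  bfunctional (fun f => I f - J f).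
Proof.
move=> [lI [C C0 bI]] [lJ [D D0 bJ]]; split.
  by move=> c f g bf bg; rewrite lI// lJ// mulrBr opprD addrACA.
exists (C + D); first by rewrite addr_ge0.
move=> f M bf M0 fM; rewrite mulrDl (le_trans (rnormD _ _))// rnormN.
by rewrite lerD ?bI ?bJ.
Qed.

Section bfunctional_zero.
Variable I : (G -> R[i]) -> R[i].
Hypothesis bI : bfunctional I.

Lemma bfunctional0 : I (fun=> 0) = 0.
Proof.
have [lI _] := bI.
rewrite -[RHS](addNr (I (fun=> 0))) -mulN1r -lI; [|exact: bborel_cst..].
by congr I; apply/funext => x; rewrite mulr0 addr0.
Qed.

Lemma bfunctionalD f g : bborel f -> bborel g ->
  I (fun x => f x + g x) = I f + I g.
Proof.
have [lI _] := bI; move=> bf bg; rewrite -[I f]mul1r -lI//.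
by congr I; apply/funext => x; rewrite mul1r.
Qed.

Lemma bfunctionalZ c f : bborel f -> I (fun x => c * f x) = c * I f.
Proof.
have [lI _] := bI; move=> bf; rewrite -[RHS]addr0 -bfunctional0 -lI//.
  by congr I; apply/funext => x; rewrite addr0.
exact: bborel_cst.
Qed.

Lemma bfunctional_sub f g : bborel f -> bborel g ->
  I (fun x => f x - g x) = I f - I g.
Proof.
have [lI _] := bI; move=> bf bg; rewrite [RHS]addrC -mulN1r -lI//.
by congr I; apply/funext => x; rewrite mulN1r addrC.
Qed.

Lemma bfunctional_sum J (r : seq J) (F : J -> G -> R[i]) :
  (forall i, bborel (F i)) ->
  I (fun x => \sum_(i <- r) F i x) = \sum_(i <- r) I (F i).
Proof.
move=> bF; elim: r => [|i r ih].
  rewrite big_nil -[RHS]bfunctional0; congr I.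
  by apply/funext => x; rewrite big_nil.
rewrite big_cons -ih -bfunctionalD//; last exact: bborel_sum.
by congr I; apply/funext => x; rewrite big_cons.
Qed.

Hypothesis I0 : forall A, borel_set A -> I (fun x => (x \in A)%:R) = 0.

(** A bounded measurable [u] lies within [d] of a step function with values [k d - M], on which [I]
    vanishes; hence [|I u| <= C d] for every [d > 0]. *)
Lemma bfunctional_zero_real (u : T -> R) M : measurable_fun setT u ->
  (forall x, `|u x| <= M) -> I (fun x => (u x)%:C) = 0.
Proof.
move=> mu uM; apply: rnorm0_eq0; apply/eqP; rewrite eq_le rnorm_ge0 andbT.
have [_ [C C0 IC]] := bI.
have C1 : 0 < C + 1 by rewrite ltr_wpDl.
apply/ler_addgt0Pl => e e0; rewrite addr0.
(* The denominator is positive even if [C = 0], and [C d <= e]. *)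
pose d := e / (C + 1); have d0 : 0 < d by rewrite divr_gt0.
pose v x := (u x + M) / d.
have v0 x : 0 <= v x.
  by rewrite divr_ge0 ?(ltW d0)// -lerBlDr sub0r; have := uM x; rewrite ler_norml => /andP[].
(* Since [0 <= v <= 2 M / d], the index [truncn (v x)] is below [m] at every point. *)
pose m := (Num.truncn ((M + M) / d)).+1.
pose A k : set T := [set x | k%:R <= v x < k.+1%:R].
have mv : measurable_fun setT v.
  by apply: measurable_funM; [apply: measurable_funD => //; exact: measurable_cst
    |exact: measurable_cst].
have mA k : borel_set (A k).
  have := mv measurableT [set` `[k%:R, k.+1%:R[%R] (measurable_itv _).
  by rewrite setTI; congr (borel_set _); apply/seteqP; split => x /=; rewrite in_itv.
pose g x : R[i] := \sum_(k <- iota 0 m) (k%:R * d - M)%:C * (x \in A k)%:R.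
have bg : bborel g by apply: bborel_sum => k; apply: bborelZ; exact: bborel_indic.
have bu : bborel (fun x => (u x)%:C) by exact: bborel_real uM.
have Ig : I g = 0.
  rewrite bfunctional_sum; last by move=> k; apply: bborelZ; exact: bborel_indic.
  rewrite big1// => k _; rewrite bfunctionalZ; last exact: bborel_indic.
  by rewrite I0 ?mulr0.
have -> : I (fun x => (u x)%:C) = I (fun x => (u x)%:C - g x).
  by rewrite bfunctional_sub// Ig subr0.
rewrite (le_trans (IC _ d _ _ _))//; first exact: bborelB.
- by rewrite ltW.
- move=> x; have /andP[k1 k2] := truncn_itv (v0 x).
  set k := Num.truncn (v x) in k1 k2.
  have km : (k < m)%N.
    rewrite /m ltnS; apply: le_truncn; rewrite ler_pM2r ?invr_gt0// lerD2r.
    by rewrite (le_trans (ler_norm _)).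
  have -> : g x = (k%:R * d - M)%:C.
    rewrite /g (bigD1_seq k) ?iota_uniq ?mem_iota//= big1 ?addr0.
      by rewrite mem_set ?mulr1//= /A /= k1 k2.
    move=> j jk; rewrite memNset ?mulr0// /A /= => /andP[j1 j2].
    move/eqP : jk; apply; apply/eqP; rewrite eqn_leq; apply/andP; split.
      by rewrite -ltnS -(ltr_nat R) (le_lt_trans j1 k2).
    by rewrite -ltnS -(ltr_nat R) (le_lt_trans k1 j2).
  rewrite -rmorphB rnormC /=.
  have -> : u x - (k%:R * d - M) = (v x - k%:R) * d.
    by rewrite mulrBl /v divfK ?gt_eqF// opprB addrA.
  rewrite normrM (gtr0_norm d0) ler_piMl ?(ltW d0)//.
  rewrite ger0_norm ?subr_ge0// lerBlDr addrC natr1.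
  exact: ltW.
rewrite /d mulrCA ler_piMr ?(ltW e0)//.
by rewrite ler_pdivrMr// mul1r lerDl.
Qed.

Lemma bfunctional_zero f : bborel f -> I f = 0.
Proof.
move=> [[M fM] mR mI]; rewrite (_ : f = (fun x => 'i * (complex.Im (f x))%:C +
    (complex.Re (f x))%:C)); last first.
  by apply/funext => x; rewrite addrC -complexE.
have bR x : `|complex.Re (f x)| <= M by rewrite (le_trans (Re_le_rnorm _)).
have bIm x : `|complex.Im (f x)| <= M by rewrite (le_trans (Im_le_rnorm _)).
have [lI _] := bI.
rewrite (lI _ _ _ (bborel_real mI bIm) (bborel_real mR bR)).
by rewrite (bfunctional_zero_real mR bR) (bfunctional_zero_real mI bIm) mulr0 addr0.
Qed.

End bfunctional_zero.

(** Reduces identities between integrals to indicators of Borel sets; restrictions, images, point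
    masses and linear combinations of measures are all handled this way. *)
Lemma bfunctional_eq I J : bfunctional I -> bfunctional J ->
  (forall A, borel_set A -> I (fun x => (x \in A)%:R) = J (fun x => (x \in A)%:R)) ->
  forall f, bborel f -> I f = J f.
Proof.
move=> bI bJ IJ f bf; apply/eqP; rewrite -subr_eq0; apply/eqP.
apply: (bfunctional_zero (bfunctionalB bI bJ)) => // A mA.
by rewrite IJ// subrr.
Qed.

End bounded_borel.

(** * Total mass and integrals of complex measures *)

Section total_variation.
Context (R : realType) (G : lcGroupType).
Local Notation T := (borel G).
Implicit Types mu : measure_algebra R G.

(** A stand-in for the total variation of [mu]: the sum of the Hahn variations of the real and
    imaginary parts. It is comparable with [measure_variation], and its sigma-additivity comes for
    free. *)
Definition tau mu : {measure set T -> \bar R} :=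
  measure_add (charge_variation (hahn_posnegP (re_charge mu)))
    (charge_variation (hahn_posnegP (im_charge mu))).

Lemma tauE mu A : borel_set A ->
  tau mu A = (charge_mass (re_charge mu) A + charge_mass (im_charge mu) A)%:E.
Proof.
move=> mA; transitivity (charge_variation (hahn_posnegP (re_charge mu)) A +
    charge_variation (hahn_posnegP (im_charge mu)) A)%E; first exact: measure_addE.
by rewrite /charge_mass /charge_variation /= !EFinD !fineK// fin_num_measure.
Qed.

Definition mass mu (A : set G) : R := fine (tau mu A).

Lemma massE mu A : borel_set A ->
  mass mu A = charge_mass (re_charge mu) A + charge_mass (im_charge mu) A.
Proof. by move=> mA; rewrite /mass tauE. Qed.

Lemma mass_EFin mu A : borel_set A -> (mass mu A)%:E = tau mu A.
Proof. by move=> mA; rewrite /mass fineK// tauE. Qed.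

Lemma mass_ge0 mu A : 0 <= mass mu A.
Proof. by rewrite fine_ge0. Qed.

Lemma mass_le mu A B : borel_set A -> borel_set B -> A `<=` B ->
  mass mu A <= mass mu B.
Proof. by move=> mA mB AB; rewrite -lee_fin !mass_EFin// le_measure ?inE. Qed.

Lemma massU_le mu A B : borel_set A -> borel_set B ->
  mass mu (A `|` B) <= mass mu A + mass mu B.
Proof.
move=> mA mB; rewrite -lee_fin EFinD !mass_EFin//; last exact: measurableU.
exact: measureU2.
Qed.

Lemma massU mu A B : borel_set A -> borel_set B -> A `&` B = set0 ->
  mass mu (A `|` B) = mass mu A + mass mu B.
Proof.
move=> mA mB AB; apply: EFin_inj; rewrite EFinD !mass_EFin//; last exact: measurableU.
exact: measureU.
Qed.

Lemma mass0 mu : mass mu set0 = 0.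
Proof. by rewrite /mass measure0. Qed.

Lemma mass_bigcup0 mu (F : nat -> set G) : (forall n, borel_set (F n)) ->
  (forall n, mass mu (F n) = 0) -> mass mu (\bigcup_n F n) = 0.
Proof.
move=> mF F0; rewrite /mass; suff -> : tau mu (\bigcup_n F n) = 0%E by [].
have mU : @measurable _ T (\bigcup_n F n) by apply: bigcup_measurable => k _; exact: mF.
have H := @measure_sigma_subadditive _ _ _ (tau mu) _ F mF mU (fun x Ux => Ux).
apply/eqP; rewrite eq_le measure_ge0 andbT (le_trans H)//.
by rewrite eseries0// => i _ _; rewrite -mass_EFin// F0.
Qed.

(** The factor 4 counts the positive and negative parts of the real and imaginary charges, each at
    most the variation of [mu] on [B]. *)
Lemma mass_le_variation mu A B : borel_set A -> A `<=` B ->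
  mass mu A <= 4%:R * measure_variation mu B.
Proof.
move=> mA AB; have fv : finite_variation mu by have [] := measure_algebraP mu.
set v := measure_variation mu B.
have H (p : {charge set T -> \bar R}) :
    (p = re_charge mu :> (set T -> \bar R) \/ p = im_charge mu :> (set T -> \bar R)) ->
    charge_mass p A <= v + v.
  move=> pE; rewrite -lee_fin (EFinD v v); apply: charge_mass_le => // C mC CA.
  have nC : rnorm (mu C) <= v by rewrite /v Defs.variation_le//; exact: subset_trans AB.
  by case: pE => ->; rewrite /re_charge /im_charge /= lee_fin (le_trans _ nC)//
    ?Re_le_rnorm ?Im_le_rnorm.
rewrite massE// (le_trans (lerD (H _ (or_introl erefl)) (H _ (or_intror erefl))))//.
by rewrite -!mulr2n -mulrnA mulr_natl.
Qed.

Lemma massT_le mu : mass mu setT <= 4%:R * rnorm mu.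
Proof. exact: (@mass_le_variation mu setT setT measurableT). Qed.

Lemma measure_le_mass mu A : borel_set A -> rnorm (mu A) <= mass mu A.
Proof.
move=> mA; rewrite (le_trans (rnorm_le_ReIm _))// massE// lerD//.
  have := abse_charge_variation (hahn_posnegP (re_charge mu)) mA.
  rewrite /charge_variation /= -[leRHS]fineK ?fin_numD ?fin_num_measure//.
  by rewrite lee_fin /charge_mass fineD ?fin_num_measure.
have := abse_charge_variation (hahn_posnegP (im_charge mu)) mA.
rewrite /charge_variation /= -[leRHS]fineK ?fin_numD ?fin_num_measure//.
by rewrite lee_fin /charge_mass fineD ?fin_num_measure.
Qed.

Lemma mass_tight mu e : 0 < e ->
  exists2 K : set G, compact K & mass mu (~` K) <= e.
Proof.
move=> e0; have [_ _ _ reg] := measure_algebraP mu.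
have [K [U [cK _ _ TU UK]]] := reg setT measurableT (e / 4%:R) ltac:(by rewrite divr_gt0).
exists K => //; have mK : borel_set (~` K).
  by apply: measurableC; exact: compact_borel.
rewrite (le_trans (@mass_le_variation mu _ (U `\` K) mK _))//.
  by move=> x Kx; split => //; exact: TU.
by rewrite mulrC -ler_pdivlMr.
Qed.

Lemma mass_cvg0 mu (F : nat -> set G) e : (forall n, borel_set (F n)) ->
  (forall m n, (m <= n)%N -> F n `<=` F m) -> mass mu (\bigcap_n F n) = 0 ->
  0 < e -> exists n, mass mu (F n) <= e.
Proof.
move=> mF dF F0 e0.
have mI : borel_set (\bigcap_n F n) by apply: bigcapT_measurable => k; exact: mF.
have H : (tau mu \o F) n @[n --> \oo] --> tau mu (\bigcap_n F n).
  apply: nonincreasing_cvg_mu => //; first by rewrite -mass_EFin ?ltry.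
  by move=> m n mn; apply/subsetPset; exact: dF.
rewrite -mass_EFin// F0 in H.
have /fine_cvgP[_ /cvgrPdist_le/(_ _ e0)[n _ Hn]] := H.
exists n; have := Hn n (leqnn n); rewrite sub0r normrN; apply: le_trans.
exact: ler_norm.
Qed.

End total_variation.

Section complex_integral_theory.
Context (R : realType) (G : lcGroupType).
Local Notation T := (borel G).
Implicit Types mu : measure_algebra R G.

Lemma charge_integral_lin (nu : {charge set T -> \bar R}) a b (g h : T -> R) M N :
  measurable_fun setT g -> measurable_fun setT h ->
  (forall x, `|g x| <= M) -> (forall x, `|h x| <= N) ->
  charge_integral nu (fun x => a * g x + b * h x) =
  a * charge_integral nu g + b * charge_integral nu h.
Proof.
move=> mg mh gM hN.
have H (p : {finite_measure set T -> \bar R}) :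
    \int[p]_x (a * g x + b * h x) = a * (\int[p]_x g x) + b * (\int[p]_x h x).
  have ig := bounded_integrable p mg gM.
  have ih := bounded_integrable p mh hN.
  have iZ c (k : T -> R) K : measurable_fun setT k -> (forall x, `|k x| <= K) ->
      p.-integrable setT (EFin \o (fun x => c * k x)).
    move=> mk kK; apply: (@bounded_integrable _ _ _ p _ (`|c| * K)).
      by apply: measurable_funM => //; exact: measurable_cst.
    by move=> x; rewrite normrM ler_wpM2l.
  by rewrite RintegralD ?RintegralZl//; [exact: iZ gM|exact: iZ hN].
by rewrite /charge_integral !H; ring.
Qed.

Lemma bborel_ReIm f : bborel f -> exists M,
  [/\ (forall x : G, `|complex.Re (f x)| <= M),
      (forall x : G, `|complex.Im (f x)| <= M),
      measurable_fun setT (fun x : T => complex.Re (f x)) &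
      measurable_fun setT (fun x : T => complex.Im (f x : R[i]))].
Proof.
move=> [[M fM] mR mI]; exists M; split => // x.
  by rewrite (le_trans (Re_le_rnorm _)).
by rewrite (le_trans (Im_le_rnorm _)).
Qed.

(** The factor 2 arises because each of the two charges integrates both the real and the imaginary
    part of [f]. *)
Lemma complex_integral_bound mu L f M N : borel_set L -> bborel f ->
  0 <= M -> 0 <= N -> (forall x, rnorm (f x) <= N) ->
  (forall x, L x -> rnorm (f x) <= M) ->
  rnorm (complex_integral mu f) <= 2%:R * (M * mass mu setT + N * mass mu (~` L)).
Proof.
move=> mL bf M0 N0 fN fM; have [K [_ _ mR mI]] := bborel_ReIm bf.
have mLC : borel_set (~` L) by exact: measurableC.
have b (p : {charge set T -> \bar R}) (w : T -> R) : measurable_fun setT w ->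
    (forall x, `|w x| <= rnorm (f x)) ->
    `|charge_integral p w| <= M * charge_mass p setT + N * charge_mass p (~` L).
  move=> mw wf; apply: charge_integral_le => //.
    by move=> x; rewrite (le_trans (wf x)).
  by move=> x Lx; rewrite (le_trans (wf x))// fM.
rewrite (le_trans (rnorm_le_ReIm _))// /complex_integral /=.
have h1 := b (re_charge mu) _ mR (fun x => Re_le_rnorm (f x)).
have h2 := b (im_charge mu) _ mI (fun x => Im_le_rnorm (f x)).
have h3 := b (re_charge mu) _ mI (fun x => Im_le_rnorm (f x)).
have h4 := b (im_charge mu) _ mR (fun x => Re_le_rnorm (f x)).
rewrite (le_trans (lerD (ler_normB _ _) (ler_normD _ _)))//.
rewrite (le_trans (lerD (lerD h1 h2) (lerD h3 h4)))//.
rewrite (massE mu (@measurableT _ T)) (massE mu mLC).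
by rewrite le_eqVlt; apply/orP; left; apply/eqP; ring.
Qed.

Lemma complex_integral_le_mass mu f M : bborel f -> 0 <= M ->
  (forall x, rnorm (f x) <= M) ->
  rnorm (complex_integral mu f) <= 2%:R * (M * mass mu setT).
Proof.
move=> bf M0 fM; rewrite (le_trans (complex_integral_bound mu
  (L := setT) (M := M) (N := M) _ bf _ _ _ _))//.
  exact: (@measurableT _ T).
by rewrite setCT mass0 mulr0 addr0.
Qed.

Lemma complex_integral_off mu A f M : borel_set A -> bborel f -> 0 <= M ->
  (forall x, rnorm (f x) <= M) -> (forall x, ~ A x -> f x = 0) ->
  rnorm (complex_integral mu f) <= 2%:R * (M * mass mu A).
Proof.
move=> mA bf M0 fM f0; rewrite (le_trans (complex_integral_bound mu
  (L := ~` A) (M := 0) (N := M) _ bf _ _ _ _))//.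
- exact: measurableC.
- by move=> x /f0 ->; rewrite rnorm0.
- by rewrite mul0r add0r setCK.
Qed.

Lemma complex_integral_lin mu c f g : bborel f -> bborel g ->
  complex_integral mu (fun x => c * f x + g x) =
  c * complex_integral mu f + complex_integral mu g.
Proof.
move=> /bborel_ReIm[M [R1 I1 mR1 mI1]] /bborel_ReIm[N [R2 I2 mR2 mI2]].
case: c => a b; rewrite /complex_integral.
have eR : (fun x => complex.Re ((a +i* b) * f x + g x)) = (fun x =>
    1 * (a * complex.Re (f x) + (- b) * complex.Im (f x)) + 1 * complex.Re (g x)).
  by apply/funext => x; case: (f x) (g x) => ? ? [? ?] /=; ring.
have eI : (fun x => complex.Im ((a +i* b) * f x + g x)) = (fun x =>
    1 * (a * complex.Im (f x) + b * complex.Re (f x)) + 1 * complex.Im (g x)).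
  by apply/funext => x; case: (f x) (g x) => ? ? [? ?] /=; ring.
have m1 s t (u v : T -> R) : measurable_fun setT u -> measurable_fun setT v ->
    measurable_fun setT (fun x => s * u x + t * v x).
  by move=> mu_ mv_; apply: measurable_funD; apply: measurable_funM => //;
    exact: measurable_cst.
have b1 s t (u v : T -> R) : (forall x, `|u x| <= M) -> (forall x, `|v x| <= M) ->
    forall x, `|s * u x + t * v x| <= `|s| * M + `|t| * M.
  by move=> uM vM x; rewrite (le_trans (ler_normD _ _))// !normrM lerD// ler_wpM2l.
rewrite eR eI !(charge_integral_lin _ _ _ (m1 _ _ _ _ mR1 mI1) mR2 (b1 _ _ _ _ R1 I1) R2).
rewrite !(charge_integral_lin _ _ _ (m1 _ _ _ _ mI1 mR1) mI2 (b1 _ _ _ _ I1 R1) I2).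
rewrite !(charge_integral_lin _ _ _ mR1 mI1 R1 I1).
rewrite !(charge_integral_lin _ _ _ mI1 mR1 I1 R1).
by apply/eqP; rewrite eq_complex /=; apply/andP; split; apply/eqP; ring.
Qed.

Lemma complex_integral_bfunctional mu : bfunctional (complex_integral mu).
Proof.
split; first by move=> *; exact: complex_integral_lin.
exists (2%:R * mass mu setT); first by rewrite mulr_ge0 ?mass_ge0.
move=> f M bf M0 fM; rewrite (le_trans (complex_integral_le_mass mu bf M0 fM))//.
by rewrite (mulrC M) mulrA.
Qed.

Lemma charge_integral_indic (nu : {charge set T -> \bar R}) A : borel_set A ->
  charge_integral nu (\1_A) = fine (nu A).
Proof.
move=> mA; rewrite /charge_integral /Rintegral !integral_indic// setIT.
rewrite (jordan_decomp (hahn_posnegP nu) mA) /cadd /= cscaleN1.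
by rewrite fineD ?fineN// ?fin_numN fin_num_measure.
Qed.

Lemma charge_integral0 (nu : {charge set T -> \bar R}) :
  charge_integral nu (fun=> 0) = 0.
Proof.
by rewrite /charge_integral /Rintegral !integral0 subrr.
Qed.

Lemma complex_integral_indic mu A : borel_set A ->
  complex_integral mu (fun x => (x \in A)%:R) = mu A.
Proof.
move=> mA; rewrite /complex_integral.
have -> : (fun x => complex.Re (x \in A)%:R) = (\1_A : T -> R).
  by apply/funext => x; rewrite indicE; case: (x \in A).
have -> : (fun x => complex.Im (x \in A)%:R) = (fun=> 0 : R).
  by apply/funext => x; case: (x \in A).
rewrite !charge_integral_indic// !charge_integral0 subr0 add0r.
by rewrite /re_charge /im_charge /=; case: (mu A).
Qed.

Lemma complex_integral_ext mu (I : (G -> R[i]) -> R[i]) : bfunctional I ->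
  (forall A, borel_set A -> I (fun x => (x \in A)%:R) = mu A) ->
  forall f, bborel f -> complex_integral mu f = I f.
Proof.
move=> bI H; apply: bfunctional_eq => //; first exact: complex_integral_bfunctional.
by move=> A mA; rewrite H// complex_integral_indic.
Qed.

Lemma complex_integral_measure_lin c mu nu f : bborel f ->
  complex_integral (c *: mu + nu) f = c * complex_integral mu f + complex_integral nu f.
Proof.
have [l1 [C C0 b1]] := complex_integral_bfunctional mu.
have [l2 [D D0 b2]] := complex_integral_bfunctional nu.
apply: (complex_integral_ext
  (I := fun f => c * complex_integral mu f + complex_integral nu f)); last first.
  by move=> A mA; rewrite !complex_integral_indic.
split.
  by move=> k g h bg bh; rewrite l1// l2//; ring.
exists (rnorm c * C + D); first by rewrite addr_ge0// mulr_ge0 ?rnorm_ge0.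
move=> g M bg M0 gM; rewrite (le_trans (rnormD _ _))// mulrDl lerD ?b2//.
by rewrite rnormM -mulrA ler_wpM2l ?rnorm_ge0 ?b1.
Qed.

End complex_integral_theory.

(** * Restrictions, images and point masses *)

Section measure_constructions.
Context (R : realType) (G : lcGroupType).
Implicit Types mu : measure_algebra R G.

(** Restrictions and images turn a disjoint Borel family testing [lam] into one testing [mu]; finite
    variation and regularity are transferred in this way. *)
Lemma variation_transfer (lam mu : set G -> R[i]^o) (E F : set G) :
  finite_variation mu ->
  (forall nF, disjoint_borel E nF -> exists2 nF', disjoint_borel F nF' &
     variation_sum nF lam = variation_sum nF' mu) ->
  measure_variation lam E <= measure_variation mu F.
Proof.
move=> fv H; apply: variation_lub => nF /H[nF' hF' ->].
exact: variation_ub.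
Qed.

Lemma finite_variation_transfer (lam mu : set G -> R[i]^o) :
  finite_variation mu ->
  (forall nF, disjoint_borel setT nF -> exists2 nF', disjoint_borel setT nF' &
     variation_sum nF lam = variation_sum nF' mu) ->
  finite_variation lam.
Proof.
move=> [M hM] H; exists M => _ [nF /H[nF' hF' ->] <-].
by apply: hM; exists nF'.
Qed.

Section restriction.
Variables (mu : measure_algebra R G) (B : set G).
Hypothesis mB : borel_set B.

(** The intersection with [B] may be Borel when [E] is not, so the normalization outside the Borel
    sets is restored by a test. *)
Let res (E : set G) : R[i]^o := if `[< borel_set E >] then mu (E `&` B) else 0.

Let resE E : borel_set E -> res E = mu (E `&` B).
Proof. by move=> mE; rewrite /res; case: asboolP. Qed.

Let res_transfer E nF : disjoint_borel E nF ->
  exists2 nF', disjoint_borel E nF' & variation_sum nF res = variation_sum nF' mu.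
Proof.
move=> [mF tF FE]; exists (nF.1, fun i => nF.2 i `&` B); last first.
  by apply: eq_bigr => i _; rewrite resE.
split => /=.
- by move=> i; apply: measurableI => //; exact: mF.
- exact: trivIset_setIr.
- by move=> i x [Fx _]; exact: FE Fx.
Qed.

Lemma restriction_subproof : res \in @measure_pred R G.
Proof.
have [mu0 mus muv mur] := measure_algebraP mu; apply/mem_set; split.
- by move=> E nE; rewrite /res; case: asboolP.
- move=> F mF tF; rewrite resE; last by apply: bigcup_measurable => i _; exact: mF.
  rewrite setI_bigcupl (_ : (fun n => _) = (fun n => \sum_(0 <= i < n) mu (F i `&` B))).
    apply: mus; last exact: trivIset_setIr.
    by move=> i; apply: measurableI => //; exact: mF.
  by apply/funext => n; apply: eq_bigr => i _; rewrite resE.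
- by apply: (finite_variation_transfer muv) => nF; exact: res_transfer.
- move=> E mE e e0; have [K [U [cK oU KE EU KU]]] := mur E mE e e0.
  exists K, U; split => //; apply: le_trans KU; apply: variation_transfer => //.
  by move=> nF; exact: res_transfer.
Qed.

Definition restriction : measure_algebra R G := MkMeasure restriction_subproof.

Lemma restrictionE E : borel_set E -> restriction E = mu (E `&` B).
Proof. exact: resE. Qed.

Lemma complex_integral_restriction f : bborel f ->
  complex_integral restriction f =
  complex_integral mu (fun x => if x \in B then f x else 0).
Proof.
have [l [C C0 b]] := complex_integral_bfunctional mu.
have bB g : bborel g -> bborel (fun x => if x \in B then g x else 0 : R[i]).
  by move=> bg; apply: bborel_patch => //; exact: bborel_cst.
apply: (complex_integral_ext
  (I := fun f => complex_integral mu (fun x => if x \in B then f x else 0))).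
  split=> [c g h bg bh|].
    rewrite -l; [|exact: bB..]; congr complex_integral.
    by apply/funext => x; case: ifP; rewrite ?mulr0 ?addr0.
  exists C => // g M bg M0 gM; apply: b => //; first exact: bB.
  by move=> x; case: ifP; rewrite ?rnorm0.
move=> A mA; rewrite restrictionE// -complex_integral_indic; last exact: measurableI.
congr complex_integral; apply/funext => x; rewrite in_setI.
by case: (x \in A); case: (x \in B).
Qed.

End restriction.

Section pushforward.
Variables (mu : measure_algebra R G) (phi psi : G -> G).
Hypothesis cphi : continuous phi.
Hypothesis cpsi : continuous psi.
Hypothesis phiK : cancel phi psi.
Hypothesis psiK : cancel psi phi.

Let push (E : set G) : R[i]^o := mu (phi @^-1` E).

Let push_transfer E nF : disjoint_borel E nF -> exists2 nF',
  disjoint_borel (phi @^-1` E) nF' & variation_sum nF push = variation_sum nF' mu.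
Proof.
move=> [mF tF FE]; exists (nF.1, fun i => phi @^-1` (nF.2 i)) => //.
split => /=.
- by move=> i; apply: borel_preimage => //; exact: mF.
- apply/trivIsetP => i j _ _ ij; move/trivIsetP : tF => /(_ i j I I ij) h.
  by rewrite -preimage_setI h preimage_set0.
- by move=> i x Fx; exact: FE Fx.
Qed.

Lemma homeo_image E : phi @` E = psi @^-1` E.
Proof.
apply/seteqP; split => [_ [x Ex <-]|x Ex]; first by rewrite /preimage /= phiK.
by exists (psi x).
Qed.

Lemma homeo_preimageK E : psi @^-1` (phi @^-1` E) = E.
Proof. by apply/seteqP; split => x; rewrite /preimage /= psiK. Qed.

Lemma pushforward_subproof : push \in @measure_pred R G.
Proof.
have [mu0 mus muv mur] := measure_algebraP mu; apply/mem_set; split.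
- move=> E nE; apply: mu0 => mE; apply: nE.
  by rewrite -(homeo_preimageK E); exact: borel_preimage.
- move=> F mF tF; rewrite /push preimage_bigcup; apply: mus.
    by move=> i; exact: borel_preimage.
  apply/trivIsetP => i j _ _ ij; move/trivIsetP : tF => /(_ i j I I ij) h.
  by rewrite -preimage_setI h preimage_set0.
- apply: (finite_variation_transfer muv) => nF /push_transfer.
  by rewrite preimage_setT.
- move=> E mE e e0.
  have [K [U [cK oU KE EU KU]]] := mur _ (borel_preimage cphi mE) e e0.
  exists (phi @` K), (psi @^-1` U); split.
  + by apply: continuous_compact => //; exact: continuous_subspaceT.
  + by move/continuousP : cpsi; exact.
  + by move=> _ [x Kx <-]; exact: KE.
  + by move=> x Ex; apply: EU; rewrite /preimage /= psiK.
  apply: le_trans KU; apply: variation_transfer => // nF /push_transfer.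
  rewrite homeo_image (_ : phi @^-1` (psi @^-1` U `\` psi @^-1` K) = U `\` K)//.
  by apply/seteqP; split => x; rewrite /preimage /setD /= phiK.
Qed.

Definition pushforward_measure : measure_algebra R G := MkMeasure pushforward_subproof.

Lemma complex_integral_pushforward f : bborel f ->
  complex_integral pushforward_measure f = complex_integral mu (f \o phi).
Proof.
have [l [C C0 b]] := complex_integral_bfunctional mu.
apply: (complex_integral_ext (I := fun f => complex_integral mu (f \o phi))).
  split=> [c g h bg bh|].
    by apply: (l c (g \o phi) (h \o phi)); exact: bborel_comp.
  exists C => // g M bg M0 gM; apply: b => //; first exact: bborel_comp.
  by move=> x; exact: gM.
by move=> A mA; exact: (complex_integral_indic mu (borel_preimage cphi mA)).
Qed.

End pushforward.

Section dirac.
Variable s : G.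

Let dir (E : set G) : R[i]^o := (`[< borel_set E >] && (s \in E))%:R.

Let dirE E : borel_set E -> dir E = (s \in E)%:R.
Proof. by move=> mE; rewrite /dir; case: asboolP. Qed.

Let dir_sum n (F : nat -> set G) : (forall i, borel_set (F i)) ->
  trivIset setT F -> \sum_(0 <= i < n) dir (F i) = (s \in \bigcup_(i < n) F i)%:R.
Proof.
move=> mF tF; elim: n => [|n ih].
  rewrite big_geq// (_ : \bigcup_(_ < _) _ = set0) ?in_set0//.
  by rewrite bigcup0.
rewrite big_nat_recr//= ih dirE//.
have -> : \bigcup_(i < n.+1) F i = \bigcup_(i < n) F i `|` F n.
  apply/seteqP; split => [x [i /= + Fx]|x [[i /= ni Fx]|Fx]].
  - by rewrite ltnS leq_eqVlt => /predU1P[<-|ni]; [right|left; exists i].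
  - by exists i => //=; rewrite ltnS ltnW.
  - by exists n => /=.
rewrite in_setU; case: (boolP (s \in F n)) => sn; last by rewrite orbF addr0.
rewrite orbT memNset ?add0r// => -[i /= ni Fi].
move/trivIsetP : tF => /(_ i n I I).
rewrite ltn_eqF// => /(_ isT) FF.
suff : (F i `&` F n) s by rewrite FF.
by split => //; exact/set_mem.
Qed.

(** Every variation sum is 0 or 1, and 0 on sets missing [s]. For regularity it therefore suffices
    that [s] be outside the difference of [U] and [K]: take [K = {s}] if [s] is in [E], and let [U]
    be the complement of [s] otherwise. *)
Lemma dirac_subproof : dir \in @measure_pred R G.
Proof.
have vE (E : set G) nF : disjoint_borel E nF ->
    variation_sum nF dir = (s \in \bigcup_(i < nF.1) nF.2 i)%:R.
  move=> [mF tF _]; rewrite /variation_sum.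
  rewrite -rnorm_nat -dir_sum// -[RHS]/(rnorm _).
  rewrite [in RHS](_ : \sum_(_ <= _ < _) _ =
    (\sum_(0 <= i < nF.1) rnorm (dir (nF.2 i)))%:C).
    by rewrite rnormC ger0_norm// sumr_ge0// => i _; exact: rnorm_ge0.
  rewrite rmorph_sum; apply: eq_bigr => i _.
  by rewrite /dir rnorm_nat rmorph_nat.
apply/mem_set; split.
- by move=> E nE; rewrite /dir; case: asboolP.
- move=> F mF tF; rewrite dirE; last by apply: bigcup_measurable => i _; exact: mF.
  rewrite (_ : (fun n => _) = (fun n => (s \in \bigcup_(i < n) F i)%:R)); last first.
    by apply/funext => n; rewrite dir_sum.
  apply: cvg_near_cst; case: (boolP (s \in \bigcup_i F i)) => [/set_mem[k _ Fk]|sF].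
    exists k.+1 => //= n /= kn; apply/eqP; rewrite mem_set//.
    by exists k.
  apply: nearW => n; apply/eqP; rewrite memNset// => -[k _ Fk].
  by move/negP : sF; apply; apply/mem_set; exists k.
- exists 1 => _ [nF hnF <-]; rewrite (vE _ _ hnF) lern1.
  by rewrite leq_b1.
- move=> E mE e e0; have cl1 : closed [set s].
    apply: compact_closed; last exact: compact_set1.
    exact: lcgroup_hausdorff.
  have z (D : set G) : ~ D s -> measure_variation dir D <= e.
    move=> Ds; apply: variation_lub => nF hnF; rewrite (vE _ _ hnF) memNset ?ltW//.
    by move=> [i _ Fi]; apply: Ds; have [_ _ ] := hnF; apply; exact: Fi.
  have [sE|sE] := pselect (E s).
    exists [set s], setT; split => //.
    + exact: compact_set1.
    + exact: openT.
    + by move=> _ ->.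
    + by apply: z => -[_]; apply.
  exists set0, (~` [set s]); split => //.
  + exact: compact0.
  + exact: closed_openC.
  + by move=> x Ex /= xs; apply: sE; rewrite -xs.
  + by apply: z => -[/= H _]; exact: H.
Qed.

Definition dirac_measure : measure_algebra R G := MkMeasure dirac_subproof.

Lemma dirac_measureE E : borel_set E -> dirac_measure E = (s \in E)%:R.
Proof. exact: dirE. Qed.

Lemma complex_integral_dirac f : bborel f -> complex_integral dirac_measure f = f s.
Proof.
apply: (complex_integral_ext (I := fun f => f s)); last first.
  by move=> A mA; rewrite dirac_measureE.
split => //; exists 1 => // g M _ _ gM; by rewrite mul1r.
Qed.

End dirac.

End measure_constructions.

(** * C_0(G): uniform limits, Urysohn functions, uniqueness of representing measures *)

Section C0_functions.
Context (R : realType) (G : lcGroupType).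

Lemma rnorm_C0_ge (f : C0 R G) x : rnorm (f x) <= rnorm f.
Proof.
apply: (@sup_norm_ub R (C0 R G) G setT (fun x (f : C0 R G) => rnorm (f x))) => // g.
by have [M _ gM] := C0_bounded g; exists M => _ [y _ <-].
Qed.

Lemma rnorm_C0_le (f : C0 R G) M : (forall x, rnorm (f x) <= M) -> rnorm f <= M.
Proof.
move=> fM; apply: (@sup_norm_le R (C0 R G) G setT (fun x (f : C0 R G) => rnorm (f x))) => //.
by exists point.
Qed.

Lemma bborel_C0 (f : C0 R G) : bborel f.
Proof. by apply: (@bborel_continuous _ _ _ (rnorm f)); [exact: C0_continuous|exact: rnorm_C0_ge]. Qed.

Lemma C0_ext (f g : C0 R G) : (forall x, f x = g x) -> f = g.
Proof. by move=> fg; apply/val_inj/funext. Qed.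

Lemma C0_mem_ext (f : C0 R G) (h : G -> R[i]^o) : (forall x, h x = f x) ->
  h \in @C0_pred R G.
Proof. by move=> /funext ->; case: f. Qed.

Lemma C0_uniform_limit (f : G -> R[i]^o) :
  (forall e : R, 0 < e -> exists g : C0 R G, forall x, rnorm (f x - g x) <= e) ->
  f \in @C0_pred R G.
Proof.
move=> H; apply/mem_set; split.
  apply/complex_continuousP => x e e0.
  have [g fg] := H _ (divr_gt0 e0 (ltr0n _ 3)).
  have /complex_continuousP/(_ x _ (divr_gt0 e0 (ltr0n _ 3))) := @C0_continuous _ _ g.
  apply: filterS => y gyx.
  have -> : f y - f x = (f y - g y) + (g y - g x) - (f x - g x) by ring.
  rewrite (le_trans (rnormD _ _))// rnormN.
  have -> : e = (e / 3%:R + e / 3%:R) + e / 3%:R by field.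
  by rewrite lerD// (le_trans (rnormD _ _))// lerD.
move=> e e0; have [g fg] := H _ (divr_gt0 e0 (ltr0n _ 2)).
have [K cK gK] := C0_vanishes g (divr_gt0 e0 (ltr0n _ 2)).
exists K => // x /gK gx; rewrite -(subrK (g x) (f x)) (le_trans (rnormD _ _))//.
by rewrite (splitr e) lerD.
Qed.

(** The one-point compactification is compact Hausdorff, hence normal. Urysohn's function there is 0
    on the complement of [U], a closed set containing the point at infinity. *)
Lemma urysohn_C0 (K U : set G) : compact K -> open U -> K `<=` U ->
  exists u : G -> R, [/\ (fun x => (u x)%:C : R[i]^o) \in @C0_pred R G,
    forall x, 0 <= u x <= 1, forall x, K x -> u x = 1 & forall x, ~ U x -> u x = 0].
Proof.
move=> cK oU KU; pose X := one_point_compactification G.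
have hX : hausdorff_space X.
  by apply: one_point_compactification_hausdorff;
    [exact: lcgroup_locally_compact|exact: lcgroup_hausdorff].
have nX : normal_space X by exact: compact_normal one_point_compactification_compact.
pose A : set X := ~` (Some @` U); pose B : set X := Some @` K.
have clA : closed A.
  by apply: open_closedC; exact: one_point_compactification_open_some.
have cSome : continuous (Some : G -> X).
  exact: one_point_compactification_some_continuous.
have clB : closed B.
  apply: compact_closed => //; apply: continuous_compact => //.
  exact: continuous_subspaceT.
have AB : A `&` B = set0.
  by rewrite -subset0 => y [nU [x Kx xy]]; apply: nU; rewrite -xy; exists x => //; exact: KU.
have sep := (@normal_separatorP R X).1 nX A B clA clB AB.
pose u x := @Urysohn X R A B (Some x).
have uA y : A y -> @Urysohn X R A B y = 0.
  by move=> Ay; apply: (Urysohn_sub0 sep); exists y.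
have u01 x : 0 <= u x <= 1.
  have : (@Urysohn X R A B @` setT) (u x) by exists (Some x).
  by move/Urysohn_range; rewrite /= in_itv.
exists u; split => //.
- apply/mem_set; split.
    apply/complex_continuousP => x e e0.
    have cu : {for x, continuous u}.
      apply: (@continuous_comp _ _ _ (Some : G -> X) (@Urysohn X R A B)); first exact: cSome.
      exact: Urysohn_continuous.
    have /(@cvgrPdist_le _ _ _ (nbhs x))/(_ _ e0) := cu.
    by apply: filterS => y; rewrite -rmorphB rnormC distrC.
  (* Continuity at [None], where the function is 0, is vanishing at infinity. *)
  move=> e e0; have uN : @Urysohn X R A B None = 0 by apply: uA => -[].
  have := @Urysohn_continuous X R A B None.
  move/(@cvgrPdist_le _ _ _ (nbhs (None : X)))/(_ _ e0) => [C [cC _] HC].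
  exists C => // x nCx; rewrite rnormC.
  have := HC (Some x); rewrite /= uN sub0r normrN; apply.
  by left; exists x.
- by move=> x Kx; apply: (Urysohn_sub1 sep); exists (Some x) => //; exists x.
- by move=> x nU; apply: uA => -[y Uy [yx]]; apply: nU; rewrite -yx.
Qed.

(** The difference [nu] vanishes on compact sets by comparison with Urysohn functions, then on Borel
    sets by inner regularity. This is the uniqueness half of the Riesz representation theorem. *)
Lemma measure_eq (lam mu : measure_algebra R G) :
  (forall f : C0 R G, complex_integral lam f = complex_integral mu f) -> lam = mu.
Proof.
move=> H; pose nu := (-1 : R[i]) *: mu + lam.
have nuE f : bborel f -> complex_integral nu f = - complex_integral mu f + complex_integral lam f.
  by move=> bf; rewrite complex_integral_measure_lin// mulN1r.
have nu0 (f : C0 R G) : complex_integral nu f = 0.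
  by rewrite nuE ?H ?addNr//; exact: bborel_C0.
suff : nu = 0 by rewrite /nu scaleN1r => /eqP; rewrite addr_eq0 eqr_opp => /eqP.
have [nuB nuS nuV nuR] := measure_algebraP nu.
have K0 K : compact K -> nu K = 0.
  move=> cK; have mK := compact_borel cK.
  apply: rnorm0_eq0; apply/eqP; rewrite eq_le rnorm_ge0 andbT.
  apply/ler_addgt0Pl => e e0; rewrite addr0.
  (* The 8 is the factor 2 of [complex_integral_off] times the factor 4 of [mass_le_variation]. *)
  have e8 : 0 < e / 8%:R by rewrite divr_gt0.
  have [L [U [cL oU LK KU UL]]] := nuR K mK _ e8.
  have [u [Cu u01 u1 u0]] := urysohn_C0 cK oU KU.
  pose f : C0 R G := MkC0 Cu.
  have mU : borel_set U by exact: sub_sigma_algebra.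
  have mUK : borel_set (U `\` K) by exact: measurableD.
  rewrite -complex_integral_indic// -[X in rnorm X]subr0 -(nu0 f).
  rewrite -(bfunctional_sub (complex_integral_bfunctional nu));
    [|exact: bborel_indic|exact: bborel_C0].
  rewrite (le_trans (complex_integral_off nu (A := U `\` K) (M := 1) mUK _ ler01 _ _))//.
  - by apply: bborelB; [exact: bborel_indic|exact: bborel_C0].
  - move=> x; rewrite -(rmorph_nat (real_complex R)) -rmorphB rnormC ler_norml.
    have /andP[h0 h1] := u01 x.
    by case: (x \in K) => /=; apply/andP; split; lra.
  - move=> x nx /=; have [Kx|nK] := pselect (K x).
      by rewrite mem_set// u1// subrr.
    rewrite memNset// u0 ?subrr// => Ux; exact: nx.
  rewrite mul1r -ler_pdivlMl// (le_trans (mass_le_variation nu (B := U `\` L) mUK _))//.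
    by move=> x [Ux nK]; split => // /LK.
  by rewrite -ler_pdivlMl// (le_trans UL)// le_eqVlt; apply/orP; left; apply/eqP; field.
apply/val_inj/funext => E; change (nu E = 0).
have [mE|nE] := pselect (borel_set E); last exact: nuB.
apply: rnorm0_eq0; apply/eqP; rewrite eq_le rnorm_ge0 andbT.
apply/ler_addgt0Pl => e e0; rewrite addr0.
have [K [U [cK oU KE EU UK]]] := nuR E mE _ e0.
have mK := compact_borel cK.
have mEK : borel_set (E `\` K) by exact: measurableD.
have -> : nu E = nu (E `\` K).
  rewrite -!complex_integral_indic//.
  rewrite -[RHS]addr0 -(K0 _ cK) -(complex_integral_indic nu mK).
  rewrite -(bfunctionalD (complex_integral_bfunctional nu)); [|exact: bborel_indic..].
  congr complex_integral; apply/funext => x; rewrite in_setD.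
  case: (boolP (x \in K)) => [/set_mem/KE/mem_set ->|_]; first by rewrite andbF add0r.
  by rewrite andbT addr0.
rewrite (le_trans _ UK)// (Defs.variation_le nuV)// => x [Ex nKx]; split => //.
exact: EU.
Qed.

End C0_functions.

(** * Translations and convolution *)

Section translations.
Context (R : realType) (G : lcGroupType).
Implicit Types (mu : measure_algebra R G) (f : C0 R G) (s x y : G).

Lemma mulgl_continuous s : continuous (fun y : G => (s * y)%g).
Proof.
move=> y; apply: (@continuous_comp _ _ _ (fun y => (s, y)) (fun p : G * G => p.1 * p.2)%g);
  last exact: mulg_continuous.
by apply: cvg_pair; [exact: cvg_cst|exact: cvg_id].
Qed.

Lemma mulgr_continuous s : continuous (fun y : G => (y * s)%g).
Proof.
move=> y; apply: (@continuous_comp _ _ _ (fun y => (y, s)) (fun p : G * G => p.1 * p.2)%g);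
  last exact: mulg_continuous.
by apply: cvg_pair; [exact: cvg_id|exact: cvg_cst].
Qed.

Definition rtrans s mu : measure_algebra R G :=
  pushforward_measure mu (@mulgr_continuous s) (@mulgr_continuous s^-1%g)
    (fun y => mulgK s y) (fun y => mulgVK s y).

Definition ltrans s mu : measure_algebra R G :=
  pushforward_measure mu (@mulgl_continuous s) (@mulgl_continuous s^-1%g)
    (fun y => mulKg s y) (fun y => mulVKg s y).

Lemma complex_integral_rtrans s mu (f : G -> R[i]) : bborel f ->
  complex_integral (rtrans s mu) f = complex_integral mu (fun y => f (y * s)%g).
Proof. exact: complex_integral_pushforward. Qed.

Lemma complex_integral_ltrans s mu (f : G -> R[i]) : bborel f ->
  complex_integral (ltrans s mu) f = complex_integral mu (fun y => f (s * y)%g).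
Proof. exact: complex_integral_pushforward. Qed.

Lemma rtrans_lin s c mu nu : rtrans s (c *: mu + nu) = c *: rtrans s mu + rtrans s nu.
Proof. exact/val_inj. Qed.

Lemma ltrans_lin s c mu nu : ltrans s (c *: mu + nu) = c *: ltrans s mu + ltrans s nu.
Proof. exact/val_inj. Qed.

Lemma rtrans_dirac1 s : rtrans s (dirac_measure R 1%g) = dirac_measure R s.
Proof.
apply: measure_eq => f; rewrite complex_integral_rtrans; last exact: bborel_C0.
rewrite !complex_integral_dirac ?mul1g//; first exact: bborel_C0.
apply: bborel_comp; [exact: mulgr_continuous|exact: bborel_C0].
Qed.

Lemma ltrans_dirac1 s : ltrans s (dirac_measure R 1%g) = dirac_measure R s.
Proof.
apply: measure_eq => f; rewrite complex_integral_ltrans; last exact: bborel_C0.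
rewrite !complex_integral_dirac ?mulg1//; first exact: bborel_C0.
apply: bborel_comp; [exact: mulgl_continuous|exact: bborel_C0].
Qed.

Lemma shift_subproof s t f : (fun x => f (s * x * t)%g : R[i]^o) \in @C0_pred R G.
Proof.
apply/mem_set; split.
  move=> x; apply: (@continuous_comp _ _ _ (fun x => (s * x * t)%g) f); last exact: C0_continuous.
  apply: (@continuous_comp _ _ _ (fun x => (s * x)%g) (fun x => (x * t)%g)).
    exact: mulgl_continuous.
  exact: mulgr_continuous.
move=> e e0; have [K cK fK] := C0_vanishes f e0.
exists ((fun x => s^-1 * x * t^-1)%g @` K); last first.
  move=> x nx; apply: fK => Kx; apply: nx; exists (s * x * t)%g => //.
  by rewrite !mulgA mulVg mul1g -mulgA mulgV mulg1.
apply: continuous_compact => //; apply: continuous_subspaceT => x.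
apply: (@continuous_comp _ _ _ (fun x => (s^-1 * x)%g) (fun x => (x * t^-1)%g)).
  exact: mulgl_continuous.
exact: mulgr_continuous.
Qed.

Definition shift s t f : C0 R G := MkC0 (shift_subproof s t f).

Lemma bborel_shiftl x f : bborel (fun y => f (x * y)%g).
Proof. apply: bborel_comp; [exact: mulgl_continuous|exact: bborel_C0]. Qed.

Lemma bborel_shiftr x f : bborel (fun y => f (y * x)%g).
Proof. apply: bborel_comp; [exact: mulgr_continuous|exact: bborel_C0]. Qed.

Lemma C0_lactE mu f x : C0_lact mu f x = complex_integral mu (fun y => f (x * y)%g).
Proof. by []. Qed.

Lemma C0_ractE mu f x : C0_ract f mu x = complex_integral mu (fun y => f (y * x)%g).
Proof. by []. Qed.

Lemma C0_lact_dirac s f x : C0_lact (dirac_measure R s) f x = f (x * s)%g.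
Proof. by rewrite C0_lactE complex_integral_dirac//; exact: bborel_shiftl. Qed.

Lemma C0_ract_dirac s f x : C0_ract f (dirac_measure R s) x = f (s * x)%g.
Proof. by rewrite C0_ractE complex_integral_dirac//; exact: bborel_shiftr. Qed.

(** Representing measures are unique, so any explicit solution is the value of [xget]. When a factor
    is a point mass, the translate of the other factor is such a solution. *)
Lemma convolution_unique mu nu lam : (forall f, complex_integral lam f =
    complex_integral mu (fun x => complex_integral nu (fun y => f (x * y)%g))) ->
  convolution mu nu = lam.
Proof.
move=> H; apply: measure_eq => f; rewrite H.
apply: (@xgetPex _ 0 [set lambda : measure_algebra R G | forall f : C0 R G,
  complex_integral lambda f = complex_integral mu (fun x =>
    complex_integral nu (fun y => f (x * y)%g))]).
by exists lam.
Qed.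

Lemma convolution_diracr mu s : convolution mu (dirac_measure R s) = rtrans s mu.
Proof.
apply: convolution_unique => f; rewrite complex_integral_rtrans; last exact: bborel_C0.
congr complex_integral; apply/funext => x.
by rewrite complex_integral_dirac//; exact: bborel_shiftl.
Qed.

Lemma convolution_diracl mu s : convolution (dirac_measure R s) mu = ltrans s mu.
Proof.
apply: convolution_unique => f; rewrite complex_integral_ltrans; last exact: bborel_C0.
by rewrite (complex_integral_dirac s (bborel_C0 (C0_lact mu f))).
Qed.

Lemma C0_lact_lin c mu nu f :
  C0_lact (c *: mu + nu) f = c *: C0_lact mu f + C0_lact nu f.
Proof.
apply: C0_ext => x; rewrite C0_lactE complex_integral_measure_lin//.
exact: bborel_shiftl.
Qed.

Lemma C0_ract_lin c mu nu f :
  C0_ract f (c *: mu + nu) = c *: C0_ract f mu + C0_ract f nu.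
Proof.
apply: C0_ext => x; rewrite C0_ractE complex_integral_measure_lin//.
exact: bborel_shiftr.
Qed.

Lemma C0_ract_linl c mu f g :
  C0_ract (c *: f + g) mu = c *: C0_ract f mu + C0_ract g mu.
Proof.
apply: C0_ext => x; rewrite C0_ractE.
rewrite [LHS](complex_integral_lin mu c (bborel_shiftr x f) (bborel_shiftr x g)).
by [].
Qed.

Lemma complex_integral_le mu (h : G -> R[i]) M : bborel h -> 0 <= M ->
  (forall x, rnorm (h x) <= M) -> rnorm (complex_integral mu h) <= 8%:R * M * rnorm mu.
Proof.
move=> bh M0 hM; rewrite (le_trans (complex_integral_le_mass mu bh M0 hM))//.
have -> : 8%:R * M * rnorm mu = 2%:R * (M * (4%:R * rnorm mu)) by ring.
by rewrite ler_wpM2l// ler_wpM2l// massT_le.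
Qed.

Lemma rnorm_C0_ract mu f : rnorm (C0_ract f mu) <= 8%:R * rnorm f * rnorm mu.
Proof.
apply: rnorm_C0_le => x; rewrite C0_ractE; apply: complex_integral_le.
- exact: bborel_shiftr.
- exact: rnorm_ge0.
- by move=> y; exact: rnorm_C0_ge.
Qed.

Lemma rnorm_dirac s : rnorm (dirac_measure R s) <= 1.
Proof.
apply: variation_lub => -[n F] [/= mF tF _]; rewrite /variation_sum /=.
have n0 i : rnorm (dirac_measure R s (F i)) = (s \in F i)%:R.
  by rewrite dirac_measureE// rnorm_nat.
under eq_bigr do rewrite n0.
have [[i Fi]|nF] := pselect (exists i, F i s); last first.
  rewrite big1// => i _; rewrite memNset// => Fi; apply: nF; by exists i.
have [ni|ni] := leqP n i.
  rewrite big1_seq ?ler01// => j /andP[_]; rewrite mem_index_iota => /andP[_ jn].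
  rewrite memNset// => Fj; move/trivIsetP : tF => /(_ i j I I).
  rewrite gtn_eqF ?(leq_trans jn ni)// => /(_ isT) FF.
  by have : (F i `&` F j) s by []; rewrite FF.
rewrite (bigD1_seq i) ?mem_index_iota ?iota_uniq//= big1 ?addr0 ?lern1 ?leq_b1//.
move=> j ji; rewrite memNset// => Fj; move/trivIsetP : tF => /(_ j i I I ji) FF.
by have : (F j `&` F i) s by []; rewrite FF.
Qed.

End translations.

(** * The unitization of M(G) *)

Section unit_extension.
Context (R : realType) (G : lcGroupType).
Local Notation A := (measure_algebra R G).
Local Notation A1 := (unitization A).
Implicit Types x y : A1.

(* M(G) has the identity [dirac 1]; [theta] is the resulting retraction of the
   unitization onto M(G). *)
Definition theta x : A := x.2 *: dirac_measure R 1%g + x.1.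

Lemma theta_lin : linear theta.
Proof.
move=> c x y; rewrite /theta /=.
by rewrite scalerDl scalerDr !scalerA -!addrA; congr (_ + _); rewrite addrCA.
Qed.

Lemma rnorm_unitization x : rnorm x = rnorm x.1 + rnorm x.2.
Proof.
by rewrite {1}/rnorm (_ : `|x| = `|x.1| + `|x.2|).
Qed.

Lemma rnorm_theta x : rnorm (theta x) <= rnorm x.
Proof.
rewrite rnorm_unitization addrC (le_trans (rnormD _ _))// lerD2r.
by rewrite rnormZ ler_piMr ?rnorm_ge0// rnorm_dirac.
Qed.

Lemma unitization_lactE x (f : C0 R G) :
  unitization_lact (@C0_lact R G) x f = C0_lact (theta x) f.
Proof.
rewrite /theta C0_lact_lin addrC; congr (_ + _ *: _).
by apply: C0_ext => z; rewrite C0_lact_dirac mulg1.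
Qed.

Lemma unitization_ractE x (f : C0 R G) :
  unitization_ract (@C0_ract R G) f x = C0_ract f (theta x).
Proof.
rewrite /theta C0_ract_lin addrC; congr (_ + _ *: _).
by apply: C0_ext => z; rewrite C0_ract_dirac mul1g.
Qed.

(** Multiplication by a point mass becomes translation of measures under [theta]; the module
    conditions on a left inverse are exploited through this formula and its mirror image. *)
Lemma theta_mul_diracr x s :
  theta (unitization_mul (@convolution R G) x (unitization_in (dirac_measure R s))) =
  rtrans s (theta x).
Proof.
rewrite /theta /= mulr0 scale0r add0r scale0r addr0 rtrans_lin rtrans_dirac1.
by rewrite convolution_diracr addrC.
Qed.

Lemma theta_mul_diracl s y :
  theta (unitization_mul (@convolution R G) (unitization_in (dirac_measure R s)) y) =
  ltrans s (theta y).
Proof.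
rewrite /theta /= mul0r scale0r add0r scale0r addr0 ltrans_lin ltrans_dirac1.
by rewrite convolution_diracl addrC.
Qed.

End unit_extension.

(** * Bounded maps from the projective tensor product to C_0(G) *)

Section tensor_linearization.
Context (R : realType) (G : lcGroupType) (A B : normedModType R[i]).
Local Notation E := (C0 R G).

Lemma blin_rnorm_le (X Y : normedModType R[i]) (T : blin X Y) :
  exists2 M : R, 0 <= M & forall x, rnorm (T x) <= M * rnorm x.
Proof.
have [_ [M TM]] := blinP T; exists `|M| => // x.
by rewrite (le_trans (TM x))// ler_wpM2r ?rnorm_ge0// ler_norm.
Qed.

Lemma ptensor_norm_ge (t : ptensor A B) (phi : bbform A B) :
  bilin_bounded phi 1 -> rnorm (t phi) <= rnorm t.
Proof.
move=> phi1; apply: (@sup_norm_ub R (ptensor A B) (bbform A B)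
  [set phi | bilin_bounded phi 1] (fun phi (t : ptensor A B) => rnorm (t phi))) => // u.
have [s hs] := ptensorP u ltr01.
exists (1 + \sum_(p <- s) (rnorm p.1 * rnorm p.2)) => _ [psi psi1 <-].
rewrite -(subrK (ev_sum s psi) (u psi)) (le_trans (rnormD _ _))// lerD//.
  by rewrite (le_trans (hs _ _ ler01 psi1))// mulr1.
rewrite (le_trans (rnorm_sum _ _ _))// ler_sum// => p _.
by rewrite (le_trans (psi1 _ _))// mul1r.
Qed.

Lemma ptensor_norm_le (t : ptensor A B) M :
  (forall phi : bbform A B, bilin_bounded phi 1 -> rnorm (t phi) <= M) -> rnorm t <= M.
Proof.
move=> tM; apply: (@sup_norm_le R (ptensor A B) (bbform A B)
  [set phi | bilin_bounded phi 1] (fun phi (t : ptensor A B) => rnorm (t phi))) => //.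
by exists (@bbform0 _ A B) => a b; rewrite bbform0E rnorm0 mul1r mulr_ge0 ?rnorm_ge0.
Qed.

Lemma rnorm_bbform_le (s : seq (A * B)) (phi : bbform A B) M : 0 < M ->
  bilin_bounded phi M ->
  rnorm (ev_sum s phi) <= M * rnorm (\sum_(p <- s) p.1 \ox p.2).
Proof.
move=> M0 phiM; pose psi := bbform_scale (M^-1)%:C phi.
have psi1 : bilin_bounded psi 1.
  move=> a b; rewrite bbform_scaleE rnormM rnormC gtr0_norm ?invr_gt0//.
  by rewrite ler_pdivrMl// mul1r.
have -> : ev_sum s phi = M%:C * ev_sum s psi.
  rewrite /ev_sum mulr_sumr; apply: eq_bigr => p _.
  by rewrite bbform_scaleE mulrA -rmorphM divff ?gt_eqF// mul1r.
rewrite rnormM rnormC gtr0_norm// ler_pM2l//.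
have -> : ev_sum s psi = (\sum_(p <- s) p.1 \ox p.2) psi.
  rewrite /ev_sum; elim: s => [|p s ih]; first by rewrite !big_nil.
  by rewrite !big_cons ih.
exact: ptensor_norm_ge.
Qed.

Lemma tensorDl a b c k : (k *: a + b) \ox c = k *: (a \ox c) + (b \ox c) :> ptensor A B.
Proof. by apply/val_inj/funext => phi; rewrite /= [LHS](bbform_linl phi c k a b). Qed.

Lemma tensorDr a b c k : a \ox (k *: b + c) = k *: (a \ox b) + (a \ox c) :> ptensor A B.
Proof. by apply/val_inj/funext => phi; rewrite /= [LHS](bbform_linr phi a k b c). Qed.

(** On a finite sum of elementary tensors, [T] followed by evaluation at a point is a bounded
    bilinear form, so the dual description of the norm gives the bound. Density, with the a priori
    bound [N], extends it to every [t]. *)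
Lemma blin_tensor_le (T : blin (ptensor A B) E) M : 0 <= M ->
  (forall x y, rnorm (T (x \ox y)) <= M * (rnorm x * rnorm y)) ->
  forall t, rnorm (T t) <= M * rnorm t.
Proof.
move=> M0 TM t; have [N N0 TN] := blin_rnorm_le T.
apply/ler_addgt0Pl => e e0.
(* The total error is [N d + M d + d * rnorm t + d ^ 2], which is at most [d c] because [d <= 1]. *)
pose c := N + M + 1 + rnorm t + 1.
have c0 : 0 < c by rewrite /c !(ltr_wpDl, addr_ge0, rnorm_ge0).
pose d := Num.min 1 (e / c).
have d0 : 0 < d by rewrite lt_min ltr01 divr_gt0.
have M1 : 0 < M + d by rewrite ltr_wpDl.
have [s hs] := ptensorP t d0.
pose u : ptensor A B := \sum_(p <- s) p.1 \ox p.2.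
have uE phi : u phi = ev_sum s phi.
  rewrite /u /ev_sum; elim: (s) => [|p s' ih]; first by rewrite !big_nil.
  by rewrite !big_cons -ih.
have tu : rnorm (t - u) <= d.
  apply: ptensor_norm_le => phi phi1.
  have -> : (t - u) phi = t phi - u phi by [].
  by rewrite uE (le_trans (hs phi 1 ler01 phi1))// mulr1.
have Tu : rnorm (T u) <= (M + d) * rnorm u.
  apply: rnorm_C0_le => g.
  have lT : linear T by exact: (blinP T).1.
  have l1 b : linear (fun a => T (a \ox b) g : R[i]^o).
    by move=> k a a'; rewrite tensorDl lT.
  have l2 a : linear (fun b => T (a \ox b) g : R[i]^o).
    by move=> k b b'; rewrite tensorDr lT.
  have bnd : bilin_bounded (fun a b => T (a \ox b) g) (M + d).
    move=> a b; rewrite (le_trans (rnorm_C0_ge _ _))// (le_trans (TM _ _))//.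
    by rewrite ler_wpM2r ?mulr_ge0 ?rnorm_ge0// lerDl ltW.
  have bnd' : exists2 K : R, 0 <= K & bilin_bounded (fun a b => T (a \ox b) g) K.
    by exists (M + d); [exact: ltW|].
  pose phi := BBForm l1 l2 bnd'.
  have -> : T u g = ev_sum s phi.
    rewrite /u /ev_sum; elim: (s) => [|p s' ih].
      by rewrite !big_nil linear0.
    by rewrite !big_cons -ih linearD.
  exact: rnorm_bbform_le.
have ut : rnorm u <= rnorm t + d.
  rewrite -[u](subrK t) (le_trans (rnormD _ _))// addrC lerD2l.
  by rewrite rnormBC.
rewrite -[t in T t](subrK u) linearD (le_trans (rnormD _ _))//.
rewrite (le_trans (lerD (TN _) Tu))//.
rewrite (le_trans (lerD (ler_wpM2l N0 tu) (ler_wpM2l (ltW M1) ut)))//.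
have d1 : d <= 1 by rewrite ge_min lexx.
have dc : d * c <= e by rewrite -ler_pdivlMr// ge_min lexx orbT.
have dd : d * d <= d by rewrite ler_piMr// ltW.
rewrite /c in dc; move: (rnorm t) (rnorm_ge0 t) dc dd => r r0 dc dd.
by nra.
Qed.

Lemma blin_tensor_eq (S T : blin (ptensor A B) E) :
  (forall x y, S (x \ox y) = T (x \ox y)) -> S = T.
Proof.
move=> ST; apply/eqP; rewrite -subr_eq0; apply/eqP/val_inj/funext => t.
apply: rnorm0_eq0; apply/eqP; rewrite eq_le rnorm_ge0 andbT.
rewrite -(mul0r (rnorm t)); apply: (@blin_tensor_le (S - T)) => // x y.
have -> : (S - T) (x \ox y) = S (x \ox y) - T (x \ox y) by [].
by rewrite ST subrr rnorm0 mul0r.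
Qed.

(** The universal property: [T t] at [g] is [t] applied to the scalar form [phi g]. As a function of
    [g] it is a uniform limit of finite sums of values of [b], hence in C_0(G). *)
Lemma blin_of_bilinear (b : A -> B -> E) M : 0 <= M ->
  (forall y, linear (b ^~ y)) -> (forall x, linear (b x)) ->
  (forall x y, rnorm (b x y) <= M * (rnorm x * rnorm y)) ->
  exists T : blin (ptensor A B) E, forall x y, T (x \ox y) = b x y.
Proof.
move=> M0 lb rb bM.
have l1 g y : linear (fun x => b x y g : R[i]^o) by move=> k x x'; rewrite lb.
have l2 g x : linear (fun y => b x y g : R[i]^o) by move=> k y y'; rewrite rb.
have bnd g : bilin_bounded (fun x y => b x y g) M.
  by move=> x y; rewrite (le_trans (rnorm_C0_ge _ _)).
have bnd' g : exists2 K : R, 0 <= K & bilin_bounded (fun x y => b x y g) K.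
  by exists M.
pose phi g := BBForm (l1 g) (l2 g) (bnd' g).
have C0t (t : ptensor A B) : (fun g => t (phi g)) \in @C0_pred R G.
  apply: C0_uniform_limit => e e0.
  have M1 : 0 < M + 1 by rewrite ltr_wpDl.
  have [s hs] := ptensorP t (divr_gt0 e0 M1).
  exists (\sum_(p <- s) b p.1 p.2) => g.
  have -> : (\sum_(p <- s) b p.1 p.2) g = ev_sum s (phi g).
    rewrite /ev_sum; elim: (s) => [|p s' ih]; first by rewrite !big_nil.
    by rewrite !big_cons -ih.
  rewrite (le_trans (hs (phi g) M M0 (bnd g)))// mulrAC -mulrA ler_piMr ?ltW//.
  by rewrite ltr_pdivrMr// mul1r ltrDl.
have TP : (fun t => MkC0 (C0t t)) \in @blin_pred R (ptensor A B) E.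
  apply/mem_set; split.
    by move=> c t u; apply: C0_ext => g.
  exists (M + 1) => t; apply: rnorm_C0_le => g /=.
  have M1 : 0 < M + 1 by rewrite ltr_wpDl.
  apply/ler_addgt0Pl => e e0.
  (* With [d] this quotient, replacing [t] by [u] costs [d M], and replacing the norm of [u] by that
     of [t] costs [(M + 1) d]; together they make [e]. *)
  have d0 : 0 < e / (M + M + 1) by rewrite divr_gt0// ltr_wpDl// addr_ge0.
  have [s hs] := ptensorP t d0.
  pose u : ptensor A B := \sum_(p <- s) p.1 \ox p.2.
  have uE psi : u psi = ev_sum s psi.
    rewrite /u /ev_sum; elim: (s) => [|p s' ih]; first by rewrite !big_nil.
    by rewrite !big_cons -ih.
  have b1 : bilin_bounded (phi g) (M + 1).
    move=> x y; rewrite (le_trans (bnd g x y))//.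
    by rewrite ler_wpM2r ?mulr_ge0 ?rnorm_ge0// lerDl.
  have h1 := hs (phi g) M M0 (bnd g).
  have h2 := rnorm_bbform_le s M1 b1.
  have h3 : rnorm u <= rnorm t + e / (M + M + 1).
    rewrite -[u](subrK t) (le_trans (rnormD _ _))// addrC lerD2l.
    rewrite rnormBC; apply: ptensor_norm_le => psi psi1.
    have -> : (t - u) psi = t psi - u psi by [].
    by rewrite uE (le_trans (hs psi 1 ler01 psi1))// mulr1.
  rewrite -(subrK (ev_sum s (phi g)) (t (phi g))) (le_trans (rnormD _ _))//.
  rewrite (le_trans (lerD h1 h2))// (le_trans (lerD (lexx _) (ler_wpM2l (ltW M1) h3)))//.
  set d := e / _ in d0 h1 h3 *.
  have dE : d * (M + M + 1) = e by rewrite /d divfK// gt_eqF// ltr_wpDl// addr_ge0.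
  by rewrite -dE le_eqVlt; apply/orP; left; apply/eqP; ring.
by exists (Blin TP) => x y; apply: C0_ext.
Qed.

End tensor_linearization.

(** * Atoms modulo a compact subgroup *)

Section null_sets.
Context (R : realType) (G : lcGroupType).
Implicit Types mu : measure_algebra R G.

(** Expresses null sets by [mu] alone, so that they can be carried along translations without
    comparing Hahn decompositions. *)
Lemma mass_eq0P mu A : borel_set A ->
  (forall B, borel_set B -> B `<=` A -> mu B = 0) <-> mass mu A = 0.
Proof.
move=> mA; split => [H|A0 B mB BA]; last first.
  apply: rnorm0_eq0; apply/eqP; rewrite eq_le rnorm_ge0 andbT.
  by rewrite (le_trans (measure_le_mass mu mB))// -A0 mass_le.
have c0 (p : {charge set borel G -> \bar R}) :
    (forall B, borel_set B -> B `<=` A -> p B = 0%E) -> charge_mass p A <= 0.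
  move=> pB; have := @charge_mass_le _ _ _ p A 0%E mA.
  rewrite adde0 lee_fin; apply=> B mB BA.
  by rewrite pB// abse0.
apply/eqP; rewrite eq_le mass_ge0 andbT massE// -[leRHS]addr0 lerD//.
  by apply: c0 => B mB BA; change ((complex.Re (mu B))%:E = 0%E); rewrite H.
by apply: c0 => B mB BA; change ((complex.Im (mu B))%:E = 0%E); rewrite H.
Qed.

Lemma mass_rtrans_eq0 mu s A : borel_set A ->
  mass mu [set y | A (y * s)%g] = 0 -> mass (rtrans s mu) A = 0.
Proof.
move=> mA; have mA' : borel_set [set y | A (y * s)%g].
  exact: borel_preimage (@mulgr_continuous G s) mA.
move=> /(mass_eq0P mu mA') H; apply/mass_eq0P => // B mB BA.
apply: H; first exact: borel_preimage (@mulgr_continuous G s) mB.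
by move=> y; exact: BA.
Qed.

Lemma bborel_limit (f_ : nat -> G -> R[i]) (f : G -> R[i]) M :
  (forall n, bborel (f_ n)) -> (forall y, rnorm (f y) <= M) ->
  (forall y, exists n, forall m, (n <= m)%N -> f_ m y = f y) -> bborel f.
Proof.
move=> bf fM H.
have K (p : R[i] -> R) :
    (forall n, measurable_fun setT (fun y : borel G => p (f_ n y))) ->
    measurable_fun setT (fun y : borel G => p (f y)).
  move=> mp; apply: (@measurable_fun_cvg _ (borel G) R setT
    (fun n y => p (f_ n y)) (fun y => p (f y))) => // y _.
  apply: cvg_near_cst; have [n Hn] := H y.
  by exists n => //= m nm; apply/eqP; rewrite Hn.
split; first by exists M.
  by apply: K => n; have [] := bf n.
by apply: K => n; have [] := bf n.
Qed.

End null_sets.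

(** * Cosets of N charged by a measure, and the action of kernels *)

Section coset_atoms.
Context (R : realType) (G : lcGroupType) (N : set G).
Hypothesis cN : compact N.
Hypothesis N1 : N 1%g.
Hypothesis NM : forall x y, N x -> N y -> N (x * y)%g.
Hypothesis NV : forall x, N x -> N x^-1%g.
Local Notation M := (measure_algebra R G).

Definition lcoset (a : G) : set G := [set y | N (a^-1 * y)%g].

Definition cosets (g : nat -> G) : set G := \bigcup_n lcoset (g n).

Lemma lcoset_trans a b c : lcoset a b -> lcoset b c -> lcoset a c.
Proof. by rewrite /lcoset /= => ab bc; have := NM ab bc; rewrite mulgA mulgK. Qed.

Lemma lcoset_sym a b : lcoset a b -> lcoset b a.
Proof. by rewrite /lcoset /= => /NV; rewrite invgM invgK. Qed.

Lemma borel_lcoset a : borel_set (lcoset a).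
Proof.
by apply: (borel_preimage (@mulgl_continuous G a^-1%g)); exact: compact_borel.
Qed.

Lemma borel_cosets g : borel_set (cosets g).
Proof. by apply: bigcup_measurable => n _; exact: borel_lcoset. Qed.

Lemma lcoset_sub g a : cosets g a -> lcoset a `<=` cosets g.
Proof. by move=> [n _ na] b ab; exists n => //; exact: lcoset_trans na ab. Qed.

(** Outside [cosets g] the measure [x] charges no coset of [N]: what is left there is diffuse modulo
    [N]. *)
Definition covers (x : M) (g : nat -> G) :=
  forall a, mass x (lcoset a) != 0 -> cosets g a.

Lemma covers_sub x g h : covers x g -> cosets g `<=` cosets h -> covers x h.
Proof. by move=> cg gh a /cg /gh. Qed.

Definition interleave (g h : nat -> G) (n : nat) : G :=
  if odd n then g n./2 else h n./2.

Lemma interleavel g h : cosets g `<=` cosets (interleave g h).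
Proof.
move=> y [n _ ny]; exists (n.*2.+1) => //.
by rewrite /interleave /= odd_double /= uphalf_double.
Qed.

Lemma interleaver g h : cosets h `<=` cosets (interleave g h).
Proof.
move=> y [n _ ny]; exists (n.*2) => //.
by rewrite /interleave odd_double /= doubleK.
Qed.

(* A sequence whose union of cosets has maximal mass meets every charged coset. *)
Lemma exists_covers x : exists g, covers x g.
Proof.
pose S := [set mass x (cosets g) | g in [set: nat -> G]].
have bS : has_ubound S.
  exists (mass x setT) => _ [g _ <-]; apply: mass_le => //; first exact: borel_cosets.
  exact: (@measurableT _ (borel G)).
have supS : has_sup S by split => //; exists (mass x (cosets (fun=> 1%g))), (fun=> 1%g).
have /choice[F HF] : forall k : nat, exists g, sup S - k.+1%:R^-1 < mass x (cosets g).
  move=> k; have k0 : 0 < k.+1%:R^-1 :> R by rewrite invr_gt0.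
  by have [_ [g _ <-] Hg] := sup_adherent k0 supS; exists g.
pose g n := if unpickle n is Some (k, j) then F k j else 1%g.
have Fg k : cosets (F k) `<=` cosets g.
  by move=> y [j _ jy]; exists (pickle (k, j)) => //; rewrite /g pickleK.
have gS : sup S <= mass x (cosets g).
  apply/ler_addgt0Pl => e e0.
  have [k ke] : exists k : nat, k.+1%:R^-1 <= e.
    exists (Num.truncn e^-1); rewrite -[leRHS]invrK lef_pV2 ?posrE ?invr_gt0//.
    by rewrite ltW// truncnS_gt.
  rewrite -lerBlDl (le_trans _ (mass_le x (borel_cosets (F k)) (borel_cosets g) (Fg k)))//.
  by rewrite (le_trans _ (ltW (HF k)))// lerD2l lerN2.
exists g => a a0; apply: contrapT => ga.
have aI : cosets g `&` lcoset a = set0.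
  rewrite -subset0 => y [gy ay]; apply: ga; apply: (lcoset_sub gy).
  exact: lcoset_sym.
pose h := interleave (fun=> a) g.
have hS : mass x (cosets h) <= sup S by apply: ub_le_sup => //; exists h.
have := le_trans hS gS; apply/negP; rewrite -ltNge.
have Uh : cosets g `|` lcoset a `<=` cosets h.
  move=> y [gy|ay]; first exact: interleaver.
  by apply: interleavel; exists 0%N.
rewrite (lt_le_trans _ (mass_le x _ (borel_cosets h) Uh))//; last first.
  by apply: measurableU; [exact: borel_cosets|exact: borel_lcoset].
rewrite massU//; [|exact: borel_cosets|exact: borel_lcoset].
by rewrite ltrDl lt_neqAle eq_sym a0 mass_ge0.
Qed.

Definition carrier x : nat -> G := projT1 (cid (exists_covers x)).

Lemma carrierP x : covers x (carrier x).
Proof. exact: projT2 (cid (exists_covers x)). Qed.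

(** A coset that is not in [cosets g] is null, and [h] adds only countably many of them. *)
Lemma mass_cosetsD x g h : covers x g -> mass x (cosets h `\` cosets g) = 0.
Proof.
move=> cg; have -> : cosets h `\` cosets g = \bigcup_n (lcoset (h n) `\` cosets g).
  by rewrite setD_bigcupl.
apply: mass_bigcup0 => n.
  by apply: measurableD; [exact: borel_lcoset|exact: borel_cosets].
have [hn|hn] := pselect (cosets g (h n)).
  rewrite (_ : _ `\` _ = set0) ?mass0//; rewrite -subset0 => y [hy]; apply.
  exact: lcoset_sub hy.
apply/eqP; rewrite eq_le mass_ge0 andbT; have [<-|/cg//] := eqVneq (mass x (lcoset (h n))) 0.
by rewrite mass_le//; [apply: measurableD; [exact: borel_lcoset|exact: borel_cosets]
  |exact: borel_lcoset].
Qed.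

(* A kernel k acts on a measure x by integrating k true y (t y) over the union of
   the charged cosets of N, and k false y (t y) over its complement. *)
Definition kernel := bool -> G -> G -> R[i].
Implicit Types k : kernel.

Definition ker k (S : set G) (t y : G) : R[i] := k (y \in S) y (t * y)%g.

Definition op k (x : M) (t : G) : R[i]^o :=
  complex_integral x (ker k (cosets (carrier x)) t).

(** The last condition ranges over all covering sequences, not only [carrier x]: a translate of
    [carrier x] covers the translated measure but need not be its carrier. *)
Definition good k := [/\ exists C, forall b y z, rnorm (k b y z) <= C,
  forall g t, bborel (ker k (cosets g) t) &
  forall x g, covers x g ->
    (fun t => complex_integral x (ker k (cosets g) t) : R[i]^o) \in @C0_pred R G].

(** Both covering sequences are compared with their interleaving, which adds only null cosets to
    each. *)
Lemma opE k x g t : good k -> covers x g ->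
  op k x t = complex_integral x (ker k (cosets g) t).
Proof.
move=> [[C kC] bk _] cg.
suff H g' h : covers x g' -> cosets g' `<=` cosets h ->
    complex_integral x (ker k (cosets g') t) = complex_integral x (ker k (cosets h) t).
  rewrite /op (H _ _ (@carrierP x) (@interleavel _ g)).
  by rewrite (H _ _ cg (@interleaver (carrier x) _)).
move=> cg' gh; apply/eqP; rewrite -subr_eq0.
rewrite -(bfunctional_sub (complex_integral_bfunctional x))//.
apply/eqP/rnorm0_eq0/eqP; rewrite eq_le rnorm_ge0 andbT.
have C0 : 0 <= C + C by rewrite addr_ge0// (le_trans (rnorm_ge0 _) (kC true 1%g 1%g)).
rewrite (le_trans (complex_integral_off x (A := cosets h `\` cosets g') (M := C + C) _ _ _ _ _))//.
- by apply: measurableD; exact: borel_cosets.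
- exact: bborelB.
- by move=> y; rewrite (le_trans (rnormD _ _))// rnormN lerD// kC.
- move=> y nhg; rewrite /ker; have [g'y|ng'y] := pselect (cosets g' y).
    by rewrite !mem_set ?subrr//; exact: gh.
  by rewrite !memNset ?subrr// => hy; exact: nhg.
by rewrite mass_cosetsD// !mulr0.
Qed.

Lemma op_C0 k x : good k -> op k x \in @C0_pred R G.
Proof. by move=> [_ _]; apply; exact: carrierP. Qed.

(** The three measures have different carriers; a common interleaving covers them all, and linearity
    becomes that of the integral of one fixed function. *)
Lemma op_lin k : good k -> forall c x y t, op k (c *: x + y) t = c * op k x t + op k y t.
Proof.
move=> gk c x y t.
pose g := interleave (carrier (c *: x + y)) (interleave (carrier x) (carrier y)).
have c1 : covers (c *: x + y) g.
  by apply: covers_sub (@interleavel _ _); exact: carrierP.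
have c2 : covers x g.
  apply: (covers_sub (@carrierP x)) => z /(@interleavel _ (carrier y)).
  exact: interleaver.
have c3 : covers y g.
  apply: (covers_sub (@carrierP y)) => z /(@interleaver (carrier x)).
  exact: interleaver.
rewrite (opE t gk c1) (opE t gk c2) (opE t gk c3) complex_integral_measure_lin//.
by have [_ bk _] := gk.
Qed.

Lemma op_le k C x t : good k -> 0 <= C -> (forall b y z, rnorm (k b y z) <= C) ->
  rnorm (op k x t) <= 8%:R * C * rnorm x.
Proof.
move=> [_ bk _] C0 kC; apply: complex_integral_le => //.
by move=> y; exact: kC.
Qed.

Definition klin c k k' : kernel := fun b y z => c * k b y z + k' b y z.

Lemma good_klin c k k' : good k -> good k' -> good (klin c k k').
Proof.
move=> [[C kC] bk kC0] [[C' kC'] bk' kC0']; split.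
- exists (rnorm c * C + C') => b y z.
  by rewrite (le_trans (rnormD _ _))// lerD// rnormM ler_wpM2l ?rnorm_ge0.
- by move=> g t; exact: (bborel_lin c (bk g t) (bk' g t)).
- move=> x g cg; apply: (@C0_mem_ext R G
      (c *: MkC0 (kC0 x g cg) + MkC0 (kC0' x g cg))) => t.
  exact: (complex_integral_lin x c (bk g t) (bk' g t)).
Qed.

Lemma op_klin c k k' x t : good k -> good k' ->
  op (klin c k k') x t = c * op k x t + op k' x t.
Proof.
move=> [_ bk _] [_ bk' _].
by rewrite /op [LHS](complex_integral_lin x c (bk _ t) (bk' _ t)).
Qed.

(** The form taken by the actions of point masses: [s] comes from the left action, a right
    translation of the measure, and [s'] from the right action, a left translation of the output
    argument. *)
Definition kshift s s' k : kernel := fun b y z => k b (y * s)%g (s' * z * s)%g.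

Section shift.
Variable s : G.
Hypothesis sN : forall v, N v <-> N (s^-1 * v * s)%g.

(** Since [s] normalizes [N], right translation by [s] permutes the left cosets of [N]. *)
Lemma lcoset_shift a y : lcoset (a * s)%g (y * s)%g <-> lcoset a y.
Proof.
by rewrite /lcoset /= invgM -mulgA [(_ * (y * s))%g]mulgA mulgA -sN.
Qed.

Lemma cosets_shift g y : cosets (fun n => g n * s)%g (y * s)%g <-> cosets g y.
Proof. by split=> -[n _ /lcoset_shift ny]; exists n. Qed.

Lemma cosets_shift_in g y : ((y * s)%g \in cosets (fun n => g n * s)%g) = (y \in cosets g).
Proof.
by apply/idP/idP => /set_mem/cosets_shift/mem_set.
Qed.

Lemma covers_rtrans x g : covers x g -> covers (rtrans s x) (fun n => g n * s)%g.
Proof.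
move=> cg a a0; rewrite -(mulgVK s a); apply/cosets_shift; apply: cg.
apply: contra a0 => /eqP a0; apply/eqP/mass_rtrans_eq0; first exact: borel_lcoset.
rewrite (_ : [set _ | _] = lcoset (a * s^-1)%g)//; apply/seteqP; split => y /=.
  by rewrite -{1}(mulgVK s a) => /lcoset_shift.
by rewrite -{2}(mulgVK s a) => ?; apply/lcoset_shift.
Qed.

Lemma ker_kshift s' k g t y :
  ker (kshift s s' k) (cosets g) t y =
  ker k (cosets (fun n => g n * s)%g) (s' * t)%g (y * s)%g.
Proof. by rewrite /ker /kshift cosets_shift_in !mulgA. Qed.

Lemma integral_kshift s' k x g t : good k ->
  complex_integral x (ker (kshift s s' k) (cosets g) t) =
  complex_integral (rtrans s x) (ker k (cosets (fun n => g n * s)%g) (s' * t)%g).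
Proof.
move=> [_ bk _]; rewrite complex_integral_rtrans//.
by congr complex_integral; apply/funext => y; rewrite ker_kshift.
Qed.

Lemma good_kshift s' k : good k -> good (kshift s s' k).
Proof.
move=> gk; have [[C kC] bk kC0] := gk; split.
- by exists C => b y z; exact: kC.
- move=> g t; rewrite (_ : ker _ _ _ = fun y =>
      ker k (cosets (fun n => g n * s)%g) (s' * t)%g (y * s)%g).
    by apply: bborel_comp; [exact: mulgr_continuous|exact: bk].
  by apply/funext => y; rewrite ker_kshift.
- move=> x g cg; apply: (@C0_mem_ext R G
      (shift s' 1%g (MkC0 (kC0 _ _ (covers_rtrans cg))))) => t.
  by rewrite integral_kshift//= mulg1.
Qed.

Lemma op_kshift s' k x t : good k ->
  op (kshift s s' k) x t = op k (rtrans s x) (s' * t)%g.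
Proof.
move=> gk; rewrite (opE t (good_kshift s' gk) (@carrierP x)) integral_kshift//.
by rewrite -opE//; exact/covers_rtrans/carrierP.
Qed.

End shift.

Definition kcst (v : C0 R G) : kernel := fun _ _ z => v z.

Lemma good_kcst v : good (kcst v).
Proof.
split.
- by exists (rnorm v) => b y z; exact: rnorm_C0_ge.
- by move=> g t; exact: bborel_shiftl.
- by move=> x g _; exact: (@C0_mem_ext R G (C0_lact x v)).
Qed.

Definition katom (K : G -> C0 R G) : kernel := fun b y z => if b then K y z else 0.

(** On finitely many cosets the output is a finite sum of averages of the functions [K (g n)] over
    restricted measures, hence in C_0(G). The remaining cosets have small mass, so the error is
    uniform in [t]. *)
Lemma good_katom K C : (forall y, rnorm (K y) <= C) ->
  (forall y v, N v -> K (y * v)%g = K y) -> good (katom K).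
Proof.
move=> KC KN; have C0 : 0 <= C by rewrite (le_trans (rnorm_ge0 _) (KC 1%g)).
have KzC y z : rnorm (K y z) <= C by rewrite (le_trans (rnorm_C0_ge _ _)).
have Kc a y : lcoset a y -> K y = K a.
  by move=> /(KN a); rewrite mulVKg.
pose S g n : set G := \bigcup_(k < n) lcoset (g k).
have mS g n : borel_set (S g n).
  by apply: bigcup_measurable => j _; exact: borel_lcoset.
have SS g n : S g n.+1 = S g n `|` lcoset (g n).
  apply/seteqP; split => [y [i /= + iy]|y [[i /= ni iy]|ny]].
  - by rewrite ltnS leq_eqVlt => /predU1P[<-|ni]; [right|left; exists i].
  - by exists i => //=; rewrite ltnS ltnW.
  - by exists n => /=.
have bS g n t : bborel (ker (katom K) (S g n) t).
  elim: n => [|n ih].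
    rewrite (_ : ker _ _ _ = fun=> 0); first exact: bborel_cst.
    by apply/funext => y; rewrite /ker memNset//= => -[].
  rewrite (_ : ker _ _ _ = (fun y => if y \in lcoset (g n) then K (g n) (t * y)%g
      else ker (katom K) (S g n) t y)).
    by apply: bborel_patch => //; [exact: borel_lcoset|exact: bborel_shiftl].
  apply/funext => y; rewrite /ker SS in_setU.
  case: (boolP (y \in lcoset _)) => [/set_mem/Kc <-|_]; first by rewrite orbT.
  by rewrite orbF.
have kC b y z : rnorm (katom K b y z) <= C by case: b; rewrite /= ?rnorm0.
have bk g t : bborel (ker (katom K) (cosets g) t).
  apply: (@bborel_limit _ _ (fun n => ker (katom K) (S g n) t) _ C) => //.
    by move=> y; exact: kC.
  move=> y; have [[n _ ny]|ngy] := pselect (cosets g y).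
    exists n.+1 => m nm; have Sy : S g m y by exists n.
    have gy : cosets g y by exists n.
    by rewrite /ker (mem_set Sy) (mem_set gy).
  exists 0%N => m _; rewrite /ker !memNset// => -[n _ ny]; apply: ngy.
  by exists n.
split => //; first by exists C.
move=> x g cg.
have SC n : (fun t => complex_integral x (ker (katom K) (S g n) t) : R[i]^o) \in @C0_pred R G.
  elim: n => [|n ih].
    apply: (@C0_mem_ext R G 0) => t; rewrite (_ : ker _ _ _ = fun=> 0).
      exact: (bfunctional0 (complex_integral_bfunctional x)).
    by apply/funext => y; rewrite /ker memNset//= => -[].
  (* Earlier cosets are removed because [g] may list a coset twice. *)
  have mD : borel_set (lcoset (g n) `\` S g n).
    exact: measurableD (borel_lcoset _) (mS _ _).
  apply: (@C0_mem_ext R G (MkC0 ih + C0_lact (restriction x mD) (K (g n)))) => t.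
  rewrite [RHS]/=.
  rewrite [X in _ = _ + X](complex_integral_restriction x mD (bborel_shiftl t (K (g n)))).
  rewrite -[RHS](bfunctionalD (complex_integral_bfunctional x))//; last first.
    by apply: bborel_patch => //; [exact: bborel_shiftl|exact: bborel_cst].
  congr complex_integral; apply/funext => y; rewrite /ker SS in_setU in_setD.
  case: (y \in S g n) => /=; first by rewrite andbF addr0.
  by rewrite andbT add0r; case: (boolP (y \in lcoset _)) => //= /set_mem/Kc ->.
apply: C0_uniform_limit => e e0.
have C1 : 0 < 2%:R * (C + 1) by rewrite mulr_gt0// ltr_wpDl.
have [n mn] : exists n, mass x (cosets g `\` S g n) <= e / (2%:R * (C + 1)).
  apply: mass_cvg0; last by rewrite divr_gt0.
  - by move=> n; exact: measurableD (borel_cosets _) (mS _ _).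
  - move=> m n mn y [gy Sy]; split => // -[i /= im iy]; apply: Sy.
    by exists i => //=; exact: leq_trans mn.
  - rewrite (_ : \bigcap_n _ = set0) ?mass0// -subset0 => y H.
    have [[n _ ny] _] := H 0%N I.
    by have [_] := H n.+1 I; apply; exists n => /=.
exists (MkC0 (SC n)) => t /=.
rewrite -(bfunctional_sub (complex_integral_bfunctional x))//.
rewrite (le_trans (complex_integral_off x (A := cosets g `\` S g n) (M := C) _ _ _ _ _))//.
- exact: measurableD (borel_cosets _) (mS _ _).
- exact: bborelB.
- move=> y; rewrite /ker; case: (boolP (y \in S g n)) => [/set_mem Sy|_].
    rewrite mem_set ?subrr ?rnorm0//; have [i _ iy] := Sy.
    by exists i.
  by rewrite subr0.
- move=> y nA; rewrite /ker; have [Sy|nSy] := pselect (S g n y).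
    by rewrite !mem_set ?subrr//; have [i _ iy] := Sy; exists i.
  by rewrite !memNset ?subrr// => gy; exact: nA.
rewrite (le_trans (ler_wpM2l _ (ler_wpM2l C0 mn)))// mulrA.
rewrite mulrCA ler_piMr ?(ltW e0)// ler_pdivrMr// mul1r.
by rewrite ler_pM2l// lerDl.
Qed.

Definition kdiffuse (e : G -> R[i]) : kernel := fun b _ z => if b then 0 else e z.

(** For [h] in C_0(G) the output is the average of [h] over the diffuse part of [x]; the output of
    [e] is a uniform limit of these. *)
Lemma good_kdiffuse e C : (forall z, rnorm (e z) <= C) -> bborel e ->
  (forall x g, covers x g -> forall d : R, 0 < d -> exists h : C0 R G,
    forall t, rnorm (complex_integral x (ker (kdiffuse e) (cosets g) t) -
      complex_integral x (ker (kdiffuse h) (cosets g) t)) <= d) ->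
  good (kdiffuse e).
Proof.
move=> eC be H; have C0 : 0 <= C by rewrite (le_trans (rnorm_ge0 _) (eC 1%g)).
split.
- by exists C => -[] y z /=; rewrite ?rnorm0.
- move=> g t; apply: (@bborel_patch _ _ (cosets g) (fun=> 0) (fun y => e (t * y)%g)).
  + exact: borel_cosets.
  + exact: bborel_cst.
  + by apply: bborel_comp => //; exact: mulgl_continuous.
- move=> x g cg; apply: C0_uniform_limit => d d0; have [h Hh] := H x g cg d d0.
  have mg : borel_set (~` cosets g) by apply: measurableC; exact: borel_cosets.
  exists (C0_lact (restriction x mg) h) => t; rewrite C0_lactE.
  rewrite complex_integral_restriction; last exact: bborel_shiftl.
  rewrite (_ : (fun y => if y \in ~` cosets g then _ else _) = ker (kdiffuse h) (cosets g) t)//.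
  by apply/funext => y; rewrite /ker /= in_setC; case: (y \in _).
Qed.

End coset_atoms.

(** * Kernels and the left inverse of iota *)

Section bounded_linear_norm.
Context (R : realType) (X Y : normedModType R[i]).

Lemma blin_linE c (S T : blin X Y) x : (c *: S + T) x = c *: S x + T x.
Proof. by []. Qed.

Lemma rnorm_blin_le (T : blin X Y) M : 0 <= M ->
  (forall x, rnorm (T x) <= M * rnorm x) -> rnorm T <= M.
Proof.
move=> M0 TM; apply: (@sup_norm_le R (blin X Y) X [set x : X | rnorm x <= 1]
  (fun x (T : blin X Y) => rnorm (T x))).
  by exists 0; rewrite /= rnorm0.
by move=> x /= x1; rewrite (le_trans (TM x))// ler_piMr.
Qed.

End bounded_linear_norm.

Lemma C0_linE (R : realType) (G : lcGroupType) c (f g : C0 R G) x :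
  (c *: f + g) x = c * f x + g x.
Proof. by []. Qed.

Section kernel_functional.
Context (R : realType) (G : lcGroupType) (N : set G).
Hypothesis cN : compact N.
Hypothesis N1 : N 1%g.
Hypothesis NM : forall x y, N x -> N y -> N (x * y)%g.
Hypothesis NV : forall x, N x -> N x^-1%g.
Local Notation M := (measure_algebra R G).
Local Notation A1 := (unitization M).
Local Notation E := (C0 R G).
Local Notation BE := (blin (ptensor A1 A1) E).
Local Notation op := (op cN NM NV).
Local Notation good := (@good R G N).
Implicit Types (k : kernel R G) (T : BE).

(** The right-hand side is the right action of [theta y] on the function [op k (theta x)]. *)
Definition represents k T := forall x y t, T (x \ox y) t =
  complex_integral (theta y) (fun u => op k (theta x) (u * t)%g).

Definition op_fun k (gk : good k) x : E := MkC0 (op_C0 cN NM NV x gk).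

Lemma represents_ract k (gk : good k) x y t :
  complex_integral (theta y) (fun u => op k (theta x) (u * t)%g) =
  C0_ract (op_fun gk (theta x)) (theta y) t.
Proof. by []. Qed.

Lemma exists_represents k : good k -> exists T, represents k T.
Proof.
move=> gk; have [[C kC] _ _] := gk.
have C0 : 0 <= C by rewrite (le_trans (rnorm_ge0 _) (kC true 1%g 1%g)).
pose b (x y : A1) := C0_ract (op_fun gk (theta x)) (theta y).
have opl c x y : op_fun gk (theta (c *: x + y)) =
    c *: op_fun gk (theta x) + op_fun gk (theta y).
  by apply: C0_ext => t; rewrite theta_lin /= op_lin.
(* Here [64 = 8 * 8], one factor from [op_le] and one from [rnorm_C0_ract]. *)
have [|y c x x'|x c y y'|x y|T HT] := @blin_of_bilinear R G A1 A1 b (64%:R * C).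
- by rewrite mulr_ge0.
- by rewrite /b opl C0_ract_linl.
- by rewrite /b theta_lin C0_ract_lin.
- rewrite (le_trans (rnorm_C0_ract _ _))//.
  have h1 : rnorm (op_fun gk (theta x)) <= 8%:R * C * rnorm x.
    apply: rnorm_C0_le => t; rewrite (le_trans (op_le cN NM NV _ t gk C0 kC))//.
    by rewrite ler_wpM2l ?mulr_ge0// rnorm_theta.
  have h2 := rnorm_theta y.
  rewrite (_ : 64%:R * C * _ = 8%:R * (8%:R * C * rnorm x) * rnorm y); last by ring.
  by rewrite ler_pM ?mulr_ge0 ?rnorm_ge0// ler_wpM2l.
by exists T => x y t; rewrite HT.
Qed.

Lemma represents_eq k T T' : represents k T -> represents k T' -> T = T'.
Proof.
by move=> kT kT'; apply: blin_tensor_eq => x y; apply: C0_ext => t; rewrite kT kT'.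
Qed.

Lemma represents_lin c k k' T T' : good k -> good k' ->
  represents k T -> represents k' T' -> represents (klin c k k') (c *: T + T').
Proof.
move=> gk gk' kT kT' x y t; have gkk' := good_klin c gk gk'.
rewrite blin_linE C0_linE kT kT' (represents_ract gkk') (represents_ract gk) (represents_ract gk').
have -> : op_fun gkk' (theta x) = c *: op_fun gk (theta x) + op_fun gk' (theta x).
  by apply: C0_ext => u /=; rewrite op_klin.
by rewrite C0_ract_linl.
Qed.

Lemma represents_norm k T C : good k -> represents k T -> 0 <= C ->
  (forall b y z, rnorm (k b y z) <= C) -> rnorm T <= 64%:R * C.
Proof.
move=> gk kT C0 kC; apply: rnorm_blin_le; first by rewrite mulr_ge0.
apply: blin_tensor_le; first by rewrite mulr_ge0.
move=> x y; apply: rnorm_C0_le => t; rewrite kT (represents_ract gk).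
rewrite (le_trans (rnorm_C0_ge _ _))// (le_trans (rnorm_C0_ract _ _))//.
have h1 : rnorm (op_fun gk (theta x)) <= 8%:R * C * rnorm x.
  apply: rnorm_C0_le => u; rewrite (le_trans (op_le cN NM NV _ u gk C0 kC))//.
  by rewrite ler_wpM2l ?mulr_ge0// rnorm_theta.
have h2 := rnorm_theta y.
rewrite (_ : 64%:R * C * _ = 8%:R * (8%:R * C * rnorm x) * rnorm y); last by ring.
by rewrite ler_pM ?mulr_ge0 ?rnorm_ge0// ler_wpM2l.
Qed.

Variable rho : blin BE E.
Hypothesis rho_iota : forall e T,
  is_iota (@C0_lact R G) (@C0_ract R G) e T -> rho T = e.
Hypothesis rho_lact : forall a T aT,
  is_lact (@convolution R G) a T aT -> rho aT = C0_lact a (rho T).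
Hypothesis rho_ract : forall a T Ta,
  is_ract (@convolution R G) T a Ta -> rho Ta = C0_ract (rho T) a.

(** [rho] transported to kernels. The representing map is unique, so the value does not depend on
    the choice; kernels that are not good get 0. *)
Definition Gam k : E :=
  if pselect (good k) is left gk then rho (projT1 (cid (exists_represents gk))) else 0.

Lemma GamE k T : good k -> represents k T -> Gam k = rho T.
Proof.
move=> gk kT; rewrite /Gam; case: pselect => // gk'; congr (rho _).
by case: cid => T' /= kT'; exact: represents_eq kT' kT.
Qed.

Lemma Gam_lin c k k' : good k -> good k' ->
  Gam (klin c k k') = c *: Gam k + Gam k'.
Proof.
move=> gk gk'; have [T kT] := exists_represents gk.
have [T' kT'] := exists_represents gk'.
rewrite (GamE gk kT) (GamE gk' kT') (GamE (good_klin c gk gk') (represents_lin c gk gk' kT kT')).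
by have [lr _] := blinP rho; rewrite lr.
Qed.

Lemma Gam_bound : exists2 D : R, 0 <= D & forall k C t, good k -> 0 <= C ->
  (forall b y z, rnorm (k b y z) <= C) -> rnorm (Gam k t) <= D * C.
Proof.
have [D D0 rD] := blin_rnorm_le rho; exists (D * 64%:R); first by rewrite mulr_ge0.
move=> k C t gk C0 kC; have [T kT] := exists_represents gk.
rewrite (GamE gk kT) (le_trans (rnorm_C0_ge _ _))// (le_trans (rD T))//.
by rewrite -mulrA ler_wpM2l//; exact: represents_norm gk kT C0 kC.
Qed.

(** The left action of the point mass at [s] leads from [k] to [kshift s 1 k], and the right action
    of the one at [s'] from there to [kshift s s' k]. [rho] respects both, and point masses act on
    C_0(G) by translation. *)
Lemma Gam_shift s s' k g : (forall v, N v <-> N (s^-1 * v * s)%g) -> good k ->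
  Gam (kshift s s' k) g = Gam k (s' * g * s)%g.
Proof.
move=> sN gk; have N1' v : N v <-> N (1^-1 * v * 1)%g by rewrite invg1 mul1g mulg1.
have gs := good_kshift cN sN 1%g gk; have gss := good_kshift cN sN s' gk.
have [T kT] := exists_represents gk.
have [T' kT'] := exists_represents gs.
have [T'' kT''] := exists_represents gss.
have H1 : rho T' = C0_lact (dirac_measure R s) (rho T).
  apply: rho_lact => x y; apply: C0_ext => t; rewrite kT' kT theta_mul_diracr.
  by congr complex_integral; apply/funext => u; rewrite (op_kshift cN NM NV sN)// mul1g.
have H2 : rho T'' = C0_ract (rho T') (dirac_measure R s').
  apply: rho_ract => x y; apply: C0_ext => t; rewrite kT'' kT' theta_mul_diracl.
  rewrite complex_integral_ltrans; last first.
    exact: (bborel_shiftr t (op_fun gs (theta x))).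
  congr complex_integral; apply/funext => u.
  by rewrite !(op_kshift cN NM NV sN)// mul1g mulgA.
by rewrite (GamE gss kT'') (GamE gk kT) H2 C0_ract_dirac H1 C0_lact_dirac.
Qed.

(** [kcst v] represents [iota v], which [rho] sends back to [v]. *)
Lemma Gam_cst v : Gam (kcst v) = v.
Proof.
have [T kT] := exists_represents (good_kcst N v).
rewrite (GamE (good_kcst N v) kT); apply: rho_iota => x y; apply: C0_ext => t.
rewrite kT unitization_ractE unitization_lactE C0_ractE.
by congr complex_integral; apply/funext.
Qed.

Definition ksum (I : Type) (r : seq I) (K : I -> kernel R G) : kernel R G :=
  fun b y z => \sum_(i <- r) K i b y z.

Lemma ksum_cons I i (r : seq I) K : ksum (i :: r) K = klin 1 (K i) (ksum r K).
Proof.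
by apply/funext => b; apply/funext => y; apply/funext => z;
  rewrite /ksum big_cons /klin mul1r.
Qed.

Lemma ksum_nil I (K : I -> kernel R G) : ksum [::] K = kcst 0.
Proof. by apply/funext => b; apply/funext => y; apply/funext => z; rewrite /ksum big_nil. Qed.

Lemma good_ksum (I : eqType) (r : seq I) K : (forall i, i \in r -> good (K i)) ->
  good (ksum r K).
Proof.
elim: r => [_|i r ih H]; first by rewrite ksum_nil; exact: good_kcst.
rewrite ksum_cons; apply: good_klin; first by apply: H; rewrite mem_head.
by apply: ih => j jr; apply: H; rewrite in_cons jr orbT.
Qed.

Lemma Gam_sum (I : eqType) (r : seq I) K : (forall i, i \in r -> good (K i)) ->
  Gam (ksum r K) = \sum_(i <- r) Gam (K i).
Proof.
elim: r => [_|i r ih H]; first by rewrite ksum_nil big_nil Gam_cst.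
have Hr j : j \in r -> good (K j) by move=> jr; apply: H; rewrite in_cons jr orbT.
rewrite ksum_cons Gam_lin ?scale1r ?big_cons ?ih//; last exact: good_ksum.
by apply: H; rewrite mem_head.
Qed.

End kernel_functional.

(** * An H-equivariant map from G to H that is constant on cosets of N *)

Section countable_subgroup.
Context (G : lcGroupType) (N H : set G).
Hypothesis N1 : N 1%g.
Hypothesis NM : forall x y, N x -> N y -> N (x * y)%g.
Hypothesis NV : forall x, N x -> N x^-1%g.
Hypothesis H1 : H 1%g.
Hypothesis HM : forall x y, H x -> H y -> H (x * y)%g.
Hypothesis HV : forall x, H x -> H x^-1%g.
Hypothesis HN : forall s v, H s -> (N v <-> N (s^-1 * v * s)%g).
Hypothesis NH : forall s, H s -> N s -> s = 1%g.

(** The set [y H N]. As [H] normalizes [N], [H N] is a group and these sets partition [G]. *)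
Let D (y : G) : set G := [set z | exists h v, [/\ H h, N v & z = y * h * v]%g].

Let DN y v : N v -> D (y * v)%g = D y.
Proof.
suff K y' v' : N v' -> D (y' * v')%g `<=` D y'.
  move=> Nv; apply/seteqP; split; first exact: K.
  by have := @K (y * v)%g v^-1%g (NV Nv); rewrite mulgK.
move=> Nv _ [h [w [Hh Nw ->]]]; exists h, (h^-1 * v' * h * w)%g; split => //.
  by apply: NM => //; exact/(HN v' Hh).
by rewrite !mulgA mulgK.
Qed.

Let DH y s : H s -> D (y * s)%g = D y.
Proof.
suff K y' s' : H s' -> D (y' * s')%g `<=` D y'.
  move=> Hs; apply/seteqP; split; first exact: K.
  by have := @K (y * s)%g s^-1%g (HV Hs); rewrite mulgK.
move=> Hs _ [h [w [Hh Nw ->]]]; exists (s' * h)%g, w; split => //; first exact: HM.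
by rewrite !mulgA.
Qed.

Let r y := xget 1%g (D y).

Let rP y : D y (r y).
Proof.
apply: (@xgetPex _ 1%g (D y)); exists y, 1%g, 1%g; split => //.
by rewrite !mulg1.
Qed.

(** As [H] meets [N] trivially, [y] lies in [r y * h * N] for exactly one [h] in [H]; this is the
    map eta. *)
Definition hpart y := xget 1%g [set h | H h /\ N (h^-1 * (r y)^-1 * y)%g].

Let hpart_ex y : H (hpart y) /\ N ((hpart y)^-1 * (r y)^-1 * y)%g.
Proof.
apply: (@xgetPex _ 1%g [set h | H h /\ N (h^-1 * (r y)^-1 * y)%g]).
have [h [v [Hh Nv ->]]] := rP y.
exists h^-1%g; split; first exact: HV.
rewrite invgK !invgM !mulgA -(mulgA _ y^-1%g) mulVg mulg1.
have := HN v^-1%g (HV Hh); rewrite invgK => <-; exact: NV.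
Qed.

Lemma hpart_in y : H (hpart y).
Proof. by have [] := hpart_ex y. Qed.

Let hpart_unique y h : H h -> N (h^-1 * (r y)^-1 * y)%g -> hpart y = h.
Proof.
move=> Hh Nh; have [H' N'] := hpart_ex y; set h' := hpart y in H' N' *.
have : (h^-1 * h')%g = 1%g.
  apply: NH; first by apply: HM => //; exact: HV.
  have := NM Nh (NV N'); rewrite !invgM !invgK !mulgA.
  by rewrite mulgK mulgVK.
by move=> /(congr1 (fun z => h * z)%g); rewrite mulVKg mulg1.
Qed.

Lemma hpartN y v : N v -> hpart (y * v)%g = hpart y.
Proof.
move=> Nv; have [H' N'] := hpart_ex y; apply: hpart_unique => //.
by rewrite /r DN// mulgA; exact: NM.
Qed.

Lemma hpartM y s : H s -> hpart (y * s)%g = (hpart y * s)%g.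
Proof.
move=> Hs; have [H' N'] := hpart_ex y; apply: hpart_unique; first exact: HM.
have -> : ((hpart y * s)^-1 * (r (y * s))^-1 * (y * s) =
    s^-1 * ((hpart y)^-1 * (r y)^-1 * y) * s)%g.
  by rewrite /r DH// invgM !mulgA.
exact: (HN ((hpart y)^-1 * (r y)^-1 * y)%g Hs).1.
Qed.

End countable_subgroup.

(** Applied pointwise to sums of kernels whose supports are disjoint. *)
Lemma rnorm_sum_one (R : realType) (I : eqType) (r : seq I) (a : I -> R[i]) (C : R) :
  uniq r -> 0 <= C -> (forall i, i \in r -> rnorm (a i) <= C) ->
  (forall i j, i \in r -> j \in r -> a i != 0 -> a j != 0 -> i = j) ->
  rnorm (\sum_(i <- r) a i) <= C.
Proof.
move=> ur C0 aC a1; have [/hasP[i ir ai]|/hasPn a0] := boolP (has (fun i => a i != 0) r).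
  rewrite (bigD1_seq i)//= big1_seq ?addr0 ?aC// => j /andP[ji jr].
  by apply/eqP; apply: contraNT ji => aj; apply/eqP; exact: a1.
by rewrite big1_seq ?rnorm0// => j /andP[_ /a0]; rewrite negbK => /eqP.
Qed.

(** * Diagonal kernels and uniform bounds for sums over H *)

Section diagonal_kernels.
Context (R : realType) (G : lcGroupType) (N H : set G).
Hypothesis cN : compact N.
Local Notation E := (C0 R G).
Local Notation good := (@good R G N).
Hypothesis HM : forall x y, H x -> H y -> H (x * y)%g.
Hypothesis HV : forall x, H x -> H x^-1%g.
Hypothesis HN : forall s v, H s -> (N v <-> N (s^-1 * v * s)%g).
Hypothesis H_infinite : forall n, exists F : seq G,
  [/\ uniq F, size F = n & forall s, s \in F -> H s].
Variable eta : G -> G.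
Hypothesis etaH : forall y, H (eta y).
Hypothesis etaN : forall y v, N v -> eta (y * v)%g = eta y.
Hypothesis etaM : forall y s, H s -> eta (y * s)%g = (eta y * s)%g.
Variable L : kernel R G -> E.
Hypothesis L_lin : forall c k k', good k -> good k' -> L (klin c k k') = c *: L k + L k'.
Hypothesis L_bound : exists2 D : R, 0 <= D & forall k C t, good k -> 0 <= C ->
  (forall b y z, rnorm (k b y z) <= C) -> rnorm (L k t) <= D * C.
Hypothesis L_shift : forall s s' k g, H s -> good k ->
  L (kshift s s' k) g = L k (s' * g * s)%g.
Hypothesis L_cst : forall v, L (kcst v) = v.
Hypothesis L_sum : forall (I : eqType) (r : seq I) (K : I -> kernel R G),
  (forall i, i \in r -> good (K i)) -> L (ksum r K) = \sum_(i <- r) L (K i).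

Lemma C0_sumE (I : Type) (r : seq I) (F : I -> E) g :
  (\sum_(i <- r) F i) g = \sum_(i <- r) F i g.
Proof. by elim: r => [|i r ih]; rewrite ?big_nil// !big_cons -ih. Qed.

Definition level (q : G) (w : E) : kernel R G :=
  katom (fun y => if eta y == q then w else 0).

Lemma good_level q w : good (level q w).
Proof.
apply: (@good_katom _ _ _ cN _ (rnorm w)).
  by move=> y; case: ifP; rewrite ?rnorm0 ?rnorm_ge0.
by move=> y v Nv; rewrite etaN.
Qed.

(* The translates of a level kernel by (s, g s^-1), s in H, have disjoint
   supports, while their images all take the value L (level q w) g at 1; as H is
   infinite, this value is 0. *)
Lemma L_level q w : L (level q w) = 0.
Proof.
apply: C0_ext => g; change (L (level q w) g = 0).
apply/eqP/negP => /negP fg; have [D D0 LD] := L_bound.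
set f := L (level q w) g in fg; have f0 : 0 < rnorm f by exact: lt0_rnorm.
pose n := (Num.truncn (D * rnorm w / rnorm f)).+1.
have [F [uF sF HF]] := H_infinite n.
pose K s := kshift s (g * s^-1)%g (level q w).
have gK s : s \in F -> good (K s).
  by move=> /HF Hs; apply: good_kshift => //; [move=> v; exact: HN|exact: good_level].
have LK : L (ksum F K) 1%g = n%:R * f.
  rewrite L_sum// C0_sumE (eq_big_seq (fun=> f)) => [|s sF'].
    by rewrite big_const_seq count_predT iter_addr_0 sF mulr_natl.
  rewrite L_shift ?mulg1 ?mulgVK//; first exact: HF.
  exact: good_level.
have : rnorm (L (ksum F K) 1%g) <= D * rnorm w.
  apply: LD; [exact: good_ksum|exact: rnorm_ge0|].
  move=> b y z; apply: rnorm_sum_one => //; first exact: rnorm_ge0.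
    move=> s _; rewrite /K /kshift /level /katom.
    case: b; rewrite ?rnorm0 ?rnorm_ge0//.
    by case: ifP => _; rewrite ?rnorm_C0_ge// [X in rnorm X](_ : _ = 0) ?rnorm0 ?rnorm_ge0.
  move=> s t /HF Hs /HF Ht; rewrite /K /kshift /level /katom.
  case: b; rewrite ?eqxx//; rewrite !etaM//.
  case: ifP => [/eqP <- _|_]; last by rewrite eqxx.
  case: ifP => [/eqP e _|_]; last by rewrite eqxx.
  by apply: esym; rewrite -[LHS](mulKg (eta y)) e mulKg.
rewrite LK rnormM rnorm_nat -ler_pdivlMr//; apply/negP; rewrite -ltNge.
exact: truncnS_gt.
Qed.

Variable h : nat -> E.
Variable W : nat -> set G.
Variable e : G -> R[i].
Hypothesis h_le1 : forall n z, rnorm (h n z) <= 1.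
Hypothesis hW_le1 : forall n m z, (n <= m)%N -> rnorm (h m z - h n z) <= 1.
Hypothesis hW : forall n m z, (n <= m)%N -> ~ W n z -> h m z = h n z.
Hypothesis h_lim : forall z, exists n, forall m, (n <= m)%N -> h m z = e z.
Hypothesis W_dec : forall n m, (n <= m)%N -> W m `<=` W n.
Hypothesis W_sep : forall s, H s -> s <> 1%g ->
  exists n, forall z, W n z -> ~ W n (z * s)%g.
Hypothesis good_e : good (kdiffuse e).
Variable code : G -> nat.
Hypothesis code_inj : forall s t, H s -> H t -> code s = code t -> s = t.

(** The constant is the bound [D] of [L], whatever [F] is: after a correction that [L] kills, the
    kernel whose image gives the sum is bounded by 1, because at most one term is nonzero at each
    point. *)
Lemma diagonal_kernel : exists (f : E) (C : R), forall F : seq G, uniq F ->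
  (forall s, s \in F -> H s) -> exists n0, forall n, (n0 <= n)%N -> forall g,
  rnorm (\sum_(s <- F) (f (g * s)%g - h n (g * s)%g)) <= C.
Proof.
have [D D0 LD] := L_bound.
pose K y := h (code (eta y)).
have gK : good (katom K).
  apply: (@good_katom _ _ _ cN _ 1) => [y|y v Nv]; last by rewrite /K etaN.
  by apply: rnorm_C0_le => z; exact: h_le1.
pose k := klin 1 (katom K) (kdiffuse e).
have gk : good k by exact: good_klin.
exists (L k), D => F uF HF.
(* One index for all pairs of distinct elements of [F]: the maximum of those given by [W_sep], as
   the sets [W n] decrease. *)
have [n0 Hn0] : exists n0, forall z s t, s \in F -> t \in F ->
    W n0 (z * s)%g -> W n0 (z * t)%g -> s = t.
  suff [n0 H0] : exists n0, forall s t, s \in F -> t \in F -> s <> t ->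
      forall z, W n0 (z * s)%g -> ~ W n0 (z * t)%g.
    exists n0 => z s t sF tF Ws Wt; apply: contrapT => st.
    exact: H0 sF tF st z Ws Wt.
  have /choice[nu Hnu] : forall p : G * G, exists n, p.1 \in F -> p.2 \in F ->
      p.1 <> p.2 -> forall z, W n (z * p.1)%g -> ~ W n (z * p.2)%g.
    move=> [s t] /=; have [[sF tF st]|nst] := pselect [/\ s \in F, t \in F & s <> t].
      have Hst : H (s^-1 * t)%g by apply: HM; [apply: HV|]; exact: HF.
      have st1 : (s^-1 * t)%g <> 1%g.
        by move=> st1; apply: st; rewrite -[RHS](mulVKg s) st1 mulg1.
      have [n Hn] := W_sep Hst st1; exists n => _ _ _ z /Hn.
      by rewrite -mulgA mulVKg.
    by exists 0%N => sF tF st; case: nst.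
  exists (\max_(p <- [seq (s, t) | s <- F, t <- F]) nu p)%N => s t sF tF st z.
  have stF : (s, t) \in [seq (s, t) | s <- F, t <- F] by apply/allpairsP; exists (s, t).
  have le_st := @leq_bigmax_seq _ _ xpredT nu _ stF isT.
  by move=> /(W_dec le_st) Ws /(W_dec le_st); exact: (Hnu (s, t)) Ws.
exists n0 => n n0n g.
have Wn z s t : s \in F -> t \in F -> W n (z * s)%g -> W n (z * t)%g -> s = t.
  by move=> sF tF /(W_dec n0n) Ws /(W_dec n0n); exact: Hn0.
pose decode j := xget 1%g [set p | H p /\ code p = j].
have decodeK p : H p -> decode (code p) = p.
  move=> Hp; have : [set p' | H p' /\ code p' = code p] (decode (code p)).
    by apply: xgetPex; exists p.
  by move=> [Hd cd]; exact: code_inj.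
(* The fibres on which some translate by [s] in [F] uses an [h j] with [j < n]; there [h j - h n] is
   not controlled by [W n]. *)
pose Q := undup [seq (decode j * s^-1)%g | j <- iota 0 n, s <- F].
have QP y s : s \in F -> (code (eta y * s)%g < n)%N -> eta y \in Q.
  move=> sF cn; rewrite mem_undup; apply/allpairsP.
  exists (code (eta y * s)%g, s); split => //=; first by rewrite mem_iota.
  rewrite decodeK ?mulgK//; apply: HM => //; exact: HF.
pose ks s := klin (-1) (kcst (shift 1%g s (h n))) (kshift s 1%g k).
have gks s : s \in F -> good (ks s).
  move=> /HF Hs; apply: good_klin; first exact: good_kcst.
  by apply: good_kshift => // v; exact: HN.
(* The value of the uncorrected sum on atoms in the fibre [q]; subtracting [level q (w q)] makes the
   kernel vanish there. *)
pose w q : E := \sum_(s <- F) (shift 1%g s (h (code (q * s)%g)) - shift 1%g s (h n)).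
have gl q : q \in Q -> good (level q (w q)) by move=> _; exact: good_level.
pose kg := klin (-1) (ksum Q (fun q => level q (w q))) (ksum F ks).
have gkg : good kg by apply: good_klin; exact: good_ksum.
have Lkg : L kg g = \sum_(s <- F) (L k (g * s)%g - h n (g * s)%g).
  rewrite L_lin; [|exact: good_ksum..].
  rewrite L_sum// big1; last by move=> q _; exact: L_level.
  rewrite scaler0 add0r L_sum// C0_sumE; apply: eq_big_seq => s sF.
  have gks' : good (kshift s 1%g k) by apply: good_kshift => // v; apply: HN; exact: HF.
  rewrite L_lin//; last exact: good_kcst.
  rewrite L_cst C0_linE L_shift ?mul1g//; last exact: HF.
  by rewrite mulN1r addrC /= ?mul1g.
rewrite -Lkg -[D]mulr1; apply: LD => // b y z.
have -> : kg b y z = - \sum_(q <- Q) level q (w q) b y z + \sum_(s <- F) ks s b y z.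
  by rewrite /kg /klin mulN1r.
have ksE s : s \in F -> ks s b y z =
    (if b then h (code (eta y * s)%g) (z * s)%g else e (z * s)%g) - h n (z * s)%g.
  move=> /HF Hs; rewrite /ks /klin mulN1r addrC /kcst /= (mul1g z); congr (_ - _).
  rewrite /kshift /k /klin /katom /kdiffuse mul1r.
  by case: b; rewrite ?addr0 ?add0r mul1g// /K etaM.
case: b ksE => ksE.
  have [yQ|yQ] := boolP (eta y \in Q).
    rewrite (bigD1_seq (eta y)) ?undup_uniq//= big1 ?addr0; last first.
      by move=> q qy; rewrite /level /katom eq_sym (negbTE qy).
    rewrite /level /katom eqxx /w C0_sumE addrC -sumrB big1_seq ?rnorm0 ?ler01//.
    move=> s /andP[_ sF]; rewrite ksE//.
    have sE (u v : E) : (shift 1%g s u - shift 1%g s v) z = u (z * s)%g - v (z * s)%g.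
      by change (u (1 * z * s)%g - v (1 * z * s)%g = u (z * s)%g - v (z * s)%g);
        rewrite mul1g.
    by rewrite sE subrr.
  rewrite big1_seq ?oppr0 ?add0r; last first.
    move=> q /andP[_ qQ]; rewrite /level /katom; case: eqP => // yq.
    by rewrite yq qQ in yQ.
  have nc s : s \in F -> (n <= code (eta y * s)%g)%N.
    by move=> sF; rewrite leqNgt; apply: contra yQ; exact: QP.
  apply: rnorm_sum_one => // [s sF|s t sF tF]; first by rewrite ksE// hW_le1// nc.
  rewrite !ksE// => hs ht; apply: (@Wn z) => //.
    by apply: contrapT => nW; move: hs; rewrite (hW (nc s sF) nW) subrr eqxx.
  by apply: contrapT => nW; move: ht; rewrite (hW (nc t tF) nW) subrr eqxx.
rewrite big1; last by [].
rewrite oppr0 add0r.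
(* Each value of [e] is a value of some [h m] with [m >= n], so the diffuse part obeys the same
   estimates as the fibres outside [Q]. *)
have eE x : exists2 m, (n <= m)%N & e x = h m x.
  have [m Hm] := h_lim x; exists (maxn n m); first exact: leq_maxl.
  by rewrite Hm// leq_maxr.
apply: rnorm_sum_one => // [s sF|s t sF tF].
  by rewrite ksE//; have [m nm ->] := eE (z * s)%g; exact: hW_le1.
rewrite !ksE// => hs ht; apply: (@Wn z) => //.
  have [m nm em] := eE (z * s)%g.
  by apply: contrapT => nW; move: hs; rewrite em (hW nm nW) subrr eqxx.
have [m nm em] := eE (z * t)%g.
by apply: contrapT => nW; move: ht; rewrite em (hW nm nW) subrr eqxx.
Qed.

End diagonal_kernels.

(** * Cluster points, countable subgroups, sparse sequences *)

Section sequences_in_groups.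

Lemma infinite_set_injection (T : pointedType) (A : set T) : infinite_set A ->
  exists u : nat -> T, injective u /\ forall n, A (u n).
Proof.
move=> /infiniteP/pcard_leP[u]; exists u; split; last first.
  by move=> n; exact: (@funS _ _ _ _ u).
by move=> m n; apply: (@inj _ _ _ u); rewrite inE.
Qed.

Lemma compact_cluster_seq (T : topologicalType) (K : set T) (u : nat -> T) :
  compact K -> (forall n, K (u n)) ->
  exists2 x, K x & forall U, nbhs x U -> forall n, exists2 m, (n <= m)%N & U (u m).
Proof.
move=> cK uK; have [|x [Kx clx]] := cK (u @ \oo) _.
  by exists 0%N => // n _; exact: uK.
exists x => // U Ux n; have [|_ [[m nm <-] Uy]] := clx (u @` [set m | (n <= m)%N]) U _ Ux.
  by exists n => // m nm; exists m.
by exists m.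
Qed.

Context (G : lcGroupType).

(** Every element is the value of a word in the [u n] and their inverses; words are countable, which
    yields both [code] and [enum]. *)
Lemma generated_subgroup (u : nat -> G) : exists (H : set G) (code : G -> nat)
    (enum : nat -> G), [/\ [/\ H 1%g, forall x y, H x -> H y -> H (x * y)%g &
      forall x, H x -> H x^-1%g], forall n, H (u n),
    forall s t, H s -> H t -> code s = code t -> s = t &
    (forall s, H s -> exists i, enum i = s) /\ forall i, H (enum i)].
Proof.
pose ev (w : seq (bool * nat)) : G :=
  foldr (fun p acc => (if p.1 then u p.2 else (u p.2)^-1) * acc)%g 1%g w.
have ev_cat w w' : ev (w ++ w') = (ev w * ev w')%g.
  by elim: w => [|p w ih] /=; rewrite ?mul1g// ih mulgA.
have evV w : exists w', ev w' = (ev w)^-1%g.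
  elim: w => [|[b n] w [w' ih]]; first by exists [::]; rewrite /= invg1.
  exists (w' ++ [:: (~~ b, n)]); rewrite ev_cat ih /= mulg1 invgM.
  by case: b; rewrite ?invgK.
pose word s := xget [::] [set w | ev w = s].
have wordK s : range ev s -> ev (word s) = s.
  by move=> [w _ ws]; apply: (@xgetPex _ [::] [set w | ev w = s]); exists w.
exists (range ev), (fun s => pickle (word s)), (fun i => odflt 1%g (omap ev (unpickle i))).
split.
- split; first by exists [::].
  + by move=> _ _ [w _ <-] [w' _ <-]; exists (w ++ w').
  + by move=> _ [w _ <-]; have [w' <-] := evV w; exists w'.
- by move=> n; exists [:: (true, n)] => //=; rewrite mulg1.
- move=> s t Hs Ht /(pcan_inj pickleK) st.
  by rewrite -(wordK s Hs) -(wordK t Ht) st.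
- split; first by move=> s [w _ <-]; exists (pickle w); rewrite pickleK.
  by move=> i; case: unpickle => [w|]; [exists w|exists [::]].
Qed.

(* Greedy choice of a sequence in H in which no nontrivial s in H occurs
   infinitely often as a quotient of two terms. *)
Lemma sparse_sequence (H : set G) (enum : nat -> G) :
  (forall l : seq G, exists x, H x /\ x \notin l) ->
  exists p : nat -> G, [/\ forall k, H (p k), injective p &
    forall j k i, (j < k)%N -> (i <= k)%N -> p k <> (p j * enum i)%g].
Proof.
move=> Hinf; pose forb (l : seq G) k := l ++ [seq (x * enum i)%g | x <- l, i <- iota 0 k.+1].
have [c Hc] := choice (fun lk : seq G * nat => Hinf (forb lk.1 lk.2)).
pose L := fix L k := if k is k'.+1 then rcons (L k') (c (L k', k')) else [::].
pose p k := c (L k, k).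
have pL j k : (j < k)%N -> p j \in L k.
  elim: k => // k ih; rewrite ltnS leq_eqVlt => /predU1P[->|/ih jk] /=.
    by rewrite mem_rcons mem_head.
  by rewrite mem_rcons in_cons jk orbT.
have pN j k : (j < k)%N -> p k <> p j.
  move=> jk pjk; have [_] := Hc (L k, k); rewrite mem_cat negb_or => /andP[+ _].
  by rewrite -/(p k) pjk pL.
exists p; split.
- by move=> k; have [] := Hc (L k, k).
- move=> j k pjk; have [jk|kj|//] := ltngtP j k.
    by case: (pN j k jk).
  by case: (pN k j kj).
- move=> j k i jk ik pk; have [_] := Hc (L k, k).
  rewrite mem_cat negb_or => /andP[_ /negP]; apply; apply/allpairsP.
  by exists (p j, i); split; [exact: pL|rewrite mem_iota|exact: pk].
Qed.

End sequences_in_groups.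

(** * Consequence of injectivity for a sequence converging pointwise in C_0(G) *)

Section obstruction.
Context (R : realType) (G : lcGroupType) (N H : set G).
Hypothesis cN : compact N.
Hypothesis N1 : N 1%g.
Hypothesis NM : forall x y, N x -> N y -> N (x * y)%g.
Hypothesis NV : forall x, N x -> N x^-1%g.
Hypothesis H1 : H 1%g.
Hypothesis HM : forall x y, H x -> H y -> H (x * y)%g.
Hypothesis HV : forall x, H x -> H x^-1%g.
Hypothesis HN : forall s v, H s -> (N v <-> N (s^-1 * v * s)%g).
Hypothesis NH : forall s, H s -> N s -> s = 1%g.
Hypothesis H_infinite : forall n, exists F : seq G,
  [/\ uniq F, size F = n & forall s, s \in F -> H s].
Variable code : G -> nat.
Hypothesis code_inj : forall s t, H s -> H t -> code s = code t -> s = t.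
Hypothesis inj : injective_bimodule (@convolution R G) (@C0_lact R G) (@C0_ract R G).

Variable h : nat -> C0 R G.
Variable W : nat -> set G.
Variable e : G -> R[i].
Hypothesis h_le1 : forall n z, rnorm (h n z) <= 1.
Hypothesis hW_le1 : forall n m z, (n <= m)%N -> rnorm (h m z - h n z) <= 1.
Hypothesis hW : forall n m z, (n <= m)%N -> ~ W n z -> h m z = h n z.
Hypothesis h_lim : forall z, exists n, forall m, (n <= m)%N -> h m z = e z.
Hypothesis W_dec : forall n m, (n <= m)%N -> W m `<=` W n.
Hypothesis W_sep : forall s, H s -> s <> 1%g ->
  exists n, forall z, W n z -> ~ W n (z * s)%g.
Hypothesis borel_W : forall n, borel_set (W n).
Hypothesis W_diffuse : forall (x : measure_algebra R G) g, covers N x g ->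
  forall d : R, 0 < d -> exists n, forall t,
    mass x (~` cosets N g `&` [set y | W n (t * y)%g]) <= d.

(** [e] differs from [h n] only inside [W n], whose translates have uniformly small mass on the
    diffuse part of [x]. *)
Lemma good_limit : good N (kdiffuse e).
Proof.
have e1 z : rnorm (e z) <= 1.
  by have [n Hn] := h_lim z; rewrite -(Hn n).
have be : bborel e.
  by apply: (@bborel_limit _ _ (fun n => h n) _ 1) => // n; exact: bborel_C0.
apply: (good_kdiffuse cN e1 be) => x g cg d d0.
(* Halved to offset the factor 2 of [complex_integral_off]. *)
have [n Hn] := W_diffuse cg (divr_gt0 d0 (ltr0n R 2)).
exists (h n) => t; have mg : borel_set (cosets N g) by exact: borel_cosets.
have bk (f : G -> R[i]) : bborel f -> bborel (ker (kdiffuse f) (cosets N g) t).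
  move=> bf; apply: (@bborel_patch _ _ (cosets N g) (fun=> 0) (fun y => f (t * y)%g)) => //.
    exact: bborel_cst.
  by apply: bborel_comp => //; exact: mulgl_continuous.
rewrite -(bfunctional_sub (complex_integral_bfunctional x)); last 2 first.
- exact: bk.
- by apply: bk; exact: bborel_C0.
have eE z : exists2 m, (n <= m)%N & e z = h m z.
  have [m Hm] := h_lim z; exists (maxn n m); first exact: leq_maxl.
  by rewrite Hm// leq_maxr.
have mA : borel_set (~` cosets N g `&` [set y | W n (t * y)%g]).
  apply: measurableI; first exact: measurableC.
  exact: borel_preimage (@mulgl_continuous G t) (borel_W n).
rewrite (le_trans (complex_integral_off x (M := 1) mA _ ler01 _ _))//.
- by apply: bborelB; [exact: bk|apply: bk; exact: bborel_C0].
- move=> y; rewrite /ker /kdiffuse; case: ifP => _; first by rewrite subrr rnorm0.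
  by have [m nm ->] := eE (t * y)%g; exact: hW_le1.
- move=> y nA; rewrite /ker /kdiffuse; case: ifPn => [_|/negP yg]; first by rewrite subrr.
  have [m nm ->] := eE (t * y)%g; rewrite (@hW n m) ?subrr// => Wy; apply: nA.
  by split => //= gy; apply: yg; exact/mem_set.
by rewrite mul1r mulrC -ler_pdivlMr.
Qed.

Lemma injective_obstruction : exists (f : C0 R G) (C : R), forall F : seq G, uniq F ->
  (forall s, s \in F -> H s) -> exists n0, forall n, (n0 <= n)%N -> forall g,
  rnorm (\sum_(s <- F) (f (g * s)%g - h n (g * s)%g)) <= C.
Proof.
have [rho [rho_iota rho_lact rho_ract]] := inj.
apply: (@diagonal_kernel _ _ N H cN HM HV HN H_infinite (hpart N H) _ _ _
  (Gam cN NM NV rho) _ _ _ _ _ h W e h_le1 hW_le1 hW h_lim W_dec W_sep _ code code_inj).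
- exact: hpart_in.
- by move=> y v; exact: hpartN.
- by move=> y s; exact: hpartM.
- by move=> c k k'; exact: Gam_lin.
- exact: Gam_bound.
- by move=> s s' k g Hs gk; apply: Gam_shift => // v; exact: HN.
- exact: Gam_cst.
- by move=> I r K; exact: Gam_sum.
- exact: good_limit.
Qed.

End obstruction.

(** * Discrete groups *)

Section discrete_case.
Context (R : realType) (G : lcGroupType).
Hypothesis open1 : open [set (1%g : G)].

Let open_all (A : set G) : open A.
Proof.
rewrite (_ : A = \bigcup_(a in A) [set y | (a^-1 * y)%g = 1%g]).
  apply: bigcup_open => a _; have /continuousP c := @mulgl_continuous G a^-1%g.
  exact: (c [set 1%g] open1).
apply/seteqP; split => [y Ay|y [a Aa /= ay]]; first by exists y => //=; rewrite mulVg.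
by rewrite -[y](mulVKg a) ay mulg1.
Qed.

Let borel_all (A : set G) : borel_set A.
Proof. exact: sub_sigma_algebra. Qed.

Let compact_finite (K : set G) : compact K -> finite_set K.
Proof.
move=> cK; apply: contrapT => /infinite_set_injection[u [u_inj uK]].
have [x _ Hx] := compact_cluster_seq cK uK.
have nx : nbhs x [set x] by apply: open_nbhs_nbhs; split.
have [m _ /= um] := Hx _ nx 0%N; have [k mk /= uk] := Hx _ nx m.+1.
by have := u_inj m k; rewrite um uk => /(_ erefl) mk'; rewrite mk' ltnn in mk.
Qed.

(** [h n] is the indicator of the first [n] terms of a sparse sequence [p] in [H]. The resulting [f]
    is at most 1/2 off a finite set, while [h n] is 1 at more and more points of [H], so the sums of
    [f - h n] over them are unbounded. *)
Lemma not_injective_discrete : infinite_set [set: G] ->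
  ~ injective_bimodule (@convolution R G) (@C0_lact R G) (@C0_ract R G).
Proof.
move=> /infinite_set_injection[u [u_inj _]] inj.
have [H [code [enum [[H1 HM HV] Hu code_inj [enumP _]]]]] := generated_subgroup u.
have Hinf (l : seq G) : exists x, H x /\ x \notin l.
  apply: contrapT => nx; pose s := [seq u i | i <- iota 0 (size l).+1].
  have us : uniq s by rewrite map_inj_uniq ?iota_uniq.
  have sl : {subset s <= l}.
    move=> _ /mapP[i _ ->]; apply/negPn/negP => ul; apply: nx.
    by exists (u i); split.
  by have := uniq_leq_size us sl; rewrite size_map size_iota ltnn.
have [p [Hp p_inj p_sparse]] := sparse_sequence enum Hinf.
pose P n := [seq p k | k <- iota 0 n].
have PP n z : z \in P n <-> exists2 k, (k < n)%N & z = p k.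
  split => [/mapP[k]|[k kn ->]]; first by rewrite mem_iota => /= kn ->; exists k.
  by apply/mapP; exists k => //; rewrite mem_iota.
have hC n : (fun z => (z \in P n)%:R : R[i]^o) \in @C0_pred R G.
  apply/mem_set; split; first by apply/continuousP => A _; exact: open_all.
  move=> d d0; exists [set` P n]; first by apply: finite_compact; exact: finite_seq.
  by move=> z /= /negP/negbTE ->; rewrite rnorm0 ltW.
pose h n := MkC0 (hC n).
pose W n : set G := [set z | exists2 k, (n <= k)%N & z = p k].
pose e z : R[i] := `[< exists k, z = p k >]%:R.
have hE n z : h n z = (z \in P n)%:R by [].
have P_mono n m z : (n <= m)%N -> z \in P n -> z \in P m.
  by move=> nm /PP[k kn ->]; apply/PP; exists k => //; exact: leq_trans nm.
have h1 n z : rnorm (h n z) <= 1 by rewrite hE rnorm_nat lern1 leq_b1.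
have h2 n m z : (n <= m)%N -> rnorm (h m z - h n z) <= 1.
  move=> nm; rewrite !hE; case: (boolP (z \in P n)) => [/(P_mono _ _ _ nm) ->|_].
    by rewrite subrr rnorm0.
  by rewrite subr0 rnorm_nat lern1 leq_b1.
have h3 n m z : (n <= m)%N -> ~ W n z -> h m z = h n z.
  move=> nm nW; rewrite !hE; case: (boolP (z \in P n)) => [/(P_mono _ _ _ nm) -> //|zn].
  rewrite (_ : z \in P m = false)//; apply/negbTE/negP => /PP[k km zk].
  have [kn|nk] := ltnP k n; last by apply: nW; exists k.
  by move/negP : zn; apply; apply/PP; exists k.
have h4 z : exists n, forall m, (n <= m)%N -> h m z = e z.
  rewrite /e; case: asboolP => [[k zk]|nz].
    by exists k.+1 => m km; rewrite hE (_ : z \in P m)//; apply/PP; exists k.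
  exists 0%N => m _; rewrite hE (_ : z \in P m = false)//.
  by apply/negbTE/negP => /PP[k _ zk]; apply: nz; exists k.
have W_dec n m : (n <= m)%N -> W m `<=` W n.
  by move=> nm z [k mk zk]; exists k => //; exact: leq_trans mk.
(* By sparseness, [p k = p j * s] with [s <> 1] forces the larger of [j] and [k] below an index of
   [s] or of its inverse. *)
have W_sep s : H s -> s <> 1%g -> exists n, forall z, W n z -> ~ W n (z * s)%g.
  move=> Hs s1; have [i si] := enumP s Hs; have [i' si'] := enumP _ (HV s Hs).
  exists (maxn i i') => z [j ij ->] [k ik pk].
  have [jk|kj|jk] := ltngtP j k.
  - apply: (p_sparse j k i jk); last by rewrite si pk.
    by rewrite (leq_trans _ ik)// leq_maxl.
  - apply: (p_sparse k j i' kj); last by rewrite si' -pk mulgK.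
    by rewrite (leq_trans _ ij)// leq_maxr.
  - by apply: s1; rewrite -[s](mulKg (p j)) pk jk mulVg.
pose N : set G := [set 1%g].
have cN : compact N by exact: compact_set1.
have Hsize n : exists F : seq G, [/\ uniq F, size F = n & forall s, s \in F -> H s].
  exists (P n); split; first by rewrite map_inj_uniq ?iota_uniq.
    by rewrite size_map size_iota.
  by move=> s /PP[k _ ->].
(* Compact sets are finite and points outside [cosets N g] are null, so tightness gives the bound
   already for [n = 0]. *)
have W_diffuse (x : measure_algebra R G) g : covers N x g -> forall d : R, 0 < d ->
    exists n, forall t, mass x (~` cosets N g `&` [set y | W n (t * y)%g]) <= d.
  move=> cg d d0; exists 0%N => t; have [K cK mK] := mass_tight x d0.
  have [l Kl] := (finite_seqP K).1 (compact_finite cK).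
  rewrite (le_trans (mass_le x (borel_all _)
    (borel_all (~` K `|` (K `\` cosets N g))) _))//.
    by move=> y [gy _]; have [Ky|nKy] := pselect (K y); [right|left].
  rewrite (le_trans (massU_le _ (borel_all _) (borel_all _)))//.
  rewrite -[leRHS]addr0 lerD//.
  rewrite (le_trans (mass_le x (borel_all _)
    (borel_all (\bigcup_n ([set nth 1%g l n] `\` cosets N g))) _))//.
    rewrite Kl => y [/= yl gy]; exists (index y l) => //.
    by split => //=; rewrite nth_index.
  rewrite mass_bigcup0// => n.
  have [ga|ga] := pselect (cosets N g (nth 1%g l n)).
    by rewrite (_ : _ `\` _ = set0) ?mass0// -subset0 => y [/= ->].
  apply/eqP; rewrite eq_le mass_ge0 andbT.
  have [<-|/cg//] := eqVneq (mass x (lcoset N (nth 1%g l n))) 0.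
  rewrite mass_le//.
  by move=> y [/= -> _]; rewrite /lcoset /= mulVg.
have [||||||f [C HC]] := @injective_obstruction R G N H cN _ _ _ H1 HM HV _ _ Hsize
  code code_inj inj h W e h1 h2 h3 h4 W_dec W_sep _ W_diffuse.
- by [].
- by move=> x y -> ->; rewrite /N /= mulg1.
- by move=> x ->; rewrite /N /= invg1.
- move=> s v Hs; split => [->|]; first by rewrite mulg1 mulVg.
  rewrite /N /= => sv; rewrite -[v](mulKg s^-1%g) -[in LHS](mulgK s (s^-1 * v)%g) sv.
  by rewrite invgK mul1g mulgV.
- by move=> s _ ->.
- by move=> n; exact: borel_all.
have [K cK fK] := C0_vanishes f (divr_gt0 ltr01 (ltr0n R 2)).
have [l Kl] := (finite_seqP K).1 (compact_finite cK).
(* After at most [size l] terms are discarded, more than [2 |C|] remain. *)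
pose m := ((Num.truncn (2%:R * `|C|)).+1 + size l)%N.
pose F := [seq z <- P m | z \notin l].
have uP : uniq (P m) by rewrite map_inj_uniq ?iota_uniq.
have uF : uniq F by rewrite filter_uniq.
have sF : (Num.truncn (2%:R * `|C|)).+1%:R <= (size F)%:R :> R.
  have : (size (P m) <= size F + size l)%N.
    rewrite size_filter -(count_predC (fun z => z \notin l) (P m)) leq_add2l.
    rewrite -size_filter; apply: uniq_leq_size; first exact: filter_uniq.
    by move=> z; rewrite mem_filter /= negbK => /andP[].
  by rewrite size_map size_iota leq_add2r ler_nat.
have HF s : s \in F -> H s.
  by rewrite mem_filter => /andP[_ /PP[k _ ->]].
have [n0 Hn0] := HC F uF HF.
have nm : (n0 <= maxn n0 m)%N by exact: leq_maxl.
have := Hn0 _ nm 1%g; apply/negP; rewrite -ltNge.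
have hs s : s \in F -> f (1 * s)%g - h (maxn n0 m) (1 * s)%g = f s - 1.
  rewrite mem_filter => /andP[_ sP]; rewrite mul1g hE (P_mono m)//.
  exact: leq_maxr.
rewrite (eq_big_seq _ hs) sumrB.
have -> : \sum_(s <- F) 1 = (size F)%:R :> R[i].
  by rewrite big_const_seq count_predT iter_addr_0.
have fF : rnorm (\sum_(s <- F) f s) <= (size F)%:R / 2%:R.
  rewrite (le_trans (rnorm_sum _ _ _))// big_seq.
  rewrite (le_trans (ler_sum _ (G := fun=> 1 / 2%:R) _))//.
    move=> s; rewrite mem_filter => /andP[sl _]; apply: fK; rewrite Kl /=.
    exact/negP.
  rewrite -big_seq big_const_seq count_predT iter_addr_0.
  by rewrite div1r -[leLHS]mulr_natl.
have H2 : (size F)%:R <= rnorm (\sum_(s <- F) f s - (size F)%:R) + (size F)%:R / 2%:R.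
  rewrite -[leLHS]rnorm_nat -[X in rnorm X <= _](subrK (\sum_(s <- F) f s)).
  by rewrite (le_trans (rnormD _ _))// rnormBC lerD2l.
have H3 : 2%:R * `|C| < (size F)%:R by rewrite (lt_le_trans _ sF)// truncnS_gt.
have := ler_norm C; move: H2 H3; move: (rnorm _) ((size F)%:R) `|C| => a b c; lra.
Qed.

End discrete_case.

(** * Non-discrete groups *)

Lemma nbhs_translate (G : lcGroupType) (g : G) (S : set G) :
  nbhs (1%g : G) S -> nbhs g [set h | S (g^-1 * h)%g].
Proof. by rewrite -(mulVg g); exact: mulgl_continuous. Qed.

(** * The continuous pseudonorm defined by a sequence in C_0(G) *)

Section pseudonorm.
Context (R : realType) (G : lcGroupType) (psi : nat -> C0 R G).
Hypothesis psi_le1 : forall i z, rnorm (psi i z) <= 1.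

Let osc i g : R := rnorm (shift 1%g g (psi i) - psi i).

Let osc_ge i g x : rnorm (psi i (x * g)%g - psi i x) <= osc i g.
Proof.
have := rnorm_C0_ge (shift 1%g g (psi i) - psi i) x.
change (rnorm (psi i (1 * x * g)%g - psi i x) <= osc i g ->
  rnorm (psi i (x * g)%g - psi i x) <= osc i g).
by rewrite mul1g.
Qed.

Let osc_le i g M : (forall x, rnorm (psi i (x * g)%g - psi i x) <= M) -> osc i g <= M.
Proof.
move=> H; apply: rnorm_C0_le => x.
change (rnorm (psi i (1 * x * g)%g - psi i x) <= M).
by rewrite mul1g.
Qed.

Let osc_le2 i g : osc i g <= 2%:R.
Proof.
apply: osc_le => x; rewrite (le_trans (rnormD _ _))// rnormN.
by rewrite (_ : 2%:R = 1 + 1)// lerD.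
Qed.

(** A construction in the manner of Birkhoff and Kakutani. The weights make all but finitely many
    terms uniformly small, which gives continuity. *)
Definition pnorm (g : G) : R := sup [set osc i g / i.+1%:R | i in [set: nat]].

Let pnorm_ub g : has_ubound [set osc i g / i.+1%:R | i in [set: nat]].
Proof.
exists 2%:R => _ [i _ <-]; rewrite ler_pdivrMr// (le_trans (osc_le2 i g))//.
by rewrite ler_peMr// ler1n.
Qed.

Let osc_le_pnorm i g : osc i g / i.+1%:R <= pnorm g.
Proof. by apply: ub_le_sup; [exact: pnorm_ub|exists i]. Qed.

Let pnorm_le g M : (forall i, osc i g / i.+1%:R <= M) -> pnorm g <= M.
Proof.
move=> H; apply: ge_sup; first by exists (osc 0%N g / 1%:R), 0%N.
by move=> _ [i _ <-].
Qed.

Lemma pnorm_ge i g x : rnorm (psi i (x * g)%g - psi i x) <= i.+1%:R * pnorm g.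
Proof.
by rewrite (le_trans (osc_ge i g x))// mulrC -ler_pdivrMr// osc_le_pnorm.
Qed.

Lemma pnorm_ge0 g : 0 <= pnorm g.
Proof. by rewrite (le_trans _ (osc_le_pnorm 0%N g))// divr_ge0// rnorm_ge0. Qed.

Lemma pnorm1 : pnorm 1%g = 0.
Proof.
apply/eqP; rewrite eq_le pnorm_ge0 andbT; apply: pnorm_le => i.
by rewrite ler_pdivrMr// mul0r; apply: osc_le => x; rewrite mulg1 subrr rnorm0.
Qed.

Lemma pnormM g h : pnorm (g * h)%g <= pnorm g + pnorm h.
Proof.
apply: pnorm_le => i; rewrite ler_pdivrMr//; apply: osc_le => x.
have -> : psi i (x * (g * h))%g - psi i x =
    (psi i (x * (g * h))%g - psi i (x * g)%g) + (psi i (x * g)%g - psi i x).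
  by rewrite addrA subrK.
apply: le_trans (rnormD _ _) _.
have h1 := pnorm_ge i g x; have h2 := pnorm_ge i h (x * g)%g.
rewrite mulrC mulrDr [leRHS]addrC; apply: lerD; last exact: h1.
by rewrite mulgA; exact: h2.
Qed.

Lemma pnormV g : pnorm g^-1%g = pnorm g.
Proof.
suff H h : pnorm h^-1%g <= pnorm h.
  apply/eqP; rewrite eq_le; apply/andP; split; first exact: H.
  by have := H g^-1%g; rewrite invgK.
apply: pnorm_le => i; rewrite ler_pdivrMr//; apply: osc_le => x.
have := pnorm_ge i h (x * h^-1)%g.
by rewrite mulgVK rnormBC mulrC.
Qed.

Lemma pnorm_eq0 g : pnorm g = 0 <-> forall i x, psi i (x * g)%g = psi i x.
Proof.
split=> [g0 i x|H].
  apply/eqP; rewrite -subr_eq0; apply/eqP/rnorm0_eq0/eqP.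
  by rewrite eq_le rnorm_ge0 andbT; have := pnorm_ge i g x; rewrite g0 mulr0.
apply/eqP; rewrite eq_le pnorm_ge0 andbT; apply: pnorm_le => i.
by rewrite ler_pdivrMr// mul0r; apply: osc_le => x; rewrite H subrr rnorm0.
Qed.

Let opp_mulg (x y : G) := (y * x)%g.

Let opp_mulg_continuous : continuous (fun p : G * G => opp_mulg p.1 p.2).
Proof.
move=> p; apply: (@continuous_comp _ _ _ (fun p : G * G => (p.2, p.1))
  (fun p : G * G => p.1 * p.2)%g); last exact: mulg_continuous.
by apply: cvg_pair; [exact: cvg_snd|exact: cvg_fst].
Qed.

(** Each [osc i] is at most 2, so indices beyond [2 / e] contribute at most [e]; the finitely many
    others are controlled by uniform continuity of [psi i]. *)
Lemma pnorm_near1 (e : R) : 0 < e -> \forall g \near (1%g : G), pnorm g <= e.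
Proof.
move=> e0; pose n := Num.truncn (2%:R / e).
have H : \forall g \near (1%g : G), forall i : 'I_n.+1, osc i g <= e.
  apply: filter_forall => i.
  (* The opposite product makes this a statement about [y |-> psi i (y * g)]. *)
  have := @C0_uniform R G opp_mulg opp_mulg_continuous
    (fun x y z => esym (mulgA z y x)) (@mulg1 G) (@mulVg G) (@mulgV G) (psi i) 1%g e e0.
  apply: filterS => g Hg; apply: osc_le => x.
  by have := Hg x; rewrite /opp_mulg mulg1.
apply: filterS H => g Hg; apply: pnorm_le => i; rewrite ler_pdivrMr//.
have [ni|ni] := ltnP i n.+1.
  rewrite (le_trans (Hg (Ordinal ni)))// ler_peMr ?(ltW e0)// ler1n//.
rewrite (le_trans (osc_le2 i g))// mulrC -ler_pdivrMr//.
by rewrite (le_trans (ltW (truncnS_gt _)))// ler_nat ltnW.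
Qed.

Lemma pnorm_continuous : continuous (pnorm : G -> R).
Proof.
move=> g; apply/(@cvgrPdist_le _ _ _ (nbhs g)) => e e0.
move: (nbhs_translate g (pnorm_near1 e0)); apply: filterS => h /= gh.
have gh' : pnorm (h^-1 * g)%g <= e.
  by have := pnormV (g^-1 * h)%g; rewrite invgM invgK => ->.
have h1 := pnormM g (g^-1 * h)%g; rewrite mulVKg in h1.
have h2 := pnormM h (h^-1 * g)%g; rewrite mulVKg in h2.
move: h1 h2 gh gh'; rewrite /= ler_norml.
move: (pnorm g) (pnorm h) (pnorm (g^-1 * h)%g) (pnorm (h^-1 * g)%g) => u v w z.
by move=> ? ? ? ?; apply/andP; split; lra.
Qed.

End pseudonorm.

(* Tent functions of height 1 at the points a (2k), vanishing at a (2k+1) when a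
   decreases fast enough. *)
Section tents.
Context (R : realType) (a : nat -> R).
Hypothesis a_gt0 : forall k, 0 < a k.
Hypothesis a_dec : forall k, a k.+1 < a k / 4%:R.

Definition tent k (r : R) : R := Num.max 0 (1 - 2%:R * `|r / a k - 1|).

Fixpoint tents n (r : R) : R :=
  if n is n'.+1 then Num.max (tents n' r) (tent n'.*2 r) else 0.

Lemma tent01 k r : 0 <= tent k r <= 1.
Proof.
rewrite /tent le_max lexx /= ge_max ler01 /= lerBlDr lerDl.
by rewrite mulr_ge0.
Qed.

Lemma tent_hi k r : 2%:R * a k <= r -> tent k r = 0.
Proof.
rewrite -ler_pdivlMr// => H; rewrite /tent; apply/max_idPl.
rewrite subr_le0; have := ler_norm (r / a k - 1); lra.
Qed.

Lemma tent_lo k r : 2%:R * r <= a k -> tent k r = 0.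
Proof.
move=> H; rewrite /tent; apply/max_idPl.
have : r / a k <= 1 / 2%:R by rewrite ler_pdivrMr//; lra.
rewrite subr_le0; have := lerNnormlW (lexx `|r / a k - 1|); lra.
Qed.

Lemma tent_peak k : tent k (a k) = 1.
Proof. by rewrite /tent divff ?gt_eqF// subrr normr0 mulr0 subr0; apply/max_idPr. Qed.

Lemma tentsS n r : tents n.+1 r = Num.max (tents n r) (tent n.*2 r).
Proof. by []. Qed.

Lemma tents0 r : tents 0 r = 0.
Proof. by []. Qed.

Lemma tents01 n r : 0 <= tents n r <= 1.
Proof.
elim: n => [|n /andP[h1 h2]]; first by rewrite tents0 lexx ler01.
have /andP[h3 h4] := tent01 n.*2 r.
by rewrite tentsS le_max h1 /= ge_max h2.
Qed.

Lemma a_le m n : (m <= n)%N -> a n <= a m.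
Proof.
elim: n => [|n ih]; first by rewrite leqn0 => /eqP ->.
rewrite leq_eqVlt => /predU1P[-> //|]; rewrite ltnS => /ih.
apply: le_trans; have := a_dec n; have := a_gt0 n; lra.
Qed.

Lemma a_small (e : R) : 0 < e -> exists n, a n < e.
Proof.
move=> e0; have an n : n.+1%:R * a n <= a 0%N.
  elim: n => [|n ih]; first by rewrite mul1r.
  apply: le_trans ih; have := a_dec n; have := a_gt0 n.
  rewrite -[n.+2%:R]natr1; have : 1 <= n.+1%:R :> R by rewrite ler1n.
  move: (n.+1%:R) (a n) (a n.+1) => x y z; nra.
exists (Num.truncn (a 0%N / e)); set n := Num.truncn _.
have : a 0%N / e < n.+1%:R by exact: truncnS_gt.
rewrite ltr_pdivrMr// => /(le_lt_trans (an n)).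
by rewrite ltr_pM2l.
Qed.

(** The tent at [a (2k)] is supported in [[a (2k) / 2, 2 a (2k)]]; those with [k >= n] vanish from
    [2 a (2n)] onward. *)
Lemma tents_stable n m r : (n <= m)%N -> 2%:R * a n.*2 <= r -> tents m r = tents n r.
Proof.
elim: m => [|m ih]; first by rewrite leqn0 => /eqP ->.
rewrite leq_eqVlt => /predU1P[-> //|]; rewrite ltnS => nm ar.
rewrite tentsS ih// tent_hi; first by apply/max_idPl; have /andP[] := tents01 n r.
by rewrite (le_trans _ ar)// ler_wpM2l// a_le// leq_double.
Qed.

Lemma tents_at0 n : tents n 0 = 0.
Proof.
elim: n => [|n ih]; rewrite ?tents0// tentsS ih tent_lo ?maxxx// mulr0.
exact: ltW.
Qed.

Lemma tents_even k n : (k < n)%N -> tents n (a k.*2) = 1.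
Proof.
move=> kn; apply/eqP; rewrite eq_le; have /andP[_ -> /=] := tents01 n (a k.*2).
elim: n kn => // n ih; rewrite ltnS leq_eqVlt => /predU1P[<-|/ih kn];
  rewrite tentsS le_max.
  by rewrite tent_peak lexx orbT.
by rewrite kn.
Qed.

(** The ratio 4 puts [a (2k+1)] in the gap between the tents at [a (2k+2)] and [a (2k)]. *)
Lemma tents_odd k n : tents n (a k.*2.+1) = 0.
Proof.
elim: n => [|n ih]; rewrite ?tents0// tentsS ih.
apply/max_idPl; have [nk|kn] := leqP n k.
  rewrite tent_lo//; have h1 := a_dec n.*2.
  have h2 : a k.*2.+1 <= a n.*2.+1 by rewrite a_le// ltnS leq_double.
  have := a_gt0 n.*2; lra.
rewrite tent_hi//; have h1 := a_dec k.*2.+1.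
have h2 : a n.*2 <= a k.*2.+2 by rewrite a_le// -doubleS leq_double.
have := a_gt0 k.*2.+1; lra.
Qed.

Lemma tents_continuous n : continuous (tents n).
Proof.
elim: n => [|n ih] r.
  by rewrite (_ : tents 0 = fun=> 0); [exact: cvg_cst|apply/funext => x; rewrite tents0].
rewrite (_ : tents n.+1 = (fun r => Num.max (tents n r) (tent n.*2 r))); last first.
  by apply/funext => x; rewrite tentsS.
apply: continuous_max; first exact: ih.
apply: continuous_max; first exact: cvg_cst.
apply: cvgB; first exact: cvg_cst.
apply: cvgM; first exact: cvg_cst.
apply: (@continuous_comp _ _ _ (fun r : R => r / a n.*2 - 1) (fun x : R => `|x|)).
  by apply: cvgB; [apply: cvgM; [exact: cvg_id|exact: cvg_cst]|exact: cvg_cst].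
exact: norm_continuous.
Qed.

End tents.

(** * Separating functions and countable subgroups accumulating at 1 *)

Section nondiscrete_groups.
Context (R : realType) (G : lcGroupType).

Lemma separating_C0 (s : G) : exists f : C0 R G,
  [/\ forall z, rnorm (f z) <= 1, f 1%g = 1 & s <> 1%g -> f s = 0].
Proof.
pose U : set G := [set z | s <> 1%g -> z <> s].
have oU : open U.
  have [s1|s1] := pselect (s = 1%g).
    rewrite (_ : U = setT); first exact: openT.
    by apply/seteqP; split => // z _ /(_ s1).
  rewrite (_ : U = ~` [set s]); last first.
    by apply/seteqP; split => z zs; [exact: zs s1|move=> _; exact: zs].
  apply: closed_openC; apply: compact_closed; last exact: compact_set1.
  exact: lcgroup_hausdorff.
have KU : [set (1%g : G)] `<=` U by move=> _ -> s1 /esym.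
have [u [Cu u01 u1 u0]] := @urysohn_C0 R G _ _ (@compact_set1 G 1%g) oU KU.
exists (MkC0 Cu); split => /=.
- by move=> z; have /andP[h0 h1] := u01 z; rewrite rnormC ger0_norm.
- by rewrite u1.
- by move=> s1; rewrite u0// => /(_ s1); exact.
Qed.

Lemma compact_nbhs1 : exists2 K : set G, compact K & nbhs (1%g : G) K.
Proof.
have [f [_ f1 _]] := separating_C0 1%g.
have [K cK fK] := C0_vanishes f (divr_gt0 ltr01 (ltr0n R 2)).
exists K => //.
have /complex_continuousP/(_ 1%g _ (divr_gt0 ltr01 (ltr0n R 4))) := @C0_continuous _ _ f.
apply: filterS => z; rewrite f1 => fz; apply: contrapT => /fK fz'.
have : rnorm (1 : R[i]) <= 1 / 2%:R + 1 / 4%:R.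
  rewrite -[X in rnorm X](subKr (f z)) opprB addrC.
  by rewrite (le_trans (rnormD _ _))// addrC lerD// rnormBC.
by rewrite rnorm1; apply/negP; rewrite -ltNge; lra.
Qed.

(** A compact neighbourhood of 1 is infinite, so it contains an injective sequence [u] with a
    cluster point [x]. Quotients of terms close to [x] are close to 1 and lie in the group generated
    by [u]. *)
Lemma accumulating_subgroup : ~ open [set (1%g : G)] ->
  exists (H : set G) (code : G -> nat) (enum : nat -> G),
  [/\ [/\ H 1%g, forall x y, H x -> H y -> H (x * y)%g & forall x, H x -> H x^-1%g],
    forall s t, H s -> H t -> code s = code t -> s = t,
    (forall s, H s -> exists i, enum i = s) /\ (forall i, H (enum i)) &
    forall V, nbhs (1%g : G) V -> forall n, exists F : seq G,
      [/\ uniq F, size F = n & forall s, s \in F -> H s /\ V s]].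
Proof.
move=> nopen; have [K cK nK] := compact_nbhs1.
have : infinite_set K.
  move=> fK; apply: nopen.
  have cl : closed (K `\ (1%g : G)).
    apply: compact_closed; first exact: lcgroup_hausdorff.
    by apply: finite_compact; exact: finite_setD.
  rewrite openE => _ ->; rewrite /interior.
  have : nbhs (1%g : G) (K `&` ~` (K `\ (1%g : G))).
    apply: filterI => //; apply: open_nbhs_nbhs; split; first exact: closed_openC.
    by move=> -[_]; apply.
  by apply: filterS => z [Kz nz]; apply: contrapT => z1; apply: nz.
move=> /infinite_set_injection[u [u_inj uK]].
have [x _ ux] := compact_cluster_seq cK uK.
have [H [code [enum [[H1 HM HV] Hu code_inj [enumP enumH]]]]] := generated_subgroup u.
exists H, code, enum; split => // V nV n.
have [U nU UV] : exists2 U, nbhs x U & forall y z, U y -> U z -> V (y^-1 * z)%g.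
  have c : {for (x, x), continuous (fun q : G * G => (q.1^-1 * q.2)%g)}.
    apply: (@continuous_comp _ _ _ (fun q : G * G => (q.1^-1, q.2)%g)
      (fun q : G * G => (q.1 * q.2)%g)); last exact: mulg_continuous.
    apply: cvg_pair; last exact: cvg_snd.
    by apply: (@continuous_comp _ _ _ fst (fun y : G => y^-1)%g);
      [exact: cvg_fst|exact: invg_continuous].
  have nV' : nbhs (x^-1 * x)%g V by rewrite mulVg.
  have [[A B] [/= nA nB AB]] := c V nV'.
  exists (A `&` B); first exact: filterI.
  by move=> y z [Ay _] [_ Bz]; exact: (AB (y, z)).
have [l [ul sl lU]] : exists l : seq nat, [/\ uniq l, size l = n & forall j, j \in l -> U (u j)].
  elim: n => [|n [l [ul sl lU]]]; first by exists [::].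
  have [j lj uj] := ux U nU (\max_(i <- l) i).+1.
  exists (j :: l); split => /=.
  - rewrite ul andbT; apply/negP => jl; have := @leq_bigmax_seq _ l xpredT id j jl isT.
    by move/(leq_trans lj); rewrite ltnn.
  - by rewrite sl.
  - by move=> i; rewrite in_cons => /predU1P[->|/lU].
(* Multiplying by the inverse of one fixed term near [x] keeps the [n] elements distinct. *)
have [i0 _ ui0] := ux U nU 0%N.
exists [seq ((u i0)^-1 * u j)%g | j <- l]; split.
- rewrite map_inj_in_uniq// => j k _ _ jk; apply: u_inj.
  by rewrite -(mulVKg (u i0) (u j)) jk mulVKg.
- by rewrite size_map.
- move=> s /mapP[j jl ->]; split; last by apply: UV => //; exact: lU.
  by apply: HM; [apply: HV|]; exact: Hu.
Qed.

End nondiscrete_groups.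

(** * The contradiction for a subgroup accumulating at 1 *)

Section accumulating_case.
Context (R : realType) (G : lcGroupType).
Variables (H : set G) (code : G -> nat).
Hypothesis H1 : H 1%g.
Hypothesis HM : forall x y, H x -> H y -> H (x * y)%g.
Hypothesis HV : forall x, H x -> H x^-1%g.
Hypothesis code_inj : forall s t, H s -> H t -> code s = code t -> s = t.
Hypothesis accH : forall V, nbhs (1%g : G) V -> forall n, exists F : seq G,
  [/\ uniq F, size F = n & forall s, s \in F -> H s /\ V s].
Variable p : G -> R.
Hypothesis p_ge0 : forall g, 0 <= p g.
Hypothesis p1 : p 1%g = 0.
Hypothesis pM : forall g h, p (g * h)%g <= p g + p h.
Hypothesis pV : forall g, p g^-1%g = p g.
Hypothesis p_cont : continuous p.
Hypothesis p_gt0 : forall s, H s -> s <> 1%g -> 0 < p s.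
Hypothesis p_conj : forall s v, H s -> (p v = 0 <-> p (s^-1 * v * s)%g = 0).
Hypothesis p_compact : exists2 r, 0 < r & exists2 K, compact K & forall g, p g <= r -> K g.

Let N : set G := [set g | p g = 0].

Let N1 : N 1%g. Proof. exact: p1. Qed.

Let NM x y : N x -> N y -> N (x * y)%g.
Proof.
rewrite /N /= => x0 y0; apply/eqP; rewrite eq_le p_ge0 andbT.
by rewrite (le_trans (pM x y))// x0 y0 addr0.
Qed.

Let NV x : N x -> N x^-1%g. Proof. by rewrite /N /= pV. Qed.

Let NH s : H s -> N s -> s = 1%g.
Proof.
move=> Hs Ns; apply: contrapT => s1; have := p_gt0 Hs s1.
by rewrite (_ : p s = 0)// ltxx.
Qed.

Let p_mulN v g : N v -> p (v * g)%g = p g.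
Proof.
rewrite /N /= => v0; apply/eqP; rewrite eq_le; apply/andP; split.
  by rewrite (le_trans (pM v g))// v0 add0r.
by rewrite -{1}(mulKg v g) (le_trans (pM _ _))// pV v0 add0r.
Qed.

Let compact_ball r K : compact K -> (forall g, p g <= r -> K g) ->
  compact [set g | p g <= r].
Proof.
move=> cK rK; apply: (subclosed_compact _ cK) => //.
apply: (@preimage_closed _ _ p [set x | x <= r]); last exact: closed_le.
by move=> x _; exact: p_cont.
Qed.

Let Hsize n : exists F : seq G, [/\ uniq F, size F = n & forall s, s \in F -> H s].
Proof.
have [F [uF sF HF]] := accH filterT n.
by exists F; split => // s /HF[].
Qed.

Let p_near1 (e : R) : 0 < e -> nbhs (1%g : G) [set g | p g <= e].
Proof.
move=> e0; have /(@cvgrPdist_le _ _ _ (nbhs (1%g : G)))/(_ _ e0) := @p_cont 1%g.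
apply: filterS => g /=; rewrite p1 sub0r normrN; apply: le_trans.
exact: ler_norm.
Qed.

Let small_H (e : R) : 0 < e -> exists2 s, H s & 0 < p s <= e.
Proof.
move=> e0; have [F [uF sF HF]] := accH (p_near1 e0) 2.
have [s sF' s1] : exists2 s, s \in F & s != 1%g.
  move: F uF sF {HF} => [|a [|b []]]//=; rewrite inE andbT => ab _.
  have [a1|a1] := eqVneq a 1%g; last by exists a; rewrite // mem_head.
  by exists b; rewrite ?in_cons ?eqxx ?orbT// -a1 eq_sym.
exists s; first by have [] := HF s sF'.
by have [Hs ps] := HF s sF'; rewrite p_gt0//; exact/eqP.
Qed.

Hypothesis inj : injective_bimodule (@convolution R G) (@C0_lact R G) (@C0_ract R G).

(** As [H] accumulates at 1, it has elements with [p] positive and arbitrarily small; they are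
    chosen so that the heights [p (b k)] decrease as fast as the tents require. *)
Let bumps : exists (r : R) (b : nat -> G), [/\ 0 < r, compact [set g | p g <= r],
  2%:R * p (b 0%N) <= r, forall k, 0 < p (b k) & forall k, p (b k.+1) < p (b k) / 4%:R].
Proof.
have [r r0 [K cK rK]] := p_compact.
have [s0 _ /andP[s00 s0r]] := small_H (divr_gt0 r0 (ltr0n R 2)).
have nx (q : {g : G | 0 < p g}) : {g : {g : G | 0 < p g} | p (val g) < p (val q) / 4%:R}.
  apply: cid; have [s _ /andP[ps sq]] := small_H (divr_gt0 (valP q) (ltr0n R 8)).
  exists (exist _ s ps) => /=; apply: (le_lt_trans sq).
  by have := valP q; lra.
pose b := fix b n : {g : G | 0 < p g} :=
  if n is n'.+1 then sval (nx (b n')) else exist _ s0 s00.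
exists r, (fun n => val (b n)); split => //.
- exact: compact_ball cK rK.
- by rewrite mulrC -ler_pdivlMr.
- by move=> k; exact: valP (b k).
- by move=> k; exact: (svalP (nx (b k))).
Qed.

(** The limit [e] of tents in [p] is alternately 1 and 0 along [b]. The bound on sums forces [f = e]
    wherever [p > 0], whence [f] is constant on [N]; but [b] accumulates on [N], where [f] would be
    both 1 and 0. *)
Lemma accumulating_contradiction : False.
Proof.
have [r [b [r0 cr br a_gt0 a_dec]]] := bumps.
pose a k := p (b k).
pose hr n (z : G) : R := tents a n (p z).
have hr01 n z : 0 <= hr n z <= 1 by exact: tents01.
have hr_cont n : continuous (hr n).
  move=> z; apply: (@continuous_comp _ _ _ p (tents a n)); first exact: p_cont.
  exact: tents_continuous.
have hC n : (fun z => (hr n z)%:C : R[i]^o) \in @C0_pred R G.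
  apply/mem_set; split.
    apply/complex_continuousP => x e e0.
    have /(@cvgrPdist_le _ _ _ (nbhs x))/(_ _ e0) := hr_cont n x.
    by apply: filterS => y; rewrite -rmorphB rnormC distrC.
  move=> e e0; exists [set g | p g <= r] => // z /negP; rewrite -ltNge => rz.
  have -> : hr n z = 0; last by rewrite rnorm0 ltW.
  rewrite /hr (@tents_stable _ a a_gt0 a_dec 0 n)//.
  by rewrite (le_trans br)// ltW.
pose h n : C0 R G := MkC0 (hC n).
have hE n z : h n z = (hr n z)%:C by [].
pose W n : set G := [set z | p z < 2%:R * a n.*2].
have a_mono m n : (m <= n)%N -> a n <= a m by exact: a_le.
have h1 n z : rnorm (h n z) <= 1.
  by rewrite hE rnormC; have /andP[h0 h1] := hr01 n z; rewrite ger0_norm.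
have h2 n m z : (n <= m)%N -> rnorm (h m z - h n z) <= 1.
  move=> _; rewrite !hE -rmorphB rnormC ler_norml.
  by have := hr01 n z; have := hr01 m z; move=> /andP[? ?] /andP[? ?]; apply/andP; split; lra.
have h3 n m z : (n <= m)%N -> ~ W n z -> h m z = h n z.
  move=> nm /negP; rewrite -leNgt => Wz; rewrite !hE /hr.
  by rewrite (tents_stable a_gt0 a_dec nm Wz).
(* On [N] every [h n] is 0; elsewhere [h n z] is stationary once [2 a (2n) <= p z]. *)
have /choice[nu Hnu] : forall z, exists n, forall m, (n <= m)%N -> h m z = h n z.
  move=> z; have [z0|z0] := eqVneq (p z) 0.
    by exists 0%N => m _; rewrite !hE /hr z0 !tents_at0.
  have pz : 0 < p z / 2%:R by rewrite divr_gt0// lt_neqAle eq_sym z0 p_ge0.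
  have [n an] := a_small a_gt0 a_dec pz.
  exists n => m nm; apply: h3 => //; rewrite /W /=; apply/negP; rewrite -leNgt.
  rewrite mulrC -ler_pdivlMr// (le_trans _ (ltW an))// a_mono//.
  by rewrite -addnn leq_addr.
pose e z := h (nu z) z.
have h4 z : exists n, forall m, (n <= m)%N -> h m z = e z by exists (nu z); exact: Hnu.
have e_p z z' : p z = p z' -> e z = e z'.
  move=> zz; rewrite /e -(Hnu z (maxn (nu z) (nu z')) (leq_maxl _ _)).
  by rewrite -(Hnu z' (maxn (nu z) (nu z')) (leq_maxr _ _)) !hE /hr zz.
have W_dec n m : (n <= m)%N -> W m `<=` W n.
  move=> nm z; rewrite /W /= => /lt_le_trans; apply.
  by rewrite ler_wpM2l// a_mono// leq_double.
have a_small2 d : 0 < d -> exists n, a n.*2 < d.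
  move=> d0; have [n an] := a_small a_gt0 a_dec d0; exists n.
  by rewrite (le_lt_trans _ an)// a_mono// -addnn leq_addr.
have W_sep s : H s -> s <> 1%g -> exists n, forall z, W n z -> ~ W n (z * s)%g.
  move=> Hs s1; have ps : 0 < p s / 4%:R by rewrite divr_gt0// p_gt0.
  have [n an] := a_small2 _ ps; exists n => z; rewrite /W /= => Wz Wzs.
  have := pM z^-1%g (z * s)%g; rewrite mulKg pV => H2.
  by move: H2; apply/negP; rewrite -ltNge; lra.
have oW n : open (W n).
  have /continuousP c := @p_cont.
  exact: (c [set x | x < 2%:R * a n.*2] (@open_lt _ _)).
have bW n : borel_set (W n) by exact: sub_sigma_algebra.
have cN : compact N.
  suff -> : N = [set g | p g <= 0].
    apply: (compact_ball cr) => g /= g0.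
    by rewrite (le_trans g0)// ltW.
  apply/seteqP; split => g; rewrite /N /=; first by move->.
  by move=> g0; apply/eqP; rewrite eq_le g0 p_ge0.
(* Passing from [t'] to [t] costs less than [a (2m)], and [2 a (2n)] is below [a (2m) / 2]; the sum
   is below [2 a (2m)]. *)
have W_shift m n (t t' y : G) : (m < n)%N -> p (t * t'^-1)%g < a m.*2 ->
    W n (t' * y)%g -> W m (t * y)%g.
  move=> mn tt Wy; rewrite /W /=.
  have := pM (t * t'^-1)%g (t' * y)%g; rewrite !mulgA mulgVK => /le_lt_trans; apply.
  have an : a n.*2 <= a m.*2.+1.
    by apply: a_mono; rewrite (@leq_trans m.+1.*2) ?leq_double.
  by move: Wy; rewrite /W /=; have := a_dec m.*2; have := a_gt0 m.*2; rewrite -/(a _) -/(a _); lra.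
(* Otherwise every [n] has a bad translation [t_ n]. Tightness confines these to a compact set. For
   [t_ n] near a cluster point [t] the bad set lies in [F m t], and the [F m t] decrease to a part
   of the coset of [t^-1] outside [cosets N g], which is null. *)
have W_diffuse (x : measure_algebra R G) g : covers N x g -> forall d : R, 0 < d ->
    exists n, forall t, mass x (~` cosets N g `&` [set y | W n (t * y)%g]) <= d.
  move=> cg d d0; pose S := ~` cosets N g.
  have bS : borel_set S.
    by apply: measurableC; apply: borel_cosets.
  pose F n t := S `&` [set y | W n (t * y)%g].
  have bF n t : borel_set (F n t).
    apply: measurableI => //.
    exact: borel_preimage (@mulgl_continuous G t) (bW n).
  apply: contrapT => /forallNP nF.
  have /choice[t_ ht] : forall n, exists t, d < mass x (F n t).
    by move=> n; have /existsNP[t /negP] := nF n; rewrite -ltNge; exists t.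
  have [K cK mK] := mass_tight x d0.
  pose B := [set g | p g <= r].
  have cL : compact ((fun q : G * G => q.1 * q.2^-1)%g @` (B `*` K)).
    apply: continuous_compact; last exact: compact_setX.
    apply: continuous_subspaceT => q.
    apply: (@continuous_comp _ _ _ (fun q : G * G => (q.1, q.2^-1)%g)
      (fun q : G * G => (q.1 * q.2)%g)); last exact: mulg_continuous.
    apply: cvg_pair; first exact: cvg_fst.
    by apply: (@continuous_comp _ _ _ snd (fun y : G => y^-1)%g);
      [exact: cvg_snd|exact: invg_continuous].
  have tL n : ((fun q : G * G => q.1 * q.2^-1)%g @` (B `*` K)) (t_ n).
    apply: contrapT => nL; have := ht n; apply/negP; rewrite -leNgt.
    rewrite (le_trans _ mK)// mass_le//.
      by apply: measurableC; exact: compact_borel.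
    move=> y [_ Wy] Ky; apply: nL; exists (t_ n * y, y)%g; last by rewrite /= mulgK.
    split => //=; rewrite /B /= (le_trans (ltW Wy))// (le_trans _ br)//.
    by rewrite ler_wpM2l// a_mono.
  have [t _ clt] := compact_cluster_seq cL tL.
  have [m Hm] : exists m, mass x (F m t) <= d.
    apply: mass_cvg0 => //.
      by move=> i j ij y [Sy Wy]; split => //; exact: W_dec ij _ Wy.
    have IF : \bigcap_n F n t `<=` S `&` lcoset N t^-1%g.
      move=> y Fy; split; first by have [] := Fy 0%N I.
      rewrite /lcoset /N /= invgK; apply/eqP; rewrite eq_le p_ge0 andbT.
      apply/ler_addgt0Pl => d' d'0; rewrite addr0.
      have [n an] := a_small2 _ (divr_gt0 d'0 (ltr0n R 2)).
      by have [_] := Fy n I; rewrite /W /=; lra.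
    have bL : borel_set (lcoset N t^-1%g) by exact: borel_lcoset.
    apply/eqP; rewrite eq_le mass_ge0 andbT.
    have [tg|tg] := pselect (cosets N g t^-1%g).
      rewrite (_ : \bigcap_n F n t = set0) ?mass0// -subset0 => y /IF[Sy ty].
      by apply: Sy; exact: (@lcoset_sub G N NM g t^-1%g).
    have [<-|/cg//] := eqVneq (mass x (lcoset N t^-1%g)) 0.
    rewrite mass_le//; first by apply: bigcapT_measurable => k; exact: bF.
    by move=> y /IF[].
  have nt : nbhs t [set t' | p (t * t'^-1)%g < a m.*2].
    have c : continuous (fun t' : G => p (t * t'^-1)%g).
      move=> t'; apply: (@continuous_comp _ _ _ (fun t' : G => t * t'^-1)%g p);
        last exact: p_cont.
      apply: (@continuous_comp _ _ _ (fun t' : G => t'^-1)%g (fun y => t * y)%g).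
        exact: invg_continuous.
      exact: mulgl_continuous.
    have /continuousP oc := c; have := oc [set x | x < a m.*2] (@open_lt _ _).
    move=> oT; apply: open_nbhs_nbhs; split; first exact: oT.
    by rewrite /preimage /= mulgV p1; exact: a_gt0.
  have [n mn tn] := clt _ nt m.+1.
  have := ht n; apply/negP; rewrite -leNgt (le_trans _ Hm)// mass_le//.
  by move=> y [Sy Wy]; split => //; exact: W_shift mn tn Wy.
have [f [C HC]] := @injective_obstruction R G N H cN N1 NM NV H1 HM HV p_conj NH Hsize
  code code_inj inj h W e h1 h2 h3 h4 W_dec W_sep bW W_diffuse.
(* If [f z] were not [e z], then near [z] and for all large [n] the function [f - h n] would stay
   within [|w| / 2] of a nonzero [w]; summing over [k] elements of [H] close to 1 would exceed
   [C]. *)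
have fe z : 0 < p z -> f z = e z.
  move=> pz; apply: contrapT => fz.
  have [n1 an1] := a_small2 _ (divr_gt0 pz (ltr0n R 4)).
  have stab y : p z / 2%:R <= p y -> forall n, (n1 <= n)%N -> h n y = h n1 y.
    move=> py n n1n; apply: h3 => //; rewrite /W /=; apply/negP; rewrite -leNgt.
    by rewrite (le_trans _ py)//; lra.
  pose w := f z - h n1 z.
  have w0 : 0 < rnorm w.
    apply: lt0_rnorm; rewrite /w subr_eq0; apply/eqP => fh; apply: fz.
    rewrite fh /e -(Hnu z (maxn (nu z) n1) (leq_maxl _ _)) stab ?leq_maxr//.
    by rewrite ler_pdivrMr// ler_peMr// ?ler1n.
  pose V := [set v | p z / 2%:R <= p (z * v)%g /\
    rnorm (f (z * v)%g - h n1 (z * v)%g - w) <= rnorm w / 2%:R].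
  have nV : nbhs (1%g : G) V.
    have n1' : nbhs (1%g : G) [set v | p z / 2%:R <= p (z * v)%g].
      move: (p_near1 (divr_gt0 pz (ltr0n R 2))); apply: filterS => v /= pv.
      by have := pM (z * v)%g v^-1%g; rewrite mulgK pV; lra.
    have n2 : nbhs (1%g : G)
        [set v | rnorm (f (z * v)%g - h n1 (z * v)%g - w) <= rnorm w / 2%:R].
      have w2 : 0 < rnorm w / 2%:R by rewrite divr_gt0.
      have /complex_continuousP/(_ 1%g _ w2) :=
        @C0_continuous _ _ (shift z 1%g f - shift z 1%g (h n1)).
      apply: filterS => v.
      change (rnorm ((f (z * v * 1)%g - h n1 (z * v * 1)%g) -
        (f (z * 1 * 1)%g - h n1 (z * 1 * 1)%g)) <= rnorm w / 2%:R ->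
        rnorm (f (z * v)%g - h n1 (z * v)%g - w) <= rnorm w / 2%:R).
      by rewrite !mulg1.
    by apply: filterS (filterI n1' n2) => v [? ?]; split.
  pose k := (Num.truncn (2%:R * C / rnorm w)).+1.
  have [F [uF sF HF]] := accH nV k.
  have [n0 Hn0] := HC F uF (fun s sF' => (HF s sF').1).
  have := Hn0 _ (leq_maxl n0 n1) z; apply/negP; rewrite -ltNge.
  have -> : \sum_(s <- F) (f (z * s)%g - h (maxn n0 n1) (z * s)%g) =
      \sum_(s <- F) (f (z * s)%g - h n1 (z * s)%g - w) + k%:R * w.
    rewrite -sF mulr_natl -(iter_addr_0 (size F) w) -(count_predT F) -big_const_seq.
    rewrite -big_split; apply: eq_big_seq => s /HF[_ [pzs _]].
    by rewrite (stab _ pzs _ (leq_maxr n0 n1)) [RHS]subrK.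
  have S1 : rnorm (\sum_(s <- F) (f (z * s)%g - h n1 (z * s)%g - w)) <=
      k%:R * (rnorm w / 2%:R).
    rewrite (le_trans (rnorm_sum _ _ _))// big_seq.
    rewrite (le_trans (ler_sum _ (G := fun=> rnorm w / 2%:R) _))//.
      by move=> s /HF[_ []].
    by rewrite -big_seq big_const_seq count_predT iter_addr_0 sF -[leLHS]mulr_natl.
  set S := \sum_(s <- F) _ in S1 *.
  have S2 : k%:R * rnorm w <= rnorm (S + k%:R * w) + rnorm S.
    rewrite -rnorm_nat -rnormM -[X in rnorm X <= _](addKr S) addrC.
    by rewrite (le_trans (rnormD _ _))// rnormN.
  have kw : 2%:R * C < k%:R * rnorm w by rewrite -ltr_pdivrMr// truncnS_gt.
  lra.
(* For [s] in [H] close to 1 and distinct from it, [v s] and [s] have the same positive [p], hence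
   the same [e], and [f = e] at both. *)
have f_const v : N v -> f v = f 1%g.
  move=> Nv; apply/eqP; rewrite -subr_eq0; apply: contrapT => /negP fv.
  have d0 : 0 < rnorm (f v - f 1%g) / 4%:R by rewrite divr_gt0// lt0_rnorm.
  have n1 : nbhs (1%g : G)
      [set y | rnorm (f (v * y)%g - f v) <= rnorm (f v - f 1%g) / 4%:R].
    have /complex_continuousP/(_ 1%g _ d0) := @C0_continuous _ _ (shift v 1%g f).
    apply: filterS => y /=.
    by rewrite !mulg1.
  have n2 : nbhs (1%g : G) [set y | rnorm (f y - f 1%g) <= rnorm (f v - f 1%g) / 4%:R].
    by have /complex_continuousP/(_ 1%g _ d0) := @C0_continuous _ _ f.
  have [F [uF sF HF]] := accH (filterI n1 n2) 2.
  have [s sF' s1] : exists2 s, s \in F & s != 1%g.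
    move: F uF sF {HF} => [|y1 [|y2 []]]//=; rewrite inE andbT => y12 _.
    have [y11|y11] := eqVneq y1 1%g; last by exists y1; rewrite // mem_head.
    by exists y2; rewrite ?in_cons ?eqxx ?orbT// -y11 eq_sym.
  have [Hs [/= fvs fs]] := HF s sF'.
  have ps : 0 < p s by apply: p_gt0 => //; exact/eqP.
  have pvs : 0 < p (v * s)%g by rewrite p_mulN.
  have e1 : f (v * s)%g = f s by rewrite (fe _ pvs) (fe _ ps); apply: e_p; rewrite p_mulN.
  rewrite e1 in fvs.
  have : rnorm (f v - f 1%g) <= rnorm (f s - f v) + rnorm (f s - f 1%g).
    rewrite -[X in rnorm X <= _](subrKA (f s)) (rnormBC (f s) (f v)).
    exact: rnormD.
  apply/negP; rewrite -ltNge; move: d0 fvs fs.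
  move: (rnorm (f v - _)) (rnorm (f s - f v)) (rnorm (f s - f 1%g)) => *; lra.
(* The heights of the [b (q k)] tend to 0, so their cluster point lies in [N], where [f] takes the
   value [f 1]. *)
have limit (c : R[i]) (q : nat -> nat) : (forall k, (k <= q k)%N) ->
    (forall k, f (b (q k)) = c) -> f 1%g = c.
  move=> qk fq; have bB k : [set g | p g <= r] (b (q k)).
    rewrite /= (le_trans _ br)//; have h0 : p (b (q k)) <= p (b 0%N) := a_mono 0%N (q k) isT.
    by rewrite (le_trans h0)// ler_peMl ?ler1n// ltW.
  have [x _ clx] := compact_cluster_seq cr bB.
  have Nx : N x.
    rewrite /N /=; apply/eqP; rewrite eq_le p_ge0 andbT.
    apply/ler_addgt0Pl => d d0; rewrite addr0.
    have d2 : 0 < d / 2%:R by rewrite divr_gt0.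
    have /(@cvgrPdist_le _ _ _ (nbhs x))/(_ _ d2) nx := @p_cont x.
    have [n an] : exists n, a n < d / 2%:R := a_small a_gt0 a_dec d2.
    have [m nm /= pm] := clx _ nx n.
    have pxm : p x - p (b (q m)) <= d / 2%:R by rewrite (le_trans (ler_norm _)).
    have am : p (b (q m)) <= a n by apply: a_mono; exact: leq_trans (qk m).
    lra.
  rewrite -(f_const x Nx); apply/eqP; rewrite -subr_eq0; apply: contrapT => /negP fx.
  have d0 : 0 < rnorm (f x - c) / 2%:R by rewrite divr_gt0// lt0_rnorm.
  have /complex_continuousP/(_ x _ d0) nx := @C0_continuous _ _ f.
  have [m _ /=] := clx _ nx 0%N; rewrite fq rnormBC; apply/negP; rewrite -ltNge.
  by rewrite ltr_pdivrMr// ltr_pMr ?ltr1n// lt0_rnorm.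
have eb k : e (b k.*2) = 1.
  have [n Hn] := h4 (b k.*2).
  rewrite -(Hn _ (leq_maxl n k.+1)) hE /hr -/(a _) tents_even//.
  exact: leq_maxr.
have eb' k : e (b k.*2.+1) = 0.
  have [n Hn] := h4 (b k.*2.+1).
  by rewrite -(Hn _ (leqnn n)) hE /hr -/(a _) tents_odd.
have f1 : f 1%g = 1.
  apply: (limit 1 double) => [k|k]; first by rewrite -addnn leq_addr.
  by rewrite fe ?eb//; exact: a_gt0.
have f0 : f 1%g = 0.
  apply: (limit 0 (fun k => k.*2.+1)) => [k|k].
    by rewrite -addnn leqW// leq_addr.
  by rewrite fe ?eb'//; exact: a_gt0.
by move/eqP : f1; rewrite f0 eq_sym oner_eq0.
Qed.

End accumulating_case.

(** * A pseudonorm adapted to H *)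

Section nondiscrete_case.
Context (R : realType) (G : lcGroupType).
Variables (H : set G) (code : G -> nat) (enum : nat -> G).
Hypothesis H1 : H 1%g.
Hypothesis HM : forall x y, H x -> H y -> H (x * y)%g.
Hypothesis HV : forall x, H x -> H x^-1%g.
Hypothesis code_inj : forall s t, H s -> H t -> code s = code t -> s = t.
Hypothesis enumP : forall s, H s -> exists i, enum i = s.
Hypothesis enumH : forall i, H (enum i).
Hypothesis accH : forall V, nbhs (1%g : G) V -> forall n, exists F : seq G,
  [/\ uniq F, size F = n & forall s, s \in F -> H s /\ V s].

Let phi (s : G) := projT1 (cid (separating_C0 R s)).

Let phiP s : [/\ forall z, rnorm (phi s z) <= 1, phi s 1%g = 1 & s <> 1%g -> phi s s = 0].
Proof. exact: projT2 (cid (separating_C0 R s)). Qed.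

(* The functions z |-> phi s (z t), s and t in H: a countable family that
   separates H from 1 and is invariant under right translation by H. *)
Let psi i : C0 R G :=
  let ab := odflt (0, 0)%N (unpickle i) in shift 1%g (enum ab.2) (phi (enum ab.1)).

Let psiE i z : psi i z =
  phi (enum (odflt (0, 0)%N (unpickle i)).1) (z * enum (odflt (0, 0)%N (unpickle i)).2)%g.
Proof. by rewrite /psi /= mul1g. Qed.

Let psi_le1 i z : rnorm (psi i z) <= 1.
Proof. by rewrite psiE; have [->] := phiP (enum (odflt (0, 0)%N (unpickle i)).1). Qed.

Let psi_ex s t : H s -> H t -> exists i, forall z, psi i z = phi s (z * t)%g.
Proof.
move=> /enumP[a <-] /enumP[b <-]; exists (pickle (a, b)) => z.
by rewrite psiE pickleK.
Qed.

Let p := pnorm psi.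

Let p_ge0 g : 0 <= p g. Proof. exact: pnorm_ge0. Qed.
Let p1 : p 1%g = 0. Proof. exact: pnorm1. Qed.
Let pM g h : p (g * h)%g <= p g + p h. Proof. exact: pnormM. Qed.
Let pV g : p g^-1%g = p g. Proof. exact: pnormV. Qed.
Let p_cont : continuous (p : G -> R). Proof. exact: pnorm_continuous. Qed.
Let p_eq0 g : p g = 0 <-> forall i x, psi i (x * g)%g = psi i x.
Proof. exact: pnorm_eq0. Qed.
(** For [p g] small, [phi 1] at [g] is within 1/2 of its value 1 at the identity, whereas it is at
    most 1/4 in modulus outside [K]. *)
Let p_compact : exists2 r, 0 < r & exists2 K, compact K & forall g, p g <= r -> K g.
Proof.
have [i Hi] := psi_ex H1 H1; have [_ phi1 _] := phiP 1%g.
have [K cK fK] := C0_vanishes (phi 1%g) (divr_gt0 ltr01 (ltr0n R 4)).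
exists (1 / 2%:R / i.+1%:R); first by rewrite !divr_gt0.
exists K => // g pg; apply: contrapT => /fK fg.
have := pnorm_ge psi_le1 i g 1%g; rewrite -/p !Hi mul1g !mulg1 phi1 => H2.
have H3 : i.+1%:R * p g <= 1 / 2%:R by rewrite mulrC -ler_pdivlMr.
have : rnorm (1 : R[i]) <= 1 / 2%:R + 1 / 4%:R.
  rewrite -[X in rnorm X](subKr (phi 1%g g)) opprB addrC.
  rewrite (le_trans (rnormD _ _))//= lerD//.
  by rewrite rnormBC (le_trans H2).
by rewrite rnorm1; apply/negP; rewrite -ltNge; lra.
Qed.

Let p_gt0 s : H s -> s <> 1%g -> 0 < p s.
Proof.
move=> Hs s1; rewrite lt_neqAle p_ge0 andbT eq_sym; apply/eqP => /p_eq0 ps.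
have [i Hi] := psi_ex Hs H1; have [_ phi1 phis] := phiP s.
have := ps i 1%g; rewrite !Hi mul1g !mulg1 phi1 phis//.
by move/eqP; rewrite eq_sym oner_eq0.
Qed.

(** Conjugation by [s] amounts to a right translation of the functions [psi i] by an element of [H],
    and the family is invariant under these. *)
Let p_conj s v : H s -> (p v = 0 <-> p (s^-1 * v * s)%g = 0).
Proof.
have K t w : H t -> p w = 0 -> p (t^-1 * w * t)%g = 0.
  move=> Ht /p_eq0 Nw; apply/p_eq0 => i x; rewrite !psiE.
  set b := enum _.2; set a := enum _.1.
  have [j Hj] : exists j, forall z, psi j z = phi a (z * (t * b))%g.
    by apply: psi_ex; [exact: enumH|apply: HM => //; exact: enumH].
  have := Nw j (x * t^-1)%g; rewrite !Hj !mulgA.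
  by rewrite (mulgVK t x).
move=> Hs; split; first exact: K.
move=> /(K _ _ (HV Hs)); rewrite invgK !mulgA mulgV mul1g.
by rewrite mulgK.
Qed.

Hypothesis inj : injective_bimodule (@convolution R G) (@C0_lact R G) (@C0_ract R G).

Lemma not_injective_accumulating : False.
Proof.
exact: (accumulating_contradiction H1 HM HV code_inj accH p_ge0 p1 pM pV p_cont p_gt0
  p_conj p_compact inj).
Qed.

End nondiscrete_case.

(** * Finite groups *)

Lemma C0_scaleE (R : realType) (G : lcGroupType) (c : R[i]) (f : C0 R G) x :
  (c *: f) x = c * f x.
Proof. by []. Qed.

Section finite_groups.
Context (R : realType) (G : lcGroupType).
Hypothesis finG : finite_set [set: G].
Local Notation M := (measure_algebra R G).
Local Notation A1 := (unitization M).
Local Notation E := (C0 R G).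
Local Notation BE := (blin (ptensor A1 A1) E).
Local Notation inA := (@unitization_in R M).
Local Notation del s := (dirac_measure R (s : G)).

Let finite_borel (A : set G) : borel_set A.
Proof. by apply: compact_borel; apply: finite_compact; exact: sub_finite_set finG. Qed.

Let elements_ex : exists l : seq G, uniq l /\ forall g, g \in l.
Proof.
have [l Gl] := (finite_seqP [set: G]).1 finG.
exists (undup l); split; first exact: undup_uniq.
by move=> g; rewrite mem_undup; have : [set: G] g by []; rewrite Gl.
Qed.

Let l := projT1 (cid elements_ex).
Let l_uniq : uniq l. Proof. by have [] := projT2 (cid elements_ex). Qed.
Let l_all g : g \in l. Proof. by have [_] := projT2 (cid elements_ex); exact. Qed.

Let sum_reindex (V : zmodType) (F : G -> V) (phi : G -> G) : injective phi ->
  \sum_(g <- l) F (phi g) = \sum_(g <- l) F g.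
Proof.
move=> phi_inj; rewrite -(big_map phi xpredT F); apply: perm_big.
have um : uniq (map phi l) by rewrite map_inj_uniq.
have [_] := uniq_min_size um (fun x _ => l_all x) (eq_leq (esym (size_map phi l))).
by move=> H; apply: uniq_perm.
Qed.

Let measure_sum (a : M) : a = \sum_(k <- l) (a [set k] : R[i]) *: del k.
Proof.
apply: measure_eq => f; have bf := bborel_C0 f.
have -> : complex_integral a f = \sum_(k <- l) a [set k] * f k.
  have fE : (f : G -> R[i]) = (fun x => \sum_(k <- l) f k * (x \in [set k])%:R).
    apply/funext => x; rewrite (bigD1_seq x)//= mem_set// mulr1 big1 ?addr0//.
    by move=> k kx; rewrite memNset ?mulr0// => /= xk; rewrite xk eqxx in kx.
  rewrite {1}fE (bfunctional_sum (complex_integral_bfunctional a)).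
    apply: eq_bigr => k _.
    rewrite (bfunctionalZ (complex_integral_bfunctional a)); last exact: bborel_indic.
    by rewrite complex_integral_indic// mulrC.
  by move=> k; apply: bborelZ; exact: bborel_indic.
elim: l => [|k r ih].
  rewrite !big_nil; have := complex_integral_measure_lin (-1) 0 0 bf.
  by rewrite scaler0 addr0 mulN1r addNr.
by rewrite !big_cons complex_integral_measure_lin// complex_integral_dirac// ih.
Qed.

(** Reduces the module conditions to point masses, for which convolution is translation. *)
Let linear_sum (V : lmodType R[i]) (phi : M -> V) : linear phi ->
  forall a, phi a = \sum_(k <- l) (a [set k] : R[i]) *: phi (del k).
Proof.
move=> lphi a; rewrite {1}(measure_sum a).
have phi0 : phi 0 = 0.
  by have := lphi (-1) 0 0; rewrite scaler0 addr0 scaleN1r addNr.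
elim: l => [|k r ih]; first by rewrite !big_nil.
by rewrite !big_cons lphi ih.
Qed.

Let inA_lin : linear inA.
Proof. by move=> c a b; rewrite /unitization_in; congr (_, _); rewrite /= scaler0 addr0. Qed.

Lemma rnorm_shift s t (f : E) : rnorm (shift s t f) <= rnorm f.
Proof. by apply: rnorm_C0_le => x; exact: (rnorm_C0_ge f (s * x * t)%g). Qed.

Lemma blin_eval_le (X Y : normedModType R[i]) (x : X) : exists2 C : R, 0 <= C &
  forall T : blin X Y, rnorm (T x) <= C * rnorm T.
Proof.
exists (rnorm x); first exact: rnorm_ge0.
move=> T; have [->|x0] := eqVneq x 0; first by rewrite linear0 !rnorm0 mul0r.
have nx : 0 < rnorm x by exact: lt0_rnorm.
pose y := (rnorm x)^-1%:C *: x.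
have rx : rnorm (rnorm x)^-1%:C = (rnorm x)^-1 by rewrite rnormC ger0_norm// invr_ge0 ltW.
have Ty : rnorm (T y) <= rnorm T.
  apply: (@sup_norm_ub R (blin X Y) X [set x : X | rnorm x <= 1]
    (fun x (T : blin X Y) => rnorm (T x))) => [S|].
    have [_ [C SC]] := blinP S; exists `|C| => _ [z /= z1 <-].
    rewrite (le_trans (SC z))// (le_trans (ler_wpM2r (rnorm_ge0 z) (ler_norm C)))//.
    by rewrite ler_piMr.
  by rewrite /= rnormZ rx mulVf// gt_eqF.
have -> : T x = (rnorm x)%:C *: T y.
  by rewrite /y linearZ /= scalerA -rmorphM divff ?gt_eqF// scale1r.
rewrite rnormZ rnormC ger0_norm; last exact: ltW.
by apply: ler_wpM2l => //; exact: ltW.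
Qed.

Let val2 (T : BE) (g h : G) : E := T (inA (del g) \ox inA (del h)).

Let c : R[i] := ((size l)%:R * (size l)%:R)^-1.

(** The shift by [h] and [g] undoes the point masses at their inverses, so that every term equals
    [e] when [T] is [iota e]. *)
Let avg (T : BE) : E :=
  c *: \sum_(g <- l) \sum_(h <- l) shift h g (val2 T g^-1%g h^-1%g).

Let avgE T t : avg T t =
  c * \sum_(g <- l) \sum_(h <- l) val2 T g^-1%g h^-1%g (h * t * g)%g.
Proof.
rewrite /avg C0_scaleE C0_sumE; congr (_ * _); apply: eq_bigr => g _.
by rewrite C0_sumE.
Qed.

Let avg_blin : (avg : BE -> E) \in @blin_pred R BE E.
Proof.
apply/mem_set; split.
  move=> k S T; apply: C0_ext => t; rewrite C0_linE !avgE mulrCA -mulrDr.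
  congr (_ * _); rewrite mulr_sumr -big_split; apply: eq_bigr => g _ /=.
  rewrite mulr_sumr -big_split; apply: eq_bigr => h _ /=.
  exact: C0_linE.
have /choice[C HC] : forall gh : G * G, exists C : R, 0 <= C /\
    forall T : BE, rnorm (val2 T gh.1^-1%g gh.2^-1%g) <= C * rnorm T.
  move=> [g h]; have [C C0 HC] :=
    @blin_eval_le _ E (inA (del g^-1%g) \ox inA (del h^-1%g)).
  by exists C; split.
exists (rnorm c * \sum_(g <- l) \sum_(h <- l) C (g, h)) => T.
rewrite rnormZ -mulrA ler_wpM2l ?rnorm_ge0// mulr_suml.
rewrite (le_trans (rnorm_sum _ _ _))// ler_sum// => g _.
rewrite mulr_suml (le_trans (rnorm_sum _ _ _))// ler_sum// => h _.
by rewrite (le_trans (rnorm_shift _ _ _))//; have [_] := HC (g, h); exact.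
Qed.

Let theta_in a : theta (inA a) = a.
Proof. by rewrite /theta /= scale0r add0r. Qed.

Let mul_in a b : unitization_mul (@convolution R G) (inA a) (inA b) = inA (convolution a b).
Proof. by rewrite /unitization_mul /= !scale0r !addr0 mulr0. Qed.

Let sumZ2 (a : G -> R[i]) (F : G -> G -> G -> R[i]) :
  c * \sum_(g <- l) \sum_(h <- l) \sum_(k <- l) a k * F g h k =
  \sum_(k <- l) a k * (c * \sum_(g <- l) \sum_(h <- l) F g h k).
Proof.
transitivity (c * \sum_(k <- l) a k * \sum_(g <- l) \sum_(h <- l) F g h k).
  congr (_ * _); under eq_bigr do rewrite exchange_big.
  rewrite exchange_big; apply: eq_bigr => k _ /=.
  by rewrite mulr_sumr; apply: eq_bigr => g _; rewrite mulr_sumr.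
by rewrite mulr_sumr; apply: eq_bigr => k _; rewrite mulrCA.
Qed.

(** The module conditions are changes of variable in the double average: [g] to [k g] for the left
    action, [h] to [h k] for the right one. *)
Lemma finite_injective :
  injective_bimodule (@convolution R G) (@C0_lact R G) (@C0_ract R G).
Proof.
pose rho : blin BE E := Blin avg_blin.
have rhoE T : rho T = avg T by [].
exists rho; split.
- move=> e T eT; apply: C0_ext => t; rewrite rhoE avgE.
  rewrite (eq_bigr (fun _ => \sum_(h <- l) e t)) => [|g _]; last first.
    apply: eq_bigr => h _; rewrite /val2 eT unitization_ractE unitization_lactE !theta_in.
    by rewrite C0_ract_dirac C0_lact_dirac !mulgA mulVg mul1g mulgK.
  rewrite !big_const_seq !count_predT !iter_addr_0 -mulrnA -mulr_natl natrM mulrA.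
  rewrite /c mulVf ?mul1r// -natrM pnatr_eq0 -lt0n muln_gt0 andbb.
  by case: l (l_all 1%g).
- move=> a T aT H; apply: C0_ext => t; rewrite !rhoE.
  rewrite (linear_sum (phi := fun a => C0_lact a (avg T))); last first.
    by move=> k u v; exact: C0_lact_lin.
  transitivity (\sum_(k <- l) a [set k] * (c * \sum_(g <- l) \sum_(h <- l)
      val2 T (g^-1 * k)%g h^-1%g (h * t * g)%g)); last first.
    rewrite C0_sumE; apply: eq_bigr => k _.
    rewrite C0_scaleE C0_lact_dirac avgE; congr (_ * (_ * _)).
    rewrite -[LHS](@sum_reindex _ _ (fun g => k * g)%g); last exact: mulgI.
    by apply: eq_bigr => g _; apply: eq_bigr => h _; rewrite invgM mulgVK !mulgA.
  rewrite avgE -sumZ2; congr (_ * _); apply: eq_bigr => g _; apply: eq_bigr => h _.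
  rewrite /val2 H mul_in convolution_diracl.
  rewrite (linear_sum (phi := fun a => T (inA (ltrans g^-1%g a) \ox inA (del h^-1%g)))).
    rewrite C0_sumE; apply: eq_bigr => k _.
    rewrite C0_scaleE; congr (_ * T (inA _ \ox _) _).
    apply: measure_eq => f; have bf := bborel_C0 f.
    rewrite complex_integral_ltrans// !complex_integral_dirac//; exact: bborel_shiftl.
  have [lT _] := blinP T.
  by move=> k u v; rewrite ltrans_lin inA_lin tensorDl lT.
- move=> a T Ta H; apply: C0_ext => t; rewrite !rhoE.
  rewrite (linear_sum (phi := fun a => C0_ract (avg T) a)); last first.
    by move=> k u v; exact: C0_ract_lin.
  transitivity (\sum_(k <- l) a [set k] * (c * \sum_(g <- l) \sum_(h <- l)
      val2 T g^-1%g (k * h^-1)%g (h * t * g)%g)); last first.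
    rewrite C0_sumE; apply: eq_bigr => k _.
    rewrite C0_scaleE C0_ract_dirac avgE; congr (_ * (_ * _)).
    apply: eq_bigr => g _.
    rewrite -[LHS](@sum_reindex _ _ (fun h => h * k)%g); last exact: mulIg.
    by apply: eq_bigr => h _; rewrite invgM mulVKg !mulgA.
  rewrite avgE -sumZ2; congr (_ * _); apply: eq_bigr => g _; apply: eq_bigr => h _.
  rewrite /val2 H mul_in convolution_diracr.
  rewrite (linear_sum (phi := fun a => T (inA (del g^-1%g) \ox inA (rtrans h^-1%g a)))).
    rewrite C0_sumE; apply: eq_bigr => k _.
    rewrite C0_scaleE; congr (_ * T (_ \ox inA _) _).
    apply: measure_eq => f; have bf := bborel_C0 f.
    rewrite complex_integral_rtrans// !complex_integral_dirac//; exact: bborel_shiftr.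
  have [lT _] := blinP T.
  by move=> k u v; rewrite rtrans_lin inA_lin tensorDr lT.
Qed.

End finite_groups.

Theorem theorem2p5 (R : realType) (G : lcGroupType) :
  injective_bimodule (@convolution R G) (@C0_lact R G) (@C0_ract R G) <->
  finite_set [set: G].
Proof.
split; last exact: finite_injective.
move=> inj; apply: contrapT => infG.
have [op1|nop] := pselect (open [set (1%g : G)]).
  exact: (not_injective_discrete op1 infG inj).
have [H [code [enum [[H1 HM HV] code_inj [enumP enumH] accH]]]] := accumulating_subgroup R nop.
exact: (not_injective_accumulating H1 HM HV code_inj enumP enumH accH inj).
Qed.
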